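(* Let $\theta_1,\theta_2$ be real-valued functions on $(0,1)$. (a) If $\theta_1,\theta_2$ are positive and $\theta_1\approx\theta_2$, i.e. there are constants $0<c\le C<\infty$ with $c\,\theta_2(t)\le\theta_1(t)\le C\,\theta_2(t)$ for all $t\in(0,1)$, then $\Lambda_{\theta_1}=\Lambda_{\theta_2}$. (b) If $\theta_1(t)/\theta_2(t)\to\infty$ as $t\to0$ and $\theta_2$ is a positive continuous nonincreasing function satisfying $$\int_0\frac{dt}{t\,\theta_2(t)}=\infty,$$ then $\Lambda_{\theta_1}\neq\Lambda_{\theta_2}$; that is, there exists a sequence $\{z_k\}$ such that $\{z_k\}\in\Lambda_{\theta_2}$ but $\{z_k\}\notin\Lambda_{\theta_1}$.
   Context: $\mathbb{D}=\{z\in\mathbb{C}:|z|<1\}$, and $H^\infty$ is the space of bounded holomorphic functions on $\mathbb{D}$. All sequences $\{z_k\}\subset\mathbb{D}$ are infinite and satisfy $|z_k|\to1$. A sequence $\{z_k\}$ is separated if $\inf_{n\neq k}\left|\frac{z_n-z_k}{1-\overline{z}_n z_k}\right|>0$. For a real-valued function $\theta$ on $(0,1)$, a sequence $\{z_k\}$ is $\theta$-thin if there exists $f\in H^\infty$, $f\not\equiv0$, with $\sum_k(1-|z_k|)e^{\theta(1-|z_k|)}|f(z_k)|<\infty$ (if some $z_k=0$, the corresponding term is omitted). $\Lambda_\theta$ denotes the class of all separated $\theta$-thin sequences. $\int_0 g(t)\,dt=\infty$ means that $\int_0^{\varepsilon}g(t)\,dt=\infty$ for small $\varepsilon\in(0,1)$.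 *)

(* Defs.v *)
From Stdlib Require Import Reals.
From Coquelicot Require Import Coquelicot.
Open Scope R_scope.

Definition in_disc (z : C) : Prop := Cmod z < 1.

(* Elements of [Hinf] are functions on C constrained only on the disc: values
   outside the disc are irrelevant, since the disc is open and complex
   differentiability at a point is a local property. *)
Definition holomorphic_on_disc (f : C -> C) : Prop :=
  forall z : C, in_disc z ->
    ex_derive (K := C_AbsRing) (V := C_NormedModule) f z.

Definition Hinf (f : C -> C) : Prop :=
  holomorphic_on_disc f /\
  exists M : R, forall z : C, in_disc z -> Cmod (f z) <= M.

(* "f is not identically 0" as a function on the disc. *)
Definition nonzero_on_disc (f : C -> C) : Prop :=
  exists w : C, in_disc w /\ f w <> RtoC 0.

Definition disc_sequence (z : nat -> C) : Prop :=
  (forall k : nat, in_disc (z k)) /\ is_lim_seq (fun k => Cmod (z k)) 1.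

Definition pseudohyp (z w : C) : R :=
  Cmod ((z - w) / (1 - Cconj z * w))%C.

Definition separated (z : nat -> C) : Prop :=
  Rbar_lt 0 (Glb_Rbar (fun r : R =>
    exists n k : nat, n <> k /\ r = pseudohyp (z n) (z k))).

(* If z k = 0 then 1 - |z k| = 1 lies outside the domain (0,1) of theta, and
   the term is omitted. *)
Definition thin_term (theta : R -> R) (f : C -> C) (z : C) : R :=
  if Req_dec_T (Cmod z) 0 then 0
  else (1 - Cmod z) * exp (theta (1 - Cmod z)) * Cmod (f z).

Definition thin (theta : R -> R) (z : nat -> C) : Prop :=
  exists f : C -> C,
    Hinf f /\ nonzero_on_disc f /\
    ex_series (fun k => thin_term theta f (z k)).

Definition Lambda (theta : R -> R) (z : nat -> C) : Prop :=
  disc_sequence z /\ separated z /\ thin theta z.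

(* int_0^eps g = +infinity for all small eps > 0, the integral over (0, eps)
   being the limit of the proper integrals over [d, eps] as d tends to 0+.
   [RInt] is total, so this is meaningful for g Riemann integrable on compact
   subintervals of (0, eps], for instance continuous there. *)
Definition int_diverges_at_0 (g : R -> R) : Prop :=
  at_right 0 (fun eps =>
    filterlim (fun d => RInt g d eps) (at_right 0) (Rbar_locally p_infty)).

Definition positive_on_01 (theta : R -> R) : Prop :=
  forall t : R, 0 < t < 1 -> 0 < theta t.

Definition continuous_on_01 (theta : R -> R) : Prop :=
  forall t : R, 0 < t < 1 -> continuous theta t.

Definition nonincreasing_on_01 (theta : R -> R) : Prop :=
  forall s t : R, 0 < s -> s <= t -> t < 1 -> theta t <= theta s.

Definition comparable_on_01 (theta1 theta2 : R -> R) : Prop :=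
  exists c C : R, 0 < c /\ c <= C /\
    forall t : R, 0 < t < 1 ->
      c * theta2 t <= theta1 t /\ theta1 t <= C * theta2 t.

(* Main.v *)
(* Part (a): if [sum (1-|z_k|) e^theta1 |f| < oo], the points where
   [e^theta1 |f| > 1] satisfy the Blaschke condition, so a power of [f] times
   their Blaschke product is a witness for [theta2].

   Part (b): the points are the nodes of depth [2^-n] of a tree of dyadic
   intervals in which about [1 / theta2 (2^-n)] of the boundary, up to a slowly varying
   factor, survives at level [n].
   Let [u] be the Poisson integral of the uniform measure on the limit Cantor
   set; at a surviving node [u] is at least of order [theta2], so
   [f = exp (- c (u + i u~))] shows that the nodes are [theta2]-thin. Since
   [sum 1 / theta2 (2^-n) = oo], there are finite blocks [Z] of nodes with
   [sum_Z (1-|z|)] as large as desired. The residue theorem for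
   [f / (B_Z (z - w))] gives
     [|f w| <= C |B_Z w| (sup |f| + sum_Z (1-|z_k|) |f z_k| / d_k)],
   where [d_k] is the product of the pseudo-hyperbolic distances from [z_k] to the
   other points of [Z]. The tree structure gives [log (1/d_k) <= C_Z theta2],
   which is at most [theta1] once the levels of [Z] are deep enough. If the nodes were
   [theta1]-thin, the bracket would stay bounded while [B_Z w] tends to [0], so
   [f] would vanish. *)
Require Import Defs.
From Stdlib Require Import Reals Arith Lra Lia Psatz ClassicalEpsilon List.
From Stdlib Require FinFun.
From Coquelicot Require Import Coquelicot.
Open Scope R_scope.

(** * Complex differentiability and pointwise limits *)

(** The obstacle is a competition between two sums. To force [f] to vanish for [theta1], the finite
    blocks must have unbounded mass [sum (1-|z|)], whereas the [theta2] side needs one convergent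
    series over all blocks together. The slowly varying factor settles this: on block [m] the target
    for [2 ^ K n] is [kap * 2 ^ m * theta2 (2^-n)]. Divergence of [sum 1 / theta2] survives division
    by a constant, so the block can still be given a mass between [m] and [2 m + 2], but each of its
    terms now gains [exp (- 2 ^ m)]. For [theta1] the factor costs only a constant per block, and a
    block may begin arbitrarily deep, hence where [theta1 / theta2] exceeds that constant. The
    Cantor set makes the two estimates compatible: the measure is so concentrated that its Poisson
    integral at a node of level [n] is at least of order [2 ^ K n], and the same number, times the
    block mass, controls the sum over the block of [1 - rho^2] seen from that node, [rho] being the
    pseudo-hyperbolic distance. *)

Lemma Cconj_1 : Cconj 1 = RtoC 1.
Proof. unfold Cconj, RtoC; simpl; f_equal; ring. Qed.

Definition cdiff (f : C -> C) (z : C) : Prop :=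
  ex_derive (K := C_AbsRing) (V := C_NormedModule) f z.

Lemma lt_Rmin (x a b : R) : x < Rmin a b -> x < a /\ x < b.
Proof. intros H. assert (Hl := Rmin_l a b). assert (Hr := Rmin_r a b). lra. Qed.

Lemma is_cderive_iff (f : C -> C) (z l : C) :
  is_derive (K := C_AbsRing) (V := C_NormedModule) f z l <->
  forall eps : R, 0 < eps -> exists delta : R, 0 < delta /\
    forall w : C, Cmod (w - z) < delta ->
      Cmod (f w - f z - (w - z) * l) <= eps * Cmod (w - z).
Proof.
split.
- intros [_ H] eps Heps.
  assert (Hz : is_filter_lim (locally (T := AbsRing_UniformSpace C_AbsRing) z) z) by (intros P HP; exact HP).
  destruct (H z Hz (mkposreal eps Heps)) as [d Hd].
  exists d; split; [apply cond_pos|].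
  intros w Hw. exact (Hd w Hw).
- intros H; split; [apply is_linear_scal_l|].
  intros x Hx.
  assert (Hxz : z = x).
  { apply (is_filter_lim_locally_unique (K := C_AbsRing) (V := AbsRing_NormedModule C_AbsRing) z x Hx). }
  subst x. intros eps.
  destruct (H eps (cond_pos eps)) as [d [Hd Hw]].
  exists (mkposreal d Hd). intros w Hb. exact (Hw w Hb).
Qed.

Lemma cdiff_iff (f : C -> C) (z : C) :
  cdiff f z <-> exists l : C,
  forall eps : R, 0 < eps -> exists delta : R, 0 < delta /\
    forall w : C, Cmod (w - z) < delta ->
      Cmod (f w - f z - (w - z) * l) <= eps * Cmod (w - z).
Proof.
split.
- intros [l Hl]; exists l; now apply is_cderive_iff.
- intros [l Hl]; exists l; now apply is_cderive_iff.
Qed.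

Lemma Cmod_sub_le (a b : C) : Cmod (a - b) <= Cmod a + Cmod b.
Proof. eapply Rle_trans; [apply Cmod_triangle|]. rewrite Cmod_opp. lra. Qed.

Definition Clim (u : nat -> C) (l : C) : Prop :=
  is_lim_seq (fun n => Cmod (u n - l)) 0.

Lemma Clim_iff (u : nat -> C) (l : C) :
  Clim u l <-> forall eps : R, 0 < eps ->
    exists N : nat, forall n, (N <= n)%nat -> Cmod (u n - l) < eps.
Proof.
unfold Clim. rewrite <- is_lim_seq_spec. split.
- intros H eps He. destruct (H (mkposreal eps He)) as [N HN].
  exists N; intros n Hn. specialize (HN n Hn). simpl in HN.
  rewrite Rminus_0_r, Rabs_pos_eq in HN; [exact HN|apply Cmod_ge_0].
- intros H eps. destruct (H eps (cond_pos eps)) as [N HN].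
  exists N; intros n Hn.
  rewrite Rminus_0_r, Rabs_pos_eq; [auto|apply Cmod_ge_0].
Qed.

Lemma Re_Im_Cmod_le (c : C) : Rabs (Re c) <= Cmod c /\ Rabs (Im c) <= Cmod c.
Proof.
assert (H := Rmax_Cmod c). unfold Re, Im. split.
- eapply Rle_trans; [apply Rmax_l|exact H].
- eapply Rle_trans; [apply Rmax_r|exact H].
Qed.

Lemma Cmod_le_abs (c : C) : Cmod c <= Rabs (Re c) + Rabs (Im c).
Proof.
replace c with (RtoC (Re c) + Ci * RtoC (Im c))%C at 1.
2:{ destruct c as [x y]; unfold Ci, RtoC, Cplus, Cmult, Re, Im; simpl; f_equal; ring. }
eapply Rle_trans; [apply Cmod_triangle|].
rewrite Cmod_mult, !Cmod_R, Cmod_Ci. lra.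
Qed.

Lemma Ccauchy_lim (u : nat -> C) :
  (forall eps : R, 0 < eps -> exists N : nat, forall n m : nat,
     (N <= n)%nat -> (N <= m)%nat -> Cmod (u n - u m) < eps) ->
  exists l : C, Clim u l.
Proof.
intros H.
assert (Hc : forall p : C -> R,
  (forall a b, p (a - b)%C = p a - p b) -> (forall c, Rabs (p c) <= Cmod c) ->
  exists l : R, is_lim_seq (fun n => p (u n)) l).
{ intros p Hp Hb.
  assert (Hex : ex_finite_lim_seq (fun n => p (u n))).
  { apply ex_lim_seq_cauchy_corr. intros eps.
    destruct (H eps (cond_pos eps)) as [N HN]. exists N. intros n m Hn Hm.
    rewrite <- Hp. eapply Rle_lt_trans; [apply Hb|]. now apply HN. }
  exact Hex. }
destruct (Hc Re) as [x Hx].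
{ intros a b. reflexivity. }
{ intros c; apply Re_Im_Cmod_le. }
destruct (Hc Im) as [y Hy].
{ intros a b. reflexivity. }
{ intros c; apply Re_Im_Cmod_le. }
exists (x, y). unfold Clim.
apply is_lim_seq_le_le with (u := fun _ => 0)
  (w := fun n => Rabs (Re (u n) - x) + Rabs (Im (u n) - y)).
- intros n; split; [apply Cmod_ge_0|]. apply (Cmod_le_abs (u n - (x, y))).
- apply is_lim_seq_const.
- assert (Habs : forall (v : nat -> R) (l : R), is_lim_seq v l ->
    is_lim_seq (fun n => Rabs (v n - l)) 0).
  { intros v l Hv. replace (Finite 0) with (Rbar_abs (Finite 0)) by (simpl; f_equal; apply Rabs_R0).
    apply is_lim_seq_abs. replace 0 with (l - l) by ring.
    apply is_lim_seq_minus'; [exact Hv|apply is_lim_seq_const]. }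
  replace 0 with (0 + 0) by ring. apply is_lim_seq_plus'; now apply Habs.
Qed.

(** Serves twice: for the partial products of a Blaschke product and for the averages of kernels
    over the levels of the tree. *)
Lemma Clim_of_summable_increments (u : nat -> C) (b : nat -> R) :
  (forall n, Cmod (u (S n) - u n) <= b n) -> ex_series b -> exists l : C, Clim u l.
Proof.
intros Hu Hb.
assert (Hinc : forall n m, (n <= m)%nat -> Cmod (u (S m) - u n) <= sum_n_m b n m).
{ intros n m Hnm. induction Hnm as [|m Hnm IH].
  - rewrite sum_n_n. apply Hu.
  - rewrite sum_n_Sm by lia.
    replace (u (S (S m)) - u n)%C with ((u (S m) - u n) + (u (S (S m)) - u (S m)))%C by ring.
    eapply Rle_trans; [apply Cmod_triangle|].
    apply Rplus_le_compat; auto. }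
apply Ccauchy_lim. intros eps He.
destruct (Cauchy_ex_series b Hb (mkposreal eps He)) as [N HN]. simpl in HN.
assert (Hlt : forall n m, (N <= n)%nat -> (n <= m)%nat -> Cmod (u m - u n) < eps).
{ intros n m Hn Hm. destruct (Nat.eq_dec n m) as [<-|Hne].
  - replace (u n - u n)%C with (RtoC 0) by ring. now rewrite Cmod_0.
  - destruct m as [|m]; [lia|].
    eapply Rle_lt_trans; [apply Hinc; lia|].
    eapply Rle_lt_trans; [apply Rle_abs|]. apply (HN n m); lia. }
exists N. intros n m Hn Hm. destruct (Nat.le_ge_cases n m).
- rewrite <- Cmod_opp. replace (- (u n - u m))%C with (u m - u n)%C by ring. auto.
- auto.
Qed.

Lemma Cmod_lim (u : nat -> C) (l : C) :
  Clim u l -> is_lim_seq (fun n => Cmod (u n)) (Cmod l).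
Proof.
intros H. rewrite Clim_iff in H. apply is_lim_seq_spec. intros eps.
destruct (H eps (cond_pos eps)) as [N HN]. exists N; intros n Hn.
specialize (HN n Hn).
apply Rabs_def1.
- assert (Ht := Cmod_triangle (u n - l) l).
  replace (u n - l + l)%C with (u n) in Ht by ring. lra.
- assert (Ht := Cmod_triangle (- (u n - l)) (u n)).
  replace (- (u n - l) + u n)%C with l in Ht by ring.
  rewrite Cmod_opp in Ht. lra.
Qed.

Lemma Cmod_lim_le (u : nat -> C) (l : C) (M : R) :
  Clim u l -> (forall n, Cmod (u n) <= M) -> Cmod l <= M.
Proof.
intros H Hb. apply (is_lim_seq_le _ _ (Cmod l) M Hb).
- now apply Cmod_lim.
- apply is_lim_seq_const.
Qed.

Lemma Clim_plus (u v : nat -> C) (a b : C) :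
  Clim u a -> Clim v b -> Clim (fun n => u n + v n)%C (a + b)%C.
Proof.
intros Hu Hv. apply is_lim_seq_le_le with (u := fun _ => 0)
  (w := fun n => Cmod (u n - a) + Cmod (v n - b)).
- intros n; split; [apply Cmod_ge_0|].
  replace (u n + v n - (a + b))%C with ((u n - a) + (v n - b))%C by ring.
  apply Cmod_triangle.
- apply is_lim_seq_const.
- replace 0 with (0 + 0) by ring. now apply is_lim_seq_plus'.
Qed.

Lemma Clim_scal (c : C) (u : nat -> C) (a : C) :
  Clim u a -> Clim (fun n => c * u n)%C (c * a)%C.
Proof.
intros Hu. unfold Clim.
apply is_lim_seq_ext with (fun n => Cmod c * Cmod (u n - a)).
- intros n. rewrite <- Cmod_mult. f_equal. ring.
- replace (Finite 0) with (Rbar_mult (Cmod c) 0) by (simpl; f_equal; ring).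
  now apply is_lim_seq_scal_l.
Qed.

(* Pointwise convergence alone would not preserve differentiability; the
   second-order remainder, uniform in [n], makes the derivatives [D n] Cauchy. *)
Lemma cdiff_limit (F : nat -> C -> C) (G : C -> C) (z : C) (D : nat -> C) (d K : R) :
  0 < d -> 0 <= K ->
  (forall n w, Cmod (w - z) < d ->
     Cmod (F n w - F n z - (w - z) * D n) <= K * Cmod (w - z) ^ 2) ->
  (forall w, Cmod (w - z) < d -> Clim (fun n => F n w) (G w)) ->
  cdiff G z.
Proof.
intros Hd HK HF HG.
assert (Hz : Cmod (z - z) < d).
{ replace (z - z)%C with (RtoC 0) by ring. now rewrite Cmod_0. }
assert (HD : exists l, Clim D l).
{ apply Ccauchy_lim. intros eps He.
  (* The remainders of [F n] and [F m] at [z + h] contribute [2 K h^2], less than [eps h / 2]. Since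
     [h] is fixed before [n] and [m], convergence at the two points [z] and [z + h] supplies the
     other half. *)
  set (h := Rmin (d / 2) (eps / (4 * (K + 1)))).
  assert (Hh : 0 < h).
  { apply Rmin_glb_lt; [lra|]. apply Rdiv_lt_0_compat; lra. }
  assert (Hhd : h < d) by (eapply Rle_lt_trans; [apply Rmin_l|lra]).
  assert (HhK : K * h < eps / 4).
  { assert (h <= eps / (4 * (K + 1))) by apply Rmin_r.
    assert (Hle : (K + 1) * h <= eps / 4).
    { replace (eps / 4) with ((K + 1) * (eps / (4 * (K + 1)))) by (field; lra).
      apply Rmult_le_compat_l; lra. }
    nra. }
  set (w := (z + RtoC h)%C).
  assert (Hwz : (w - z)%C = RtoC h) by (unfold w; ring).
  assert (Hm : Cmod (w - z) = h) by (rewrite Hwz, Cmod_R, Rabs_pos_eq; lra).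
  assert (He4 : 0 < eps * h / 8) by nra.
  destruct (proj1 (Clim_iff _ _) (HG w ltac:(lra)) _ He4) as [N1 HN1].
  destruct (proj1 (Clim_iff _ _) (HG z Hz) _ He4) as [N2 HN2].
  exists (N1 + N2)%nat. intros n m Hn Hm'.
  assert (A1 := HN1 n ltac:(lia)). assert (A2 := HN1 m ltac:(lia)).
  assert (A3 := HN2 n ltac:(lia)). assert (A4 := HN2 m ltac:(lia)).
  assert (A5 := HF n w ltac:(lra)). assert (A6 := HF m w ltac:(lra)).
  rewrite Hm in A5, A6.
  assert (Hprod : h * Cmod (D n - D m) <= eps * h / 2 + 2 * (K * h ^ 2)).
  { replace (h * Cmod (D n - D m)) with (Cmod ((w - z) * (D n - D m)))
      by (rewrite Cmod_mult, Hm; reflexivity).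
    replace ((w - z) * (D n - D m))%C with
      (((F n w - G w) - (F m w - G w)) - ((F n z - G z) - (F m z - G z))
       - (F n w - F n z - (w - z) * D n) + (F m w - F m z - (w - z) * D m))%C by ring.
    eapply Rle_trans; [apply Cmod_triangle|].
    eapply Rle_trans; [apply Rplus_le_compat_r; apply Cmod_sub_le|].
    eapply Rle_trans; [apply Rplus_le_compat_r; apply Rplus_le_compat_r; apply Cmod_sub_le|].
    assert (B1 := Cmod_sub_le (F n w - G w)%C (F m w - G w)%C).
    assert (B2 := Cmod_sub_le (F n z - G z)%C (F m z - G z)%C). lra. }
  assert (h * Cmod (D n - D m) < h * eps) by nra.
  apply Rmult_lt_reg_l with h; auto. }
destruct HD as [l Hl]. apply cdiff_iff. exists l. intros eps He.
assert (Hrem : forall w, Cmod (w - z) < d ->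
   Cmod (G w - G z - (w - z) * l) <= K * Cmod (w - z) ^ 2).
{ intros w Hw. apply Cmod_lim_le with (u := fun n => (F n w - F n z - (w - z) * D n)%C).
  - replace (G w - G z - (w - z) * l)%C with
      ((G w + (RtoC (-1)) * G z) + (- (w - z)) * l)%C by ring.
    assert (Hlim : Clim (fun n => F n w + RtoC (-1) * F n z + - (w - z) * D n)%C
       (G w + RtoC (-1) * G z + - (w - z) * l)%C).
    { apply Clim_plus; [apply Clim_plus|]; try (apply Clim_scal); auto. }
    revert Hlim. unfold Clim. apply is_lim_seq_ext. intros n.
    f_equal. ring.
  - intros n. now apply HF. }
exists (Rmin d (eps / (K + 1))). split.
- apply Rmin_glb_lt; [lra|]. apply Rdiv_lt_0_compat; lra.
- intros w Hw. assert (H1 : Cmod (w - z) < d) by apply (lt_Rmin _ _ _ Hw).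
  assert (H2 : Cmod (w - z) < eps / (K + 1)) by apply (lt_Rmin _ _ _ Hw).
  eapply Rle_trans; [now apply Hrem|].
  assert (H3 := Cmod_ge_0 (w - z)).
  assert (K * Cmod (w - z) <= eps).
  { assert ((K + 1) * Cmod (w - z) <= eps).
    { replace eps with ((K + 1) * (eps / (K + 1))) at 1 by (field; lra).
      apply Rmult_le_compat_l; lra. }
    nra. }
  nra.
Qed.

(** * Blaschke products *)

Lemma Cmod_sub_ge (a b : C) : Cmod a - Cmod b <= Cmod (a - b).
Proof.
assert (H := Cmod_triangle (a - b) b).
replace (a - b + b)%C with a in H by ring. lra.
Qed.

Lemma Cmod_sub_sym (a b : C) : Cmod (a - b) = Cmod (b - a).
Proof. rewrite <- Cmod_opp. f_equal. ring. Qed.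

Lemma Cmod_pos_neq (a : C) : 0 < Cmod a -> a <> RtoC 0.
Proof. intros H. now apply Cmod_gt_0. Qed.

Lemma cdiff_continuous (f : C -> C) (z : C) :
  cdiff f z -> forall eps, 0 < eps -> exists delta, 0 < delta /\
    forall w, Cmod (w - z) < delta -> Cmod (f w - f z) < eps.
Proof.
intros H eps He. destruct (proj1 (cdiff_iff f z) H) as [l Hl].
destruct (Hl 1 Rlt_0_1) as [d [Hd Hw]].
assert (Hc := Cmod_ge_0 l).
exists (Rmin d (eps / (Cmod l + 2))). split.
- apply Rmin_glb_lt; [lra|]. apply Rdiv_lt_0_compat; lra.
- intros w H0.
  assert (H1 : Cmod (w - z) < d) by apply (lt_Rmin _ _ _ H0).
  assert (H2 : Cmod (w - z) < eps / (Cmod l + 2)) by apply (lt_Rmin _ _ _ H0).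
  specialize (Hw w H1).
  replace (f w - f z)%C with ((f w - f z - (w - z) * l) + (w - z) * l)%C by ring.
  eapply Rle_lt_trans; [apply Cmod_triangle|]. rewrite Cmod_mult.
  assert ((Cmod l + 2) * Cmod (w - z) < eps).
  { replace eps with ((Cmod l + 2) * (eps / (Cmod l + 2))) at 1 by (field; lra).
    apply Rmult_lt_compat_l; lra. }
  nra.
Qed.

Lemma cdiff_const (c z : C) : cdiff (fun _ => c) z.
Proof.
apply cdiff_iff. exists (RtoC 0). intros eps He. exists 1; split; [lra|].
intros w _. replace (c - c - (w - z) * 0)%C with (RtoC 0) by ring.
rewrite Cmod_0. assert (H := Cmod_ge_0 (w - z)). nra.
Qed.

Lemma cdiff_mult (f g : C -> C) (z : C) :
  cdiff f z -> cdiff g z -> cdiff (fun w => f w * g w)%C z.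
Proof.
intros Hf Hg. assert (Cg := cdiff_continuous g z Hg).
apply cdiff_iff in Hf. apply cdiff_iff in Hg. apply cdiff_iff.
destruct Hf as [l Hl]. destruct Hg as [m Hm].
exists (l * g z + f z * m)%C. intros eps He.
assert (Pg := Cmod_ge_0 (g z)). assert (Pf := Cmod_ge_0 (f z)). assert (Pl := Cmod_ge_0 l).
set (e := eps / (Cmod (g z) + 1 + Cmod (f z) + Cmod l + 1)).
assert (HE : 0 < e) by (apply Rdiv_lt_0_compat; lra).
assert (Heq : e * (Cmod (g z) + 1 + Cmod (f z) + Cmod l + 1) = eps) by (unfold e; field; lra).
destruct (Hl e HE) as [d1 [Hd1 H1]]. destruct (Hm e HE) as [d2 [Hd2 H2]].
destruct (Cg (Rmin e 1) ltac:(apply Rmin_glb_lt; lra)) as [d3 [Hd3 H3]].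
exists (Rmin d1 (Rmin d2 d3)). split.
- repeat apply Rmin_glb_lt; lra.
- intros w Hw.
  assert (Hw1 : Cmod (w - z) < d1) by apply (lt_Rmin _ _ _ Hw).
  assert (Hw23 : Cmod (w - z) < Rmin d2 d3) by apply (lt_Rmin _ _ _ Hw).
  assert (Hw2 : Cmod (w - z) < d2) by apply (lt_Rmin _ _ _ Hw23).
  assert (Hw3 : Cmod (w - z) < d3) by apply (lt_Rmin _ _ _ Hw23).
  specialize (H1 w Hw1). specialize (H2 w Hw2). specialize (H3 w Hw3).
  assert (H3e : Cmod (g w - g z) <= e) by (eapply Rle_trans; [left; apply H3|apply Rmin_l]).
  assert (H31 : Cmod (g w - g z) <= 1) by (eapply Rle_trans; [left; apply H3|apply Rmin_r]).
  replace (f w * g w - f z * g z - (w - z) * (l * g z + f z * m))%C with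
    ((f w - f z - (w - z) * l) * ((g w - g z) + g z) + f z * (g w - g z - (w - z) * m)
      + (w - z) * l * (g w - g z))%C by ring.
  eapply Rle_trans; [apply Cmod_triangle|].
  eapply Rle_trans; [apply Rplus_le_compat_r; apply Cmod_triangle|].
  rewrite !Cmod_mult.
  assert (H4 := Cmod_triangle (g w - g z) (g z)).
  assert (Q1 := Cmod_ge_0 (f w - f z - (w - z) * l)).
  assert (Q3 := Cmod_ge_0 (g w - g z + g z)).
  assert (A : Cmod (f w - f z - (w - z) * l) * Cmod (g w - g z + g z)
     <= e * Cmod (w - z) * (Cmod (g z) + 1)).
  { apply Rmult_le_compat; lra. }
  assert (B : Cmod (f z) * Cmod (g w - g z - (w - z) * m) <= Cmod (f z) * (e * Cmod (w - z))).
  { apply Rmult_le_compat_l; lra. }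
  assert (D : Cmod (w - z) * Cmod l * Cmod (g w - g z) <= Cmod (w - z) * Cmod l * e).
  { apply Rmult_le_compat_l; nra. }
  rewrite <- Heq. nra.
Qed.

Lemma cdiff_pow (f : C -> C) (n : nat) (z : C) :
  cdiff f z -> cdiff (fun w => f w ^ n)%C z.
Proof.
intros Hf. induction n as [|n IH]; simpl.
- apply cdiff_const.
- now apply cdiff_mult.
Qed.

Lemma pow2_le (x y : R) : 0 <= y -> x ^ 2 <= y ^ 2 -> x <= y.
Proof. intros Hy H. nra. Qed.

Lemma Cmod_conj_mult_ge (a z : C) : Cmod a <= 1 -> 1 - Cmod z <= Cmod (1 - Cconj a * z).
Proof.
intros Ha. eapply Rle_trans; [|apply Cmod_sub_ge].
rewrite Cmod_1, Cmod_mult, Cmod_conj. assert (H := Cmod_ge_0 z). nra.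
Qed.

Lemma one_sub_conj_pos (a z : C) : Cmod a <= 1 -> Cmod z < 1 -> 0 < Cmod (1 - Cconj a * z).
Proof. intros Ha Hz. assert (H := Cmod_conj_mult_ge a z Ha). lra. Qed.

Lemma one_sub_conj_neq0 (a z : C) : Cmod a <= 1 -> Cmod z < 1 -> (1 - Cconj a * z)%C <> RtoC 0.
Proof. intros Ha Hz. apply Cmod_pos_neq. now apply one_sub_conj_pos. Qed.

(* The reproducing kernel of the Hardy space. Blaschke factors are affine in it,
   and for [|a| = 1] its real part is half of one plus the Poisson kernel. *)
Definition szego (a z : C) : C := (/ (1 - Cconj a * z))%C.

Lemma Cmod_szego_le (a z : C) :
  Cmod a <= 1 -> Cmod z < 1 -> Cmod (szego a z) <= / (1 - Cmod z).
Proof.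
intros Ha Hz. unfold szego. rewrite Cmod_inv by now apply one_sub_conj_neq0.
apply Rinv_le_contravar; [lra|now apply Cmod_conj_mult_ge].
Qed.

Lemma Cmod_close (z w : C) : Cmod (w - z) < (1 - Cmod z) / 2 -> (1 - Cmod z) / 2 <= 1 - Cmod w.
Proof.
intros H. assert (H1 := Cmod_sub_ge w z). lra.
Qed.

Lemma szego_lipschitz (a z w : C) : Cmod a <= 1 -> Cmod z < 1 ->
  Cmod (w - z) < (1 - Cmod z) / 2 ->
  Cmod (szego a w - szego a z) <= 2 / (1 - Cmod z) ^ 2 * Cmod (w - z).
Proof.
intros Ha Hz Hw. assert (Hc := Cmod_close z w Hw).
assert (Hw1 : Cmod w < 1) by lra.
replace (szego a w - szego a z)%C with (Cconj a * (w - z) * (szego a w * szego a z))%C.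
2:{ unfold szego. field. split; now apply one_sub_conj_neq0. }
rewrite !Cmod_mult, Cmod_conj.
assert (H1 := Cmod_szego_le a z Ha Hz). assert (H2 := Cmod_szego_le a w Ha Hw1).
assert (H3 : / (1 - Cmod w) <= 2 / (1 - Cmod z)).
{ replace (2 / (1 - Cmod z)) with (/ ((1 - Cmod z) / 2)) by (field; lra).
  apply Rinv_le_contravar; lra. }
assert (P := Cmod_ge_0 (w - z)). assert (P1 := Cmod_ge_0 (szego a z)).
assert (P2 := Cmod_ge_0 (szego a w)). assert (P3 := Cmod_ge_0 a).
assert (H4 : Cmod (szego a w) * Cmod (szego a z) <= 2 / (1 - Cmod z) * / (1 - Cmod z))
  by (apply Rmult_le_compat; lra).
replace (2 / (1 - Cmod z) ^ 2) with (2 / (1 - Cmod z) * / (1 - Cmod z)) by (field; lra).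
assert (H5 : Cmod a * Cmod (w - z) <= Cmod (w - z)) by nra.
rewrite Rmult_comm. apply Rmult_le_compat; try nra.
Qed.

(** The remainder equals [conj a (w - z) szego a z (szego a w - szego a z)], so the Lipschitz bound
    makes it quadratic. The constant depends on [|z|] only; this uniformity in [a] serves both
    infinite products and averages over boundary points. *)
Lemma szego_remainder (a z w : C) : Cmod a <= 1 -> Cmod z < 1 ->
  Cmod (w - z) < (1 - Cmod z) / 2 ->
  Cmod (szego a w - szego a z - (w - z) * (Cconj a * szego a z ^ 2))
    <= 2 / (1 - Cmod z) ^ 3 * Cmod (w - z) ^ 2.
Proof.
intros Ha Hz Hw. assert (Hc := Cmod_close z w Hw).
assert (Hw1 : Cmod w < 1) by lra.
replace (szego a w - szego a z - (w - z) * (Cconj a * szego a z ^ 2))%C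
  with ((Cconj a * (w - z) * szego a z) * (szego a w - szego a z))%C.
2:{ unfold szego. field. split; now apply one_sub_conj_neq0. }
rewrite !Cmod_mult, Cmod_conj.
assert (H1 := Cmod_szego_le a z Ha Hz). assert (H2 := szego_lipschitz a z w Ha Hz Hw).
assert (P := Cmod_ge_0 (w - z)). assert (P1 := Cmod_ge_0 (szego a z)).
assert (P3 := Cmod_ge_0 a).
replace (2 / (1 - Cmod z) ^ 3 * Cmod (w - z) ^ 2) with
  ((Cmod (w - z) * / (1 - Cmod z)) * (2 / (1 - Cmod z) ^ 2 * Cmod (w - z))) by (field; lra).
assert (H5 : Cmod a * Cmod (w - z) <= Cmod (w - z)) by nra.
apply Rmult_le_compat; try apply Cmod_ge_0; auto.
- apply Rmult_le_pos; nra.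
- apply Rmult_le_compat; nra.
Qed.

(* [1 - rho(a,z)^2 = (1-|a|^2)(1-|z|^2)/|1 - conj a z|^2], cleared of denominators. *)
Lemma pick_identity (a z : C) :
  Cmod (1 - Cconj a * z) ^ 2 - Cmod (a - z) ^ 2 = (1 - Cmod a ^ 2) * (1 - Cmod z ^ 2).
Proof.
rewrite !Cmod2_alt. destruct a as [a1 a2], z as [x y]. simpl. ring.
Qed.

Lemma Cmod_sub_le_conj (a z : C) : Cmod a <= 1 -> Cmod z <= 1 ->
  Cmod (a - z) <= Cmod (1 - Cconj a * z).
Proof.
intros Ha Hz. assert (H := pick_identity a z).
assert (P1 := Cmod_ge_0 a). assert (P2 := Cmod_ge_0 z).
apply pow2_le; [apply Cmod_ge_0|].
assert (0 <= (1 - Cmod a ^ 2) * (1 - Cmod z ^ 2)) by (apply Rmult_le_pos; nra). lra.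
Qed.

Fixpoint cprod (b : nat -> C -> C) (n : nat) (z : C) : C :=
  match n with O => RtoC 1 | S n => (cprod b n z * b n z)%C end.

(** For [c = 1 - |a|^2] this is the Blaschke factor scaled by [conj a] instead of the unimodular
    [conj a / |a|]; being affine in the kernel, it differs from 1 by a multiple of [c]. The choice
    [c = 0] gives the constant 1 and so drops an index without renumbering. *)
Definition bfactor (a : C) (c : R) (z : C) : C := (1 - RtoC c * szego a z)%C.

Lemma bfactor_full (a z : C) : Cmod a < 1 -> Cmod z < 1 ->
  bfactor a (1 - Cmod a ^ 2) z = (Cconj a * (a - z) * szego a z)%C.
Proof.
intros Ha Hz. unfold bfactor, szego.
rewrite RtoC_minus, Cmod2_conj. field. apply one_sub_conj_neq0; lra.
Qed.

Lemma bfactor_full_bound (a z : C) : Cmod a < 1 -> Cmod z < 1 ->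
  Cmod (bfactor a (1 - Cmod a ^ 2) z) <= 1.
Proof.
intros Ha Hz. rewrite bfactor_full by auto.
rewrite !Cmod_mult, Cmod_conj. unfold szego.
assert (Hn : (1 - Cconj a * z)%C <> RtoC 0) by (apply one_sub_conj_neq0; lra).
rewrite Cmod_inv by exact Hn. apply Cmod_gt_0 in Hn.
assert (H := Cmod_sub_le_conj a z ltac:(lra) ltac:(lra)).
assert (P' := Cmod_ge_0 (a - z)).
apply Rmult_le_reg_r with (Cmod (1 - Cconj a * z)); auto.
rewrite Rmult_assoc, Rinv_l by lra. nra.
Qed.

Section Blaschke.

Variables (a : nat -> C) (c : nat -> R).
Hypothesis a_disc : forall k, Cmod (a k) < 1.
Hypothesis c_cases : forall k, c k = 0 \/ c k = 1 - Cmod (a k) ^ 2.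
Hypothesis c_summable : ex_series c.

Let b (k : nat) (z : C) : C := bfactor (a k) (c k) z.

Lemma bcoeff_nonneg k : 0 <= c k.
Proof.
destruct (c_cases k) as [->| ->]; [lra|].
assert (H := a_disc k). assert (P := Cmod_ge_0 (a k)). nra.
Qed.

Lemma bfactor_bound k z : Cmod z < 1 -> Cmod (b k z) <= 1.
Proof.
intros Hz. unfold b. destruct (c_cases k) as [->| ->].
- unfold bfactor. replace (1 - 0 * szego (a k) z)%C with (RtoC 1) by ring.
  rewrite Cmod_1; lra.
- now apply bfactor_full_bound.
Qed.

Lemma cprod_bound n z : Cmod z < 1 -> Cmod (cprod b n z) <= 1.
Proof.
intros Hz. induction n as [|n IH]; simpl; [rewrite Cmod_1; lra|].
rewrite Cmod_mult. assert (H := bfactor_bound n z Hz).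
assert (P' := Cmod_ge_0 (cprod b n z)). nra.
Qed.

Lemma bfactor_sub1 k z : Cmod z < 1 -> Cmod (b k z - 1) <= c k * / (1 - Cmod z).
Proof.
intros Hz. unfold b, bfactor.
replace (1 - RtoC (c k) * szego (a k) z - 1)%C with (- (RtoC (c k) * szego (a k) z))%C by ring.
rewrite Cmod_opp, Cmod_mult, Cmod_R, Rabs_pos_eq by apply bcoeff_nonneg.
apply Rmult_le_compat_l; [apply bcoeff_nonneg|]. apply Cmod_szego_le; auto. left; auto.
Qed.

Lemma cprod_converges z : Cmod z < 1 -> exists l, Clim (fun n => cprod b n z) l.
Proof.
intros Hz. apply Clim_of_summable_increments with (b := fun k => c k * / (1 - Cmod z)).
- intros n. simpl.
  replace (cprod b n z * b n z - cprod b n z)%C with (cprod b n z * (b n z - 1))%C by ring.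
  rewrite Cmod_mult. assert (H := cprod_bound n z Hz). assert (H1 := bfactor_sub1 n z Hz).
  assert (P := Cmod_ge_0 (b n z - 1)). nra.
- apply ex_series_ext with (fun k => / (1 - Cmod z) * c k).
  + intros n. apply Rmult_comm.
  + apply (ex_series_scal_l (/ (1 - Cmod z)) c c_summable).
Qed.

Lemma bcoeff_sums_bounded : exists S, 0 <= S /\ forall n, sum_n c n <= S.
Proof.
exists (Series c). assert (H : forall n, sum_n c n <= Series c).
{ intros n. apply (is_lim_seq_incr_compare (sum_n c)).
  - apply Series_correct, c_summable.
  - intros m. rewrite sum_Sn. assert (P := bcoeff_nonneg (S m)). unfold plus; simpl. lra. }
split; auto. eapply Rle_trans; [|apply (H 0%nat)]. rewrite sum_O. apply bcoeff_nonneg.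
Qed.

Let db (z : C) (k : nat) : C := (- RtoC (c k) * (Cconj (a k) * szego (a k) z ^ 2))%C.

Fixpoint dprod (z : C) (n : nat) : C :=
  match n with
  | O => RtoC 0
  | S n => (dprod z n * b n z + cprod b n z * db z n)%C
  end.

Fixpoint csum (n : nat) : R := match n with O => 0 | S n => csum n + c n end.

Lemma csum_nonneg n : 0 <= csum n.
Proof. induction n; simpl; [lra|]. assert (H := bcoeff_nonneg n). lra. Qed.

Lemma csum_sum_n n : csum (S n) = sum_n c n.
Proof.
induction n as [|n IH].
- simpl. rewrite sum_O. ring.
- rewrite sum_Sn, <- IH. reflexivity.
Qed.

(** Product rule by induction; the product of two increments produces the term in [csum n ^ 2]. The
    bounds involve [n] only through [csum n], which is bounded, as [cdiff_limit] requires. *)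
Lemma cprod_remainder z w n : Cmod z < 1 -> Cmod (w - z) < (1 - Cmod z) / 2 ->
  let L := 2 / (1 - Cmod z) ^ 2 in
  let M := 2 / (1 - Cmod z) ^ 3 in
  Cmod (cprod b n w - cprod b n z) <= csum n * L * Cmod (w - z) /\
  Cmod (cprod b n w - cprod b n z - (w - z) * dprod z n)
    <= (csum n * M + csum n ^ 2 * L ^ 2) * Cmod (w - z) ^ 2.
Proof.
intros Hz Hw L M. assert (Hc := Cmod_close z w Hw).
assert (Hw1 : Cmod w < 1) by lra.
assert (HL : 0 < L) by (apply Rdiv_lt_0_compat; [lra|apply pow_lt; lra]).
assert (HM : 0 < M) by (apply Rdiv_lt_0_compat; [lra|apply pow_lt; lra]).
induction n as [|n [IH1 IH2]].
- simpl. replace (1 - 1)%C with (RtoC 0) by ring.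
  replace (0 - (w - z) * 0)%C with (RtoC 0) by ring. rewrite Cmod_0. split; nra.
- assert (Hcn := bcoeff_nonneg n). assert (HS := csum_nonneg n).
  assert (F1 : Cmod (b n w - b n z) <= c n * L * Cmod (w - z)).
  { unfold b, bfactor.
    replace (1 - RtoC (c n) * szego (a n) w - (1 - RtoC (c n) * szego (a n) z))%C
      with (- RtoC (c n) * (szego (a n) w - szego (a n) z))%C by ring.
    rewrite Cmod_mult, Cmod_opp, Cmod_R, Rabs_pos_eq by exact Hcn.
    rewrite Rmult_assoc. apply Rmult_le_compat_l; auto.
    apply szego_lipschitz; auto. left; auto. }
  assert (F2 : Cmod (b n w - b n z - (w - z) * db z n) <= c n * M * Cmod (w - z) ^ 2).
  { unfold b, bfactor, db.
    replace (1 - RtoC (c n) * szego (a n) w - (1 - RtoC (c n) * szego (a n) z)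
       - (w - z) * (- RtoC (c n) * (Cconj (a n) * szego (a n) z ^ 2)))%C
      with (- RtoC (c n) * (szego (a n) w - szego (a n) z
         - (w - z) * (Cconj (a n) * szego (a n) z ^ 2)))%C by ring.
    rewrite Cmod_mult, Cmod_opp, Cmod_R, Rabs_pos_eq by exact Hcn.
    rewrite Rmult_assoc. apply Rmult_le_compat_l; auto.
    apply szego_remainder; auto. left; auto. }
  assert (Bw := bfactor_bound n w Hw1). assert (Bz := bfactor_bound n z Hz).
  assert (Cz := cprod_bound n z Hz).
  assert (Q5 := Cmod_ge_0 (b n w - b n z)).
  assert (Q6 := Cmod_ge_0 (cprod b n w - cprod b n z)).
  assert (Q7 := Cmod_ge_0 (b n w - b n z - (w - z) * db z n)).
  assert (Q8 := Cmod_ge_0 (cprod b n w - cprod b n z - (w - z) * dprod z n)).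
  simpl cprod; simpl dprod; simpl csum. split.
  + replace (cprod b n w * b n w - cprod b n z * b n z)%C with
     ((cprod b n w - cprod b n z) * b n w + cprod b n z * (b n w - b n z))%C by ring.
    eapply Rle_trans; [apply Cmod_triangle|]. rewrite !Cmod_mult. nra.
  + replace (cprod b n w * b n w - cprod b n z * b n z
      - (w - z) * (dprod z n * b n z + cprod b n z * db z n))%C with
     ((cprod b n w - cprod b n z - (w - z) * dprod z n) * b n z
      + cprod b n z * (b n w - b n z - (w - z) * db z n)
      + (cprod b n w - cprod b n z) * (b n w - b n z))%C by ring.
    eapply Rle_trans; [apply Cmod_triangle|].
    eapply Rle_trans; [apply Rplus_le_compat_r; apply Cmod_triangle|].
    rewrite !Cmod_mult.
    assert (G1 : Cmod (cprod b n w - cprod b n z - (w - z) * dprod z n) * Cmod (b n z)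
       <= (csum n * M + csum n ^ 2 * L ^ 2) * Cmod (w - z) ^ 2) by nra.
    assert (G2 : Cmod (cprod b n z) * Cmod (b n w - b n z - (w - z) * db z n)
       <= c n * M * Cmod (w - z) ^ 2) by nra.
    assert (G3 : Cmod (cprod b n w - cprod b n z) * Cmod (b n w - b n z)
       <= (csum n * L * Cmod (w - z)) * (c n * L * Cmod (w - z)))
      by (apply Rmult_le_compat; auto).
    assert (G4 : 0 <= csum n * c n * L ^ 2 * Cmod (w - z) ^ 2).
    { apply Rmult_le_pos; [apply Rmult_le_pos; [now apply Rmult_le_pos|]|]; apply pow2_ge_0. }
    assert (G5 : 0 <= c n ^ 2 * L ^ 2 * Cmod (w - z) ^ 2).
    { apply Rmult_le_pos; [apply Rmult_le_pos|]; apply pow2_ge_0. }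
    eapply Rle_trans; [apply Rplus_le_compat; [apply Rplus_le_compat; [exact G1|exact G2]|exact G3]|].
    match goal with |- ?x <= ?y => assert (y - x =
      csum n * c n * L ^ 2 * Cmod (w - z) ^ 2 + c n ^ 2 * L ^ 2 * Cmod (w - z) ^ 2) by ring end.
    lra.
Qed.

(** Weierstrass' inequality [prod (1 - x_k) >= 1 - sum x_k], applied to the factors after [n0]. It
    keeps the tail of the product away from 0. *)
Lemma cprod_lower w n0 n : Cmod w < 1 ->
  Cmod (cprod b n0 w) * (1 - (csum (n0 + n) - csum n0) * / (1 - Cmod w))
    <= Cmod (cprod b (n0 + n) w).
Proof.
intros Hw. assert (Hi : 0 < / (1 - Cmod w)) by (apply Rinv_0_lt_compat; lra).
assert (Hmon : forall m, csum n0 <= csum (n0 + m)).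
{ induction m; [rewrite Nat.add_0_r; lra|]. rewrite Nat.add_succ_r. simpl.
  assert (H := bcoeff_nonneg (n0 + m)). lra. }
induction n as [|n IH].
- rewrite Nat.add_0_r. right; ring.
- rewrite Nat.add_succ_r. simpl. rewrite Cmod_mult.
  set (k := (n0 + n)%nat) in *.
  assert (H1 : 1 - c k * / (1 - Cmod w) <= Cmod (b k w)).
  { assert (H := bfactor_sub1 k w Hw). assert (H2 := Cmod_sub_ge 1 (1 - b k w)).
    replace (1 - (1 - b k w))%C with (b k w) in H2 by ring.
    rewrite Cmod_1, (Cmod_sub_sym 1 (b k w)) in H2. lra. }
  assert (H3 := bcoeff_nonneg k).
  assert (P1 := Cmod_ge_0 (cprod b n0 w)). assert (P2 := Cmod_ge_0 (cprod b k w)).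
  assert (P3 := Cmod_ge_0 (b k w)). assert (H5 := Hmon n). fold k in H5.
  set (i := / (1 - Cmod w)) in *.
  set (d := csum k - csum n0) in *.
  replace (csum k + c k - csum n0) with (d + c k) by (unfold d; ring).
  assert (Hd : 0 <= d) by (unfold d; lra).
  assert (Hci : 0 <= c k * i) by nra. assert (Hdi : 0 <= d * i) by nra.
  destruct (Rle_dec (1 - (d + c k) * i) 0) as [Hn|Hn]; [nra|].
  assert (Hx : Cmod (cprod b n0 w) * (1 - d * i) * (1 - c k * i) <= Cmod (cprod b k w) * Cmod (b k w)).
  { apply Rmult_le_compat; nra. }
  assert (Hy : Cmod (cprod b n0 w) * (1 - (d + c k) * i)
    <= Cmod (cprod b n0 w) * (1 - d * i) * (1 - c k * i)).
  { rewrite Rmult_assoc. apply Rmult_le_compat_l; auto. nra. }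
  lra.
Qed.

(** The condition [a k <> 0] comes from the scaling of the factors by [conj a]: a zero at the origin
    would annihilate the product. The point [w0] is where the product is certified not to vanish. *)
Lemma blaschke_product (w0 : C) : Cmod w0 < 1 ->
  (forall k, c k <> 0 -> a k <> w0 /\ a k <> RtoC 0) ->
  exists B : C -> C,
    (forall z, in_disc z -> cdiff B z) /\
    (forall z, in_disc z -> Cmod (B z) <= 1) /\
    B w0 <> RtoC 0 /\ forall k, c k <> 0 -> B (a k) = RtoC 0.
Proof.
intros Hw0 Hne.
assert (HB : forall z, exists l, Cmod z < 1 -> Clim (fun n => cprod b n z) l).
{ intros z. destruct (Rlt_dec (Cmod z) 1) as [Hz|Hz].
  - destruct (cprod_converges z Hz) as [l Hl]. now exists l.
  - exists (RtoC 0). intros H; lra. }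
destruct (choice _ HB) as [B HBl]. exists B.
destruct bcoeff_sums_bounded as [S [HS HSn]].
assert (HSc : forall n, csum n <= S).
{ intros [|n]; [exact HS|]. rewrite csum_sum_n. apply HSn. }
split; [|split; [|split]].
- intros z Hz. unfold in_disc in Hz.
  apply cdiff_limit with (F := cprod b) (D := dprod z) (d := (1 - Cmod z) / 2)
    (K := S * (2 / (1 - Cmod z) ^ 3) + S ^ 2 * (2 / (1 - Cmod z) ^ 2) ^ 2).
  + lra.
  + assert (0 < 2 / (1 - Cmod z) ^ 3) by (apply Rdiv_lt_0_compat; [lra|apply pow_lt; lra]).
    apply Rplus_le_le_0_compat; [nra|]. apply Rmult_le_pos; apply pow2_ge_0.
  + intros n w Hw. eapply Rle_trans; [apply (cprod_remainder z w n Hz Hw)|].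
    apply Rmult_le_compat_r; [apply pow2_ge_0|].
    assert (H1 := HSc n). assert (H2 := csum_nonneg n).
    apply Rplus_le_compat; apply Rmult_le_compat_r; auto.
    * left. apply Rdiv_lt_0_compat; [lra|apply pow_lt; lra].
    * apply pow2_ge_0.
    * apply pow_incr; lra.
  + intros w Hw. apply HBl. assert (H := Cmod_close z w Hw). lra.
- intros z Hz. apply Cmod_lim_le with (u := fun n => cprod b n z).
  + now apply HBl.
  + intros n. now apply cprod_bound.
(* From [n0] on, the coefficients sum to at most [(1 - |w0|) / 2], so the tail product has modulus
   at least 1/2 at [w0]; the finitely many earlier factors are nonzero there. *)
- assert (Hn0 : exists n0, forall n, (csum (n0 + n) - csum n0) * / (1 - Cmod w0) <= 1 / 2).
  { destruct (Cauchy_ex_series c c_summable (mkposreal ((1 - Cmod w0) / 2) ltac:(lra))) as [N HN].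
    simpl in HN. exists (Datatypes.S N). intros n.
    assert (H : csum (Datatypes.S N + n) - csum (Datatypes.S N) <= (1 - Cmod w0) / 2).
    { destruct n as [|n].
      - rewrite Nat.add_0_r. lra.
      - specialize (HN (Datatypes.S N) (Datatypes.S N + n)%nat ltac:(lia) ltac:(lia)).
        assert (E := sum_n_m_sum_n (G := R_AbelianGroup) c N (Datatypes.S N + n) ltac:(lia)).
        replace (Datatypes.S N + Datatypes.S n)%nat with (Datatypes.S (Datatypes.S N + n)) by lia.
        rewrite !csum_sum_n.
        apply Rle_trans with (sum_n_m (G := R_AbelianGroup) c (Datatypes.S N) (Datatypes.S N + n)).
        + right. symmetry. exact E.
        + eapply Rle_trans; [apply Rle_abs|]. left. exact HN. }
    apply Rmult_le_reg_r with (1 - Cmod w0); [lra|].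
    rewrite Rmult_assoc, Rinv_l by lra. lra. }
  destruct Hn0 as [n0 Hn0].
  assert (Hnz : forall n, 0 < Cmod (cprod b n w0)).
  { induction n; simpl.
    - rewrite Cmod_1; lra.
    - rewrite Cmod_mult. apply Rmult_lt_0_compat; auto. apply Cmod_gt_0.
      unfold b. destruct (Req_dec (c n) 0) as [H0|H0].
      + rewrite H0. unfold bfactor. replace (1 - 0 * szego (a n) w0)%C with (RtoC 1) by ring.
        apply C1_nz.
      + destruct (Hne n H0) as [N1 N2].
        destruct (c_cases n) as [E|E]; [contradiction|]. rewrite E.
        rewrite bfactor_full by auto. repeat apply Cmult_neq_0.
        * apply Cmod_gt_0. rewrite Cmod_conj. now apply Cmod_gt_0.
        * now apply Cminus_eq_contra.
        * unfold szego. apply Cmod_gt_0. rewrite Cmod_inv by (apply one_sub_conj_neq0; auto; left; auto).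
          apply Rinv_0_lt_compat, Cmod_gt_0, one_sub_conj_neq0; auto. left; auto. }
  apply Cmod_gt_0.
  assert (Hl : is_lim_seq (fun n => Cmod (cprod b (n0 + n) w0)) (Cmod (B w0))).
  { apply is_lim_seq_ext with (fun n => Cmod (cprod b (n + n0) w0)).
    - intros n. now rewrite Nat.add_comm.
    - apply (is_lim_seq_incr_n (fun n => Cmod (cprod b n w0)) n0). apply Cmod_lim. now apply HBl. }
  assert (Hle : Cmod (cprod b n0 w0) / 2 <= Cmod (B w0)).
  { apply (is_lim_seq_le (fun _ => Cmod (cprod b n0 w0) / 2) (fun n => Cmod (cprod b (n0 + n) w0))
      (Cmod (cprod b n0 w0) / 2) (Cmod (B w0))); auto.
    - intros n. eapply Rle_trans; [|now apply cprod_lower].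
      assert (H1 := Hn0 n). assert (H2 := Hnz n0). nra.
    - apply is_lim_seq_const. }
  assert (H1 := Hnz n0). lra.
- intros k Hk.
  assert (Hzero : forall n, (k < n)%nat -> cprod b n (a k) = RtoC 0).
  { induction n as [|n IH]; [lia|]. intros Hkn. simpl.
    destruct (Nat.eq_dec k n) as [<-|Hd].
    - destruct (c_cases k) as [E|E]; [contradiction|].
      unfold b. rewrite E, bfactor_full by auto.
      ring.
    - rewrite IH by lia. ring. }
  assert (Hl := HBl (a k) (a_disc k)). rewrite Clim_iff in Hl.
  apply NNPP. intros Hn. apply Cmod_gt_0 in Hn.
  destruct (Hl _ Hn) as [N HN]. specialize (HN (N + Datatypes.S k)%nat ltac:(lia)).
  rewrite Hzero in HN by lia. rewrite Cmod_sub_sym in HN.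
  replace (B (a k) - 0)%C with (B (a k)) in HN by ring. lra.
Qed.

End Blaschke.

(** * Comparable weights *)

Lemma ex_series_Rle (a b : nat -> R) :
  (forall n, 0 <= a n <= b n) -> ex_series b -> ex_series a.
Proof.
intros H Hb. apply (ex_series_le (K := R_AbsRing) (V := R_CompleteNormedModule) a b); auto.
intros n. unfold norm; simpl. unfold abs; simpl. rewrite Rabs_pos_eq; apply H.
Qed.

Lemma thin_term_nonneg (theta : R -> R) (f : C -> C) (z : C) :
  Cmod z < 1 -> 0 <= thin_term theta f z.
Proof.
intros Hz. unfold thin_term. destruct (Req_dec_T (Cmod z) 0); [lra|].
apply Rmult_le_pos; [apply Rmult_le_pos; [lra|left; apply exp_pos]|apply Cmod_ge_0].
Qed.

Lemma exp_le_exp (x y : R) : x <= y -> exp x <= exp y.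
Proof. intros [H| ->]; [left; now apply exp_increasing|lra]. Qed.

Lemma exp_mult_nat (x : R) (n : nat) : exp (INR n * x) = exp x ^ n.
Proof.
induction n as [|n IH].
- simpl. now rewrite Rmult_0_l, exp_0.
- rewrite S_INR, Rmult_plus_distr_r, Rmult_1_l, exp_plus, IH. simpl. ring.
Qed.

Lemma pow_le_base (x : R) (n : nat) : 0 <= x <= 1 -> x ^ S n <= x.
Proof.
intros Hx. induction n as [|n IH]; [simpl; lra|].
change (x ^ S (S n)) with (x * x ^ S n). nra.
Qed.

(* Where [exp theta1 * |f| > 1] the thin sum dominates [sum (1 - |z_k|)], so
   these points carry a Blaschke product; elsewhere a power of [f] is enough. *)
Lemma Lambda_of_le (theta1 theta2 : R -> R) (p : nat) (z : nat -> C) :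
  (forall t, 0 < t < 1 -> theta2 t <= INR (S p) * theta1 t) ->
  Lambda theta1 z -> Lambda theta2 z.
Proof.
intros Hth [Hd [Hs [f [[Hh [M HM]] [[w [Hw Hfw]] Hser]]]]].
split; [exact Hd|split; [exact Hs|]].
destruct Hd as [Hdisc Hlim].
(* Dividing by a bound that is also at least 1 yields both [|f0| <= 1], needed for powers, and
   [|f0| <= |f|], needed for the comparison of the series. *)
assert (HM1 : 1 <= Rmax M 1) by apply Rmax_r.
set (M1 := Rmax M 1) in *.
set (f0 := fun u => (f u * RtoC (/ M1))%C).
assert (Hf0 : forall u, Cmod (f0 u) = Cmod (f u) / M1).
{ intros u. unfold f0. rewrite Cmod_mult, Cmod_R, Rabs_pos_eq; [reflexivity|].
  left. apply Rinv_0_lt_compat; lra. }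
assert (Hf0le : forall u, Cmod (f0 u) <= Cmod (f u)).
{ intros u. rewrite Hf0. apply Rle_div_l; [lra|]. assert (H := Cmod_ge_0 (f u)). nra. }
assert (Hf01 : forall u, in_disc u -> Cmod (f0 u) <= 1).
{ intros u Hu. rewrite Hf0. apply Rle_div_l; [lra|]. rewrite Rmult_1_l.
  eapply Rle_trans; [now apply HM|apply Rmax_l]. }
(* Beyond [k0] no point equals [w] or 0, so the Blaschke product does not vanish at [w]; the terms
   before [k0] do not affect convergence. *)
assert (Hk0 : exists k0, forall k, (k0 <= k)%nat -> Cmod w < Cmod (z k)).
{ apply is_lim_seq_spec in Hlim. unfold in_disc in Hw.
  destruct (Hlim (mkposreal (1 - Cmod w) ltac:(lra))) as [N HN].
  exists N. intros k Hk. specialize (HN k Hk). simpl in HN. apply Rabs_def2 in HN. lra. }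
destruct Hk0 as [k0 Hk0].
set (X := fun k => (k0 <= k)%nat /\ 1 < exp (theta1 (1 - Cmod (z k))) * Cmod (f0 (z k))).
set (c := fun k => if excluded_middle_informative (X k) then 1 - Cmod (z k) ^ 2 else 0).
assert (Hw0 := Cmod_ge_0 w).
destruct (blaschke_product z c) with (w0 := w) as [B [HBd [HBb [HBw HB0]]]].
- exact Hdisc.
- intros k. unfold c. destruct (excluded_middle_informative (X k)); auto.
- apply ex_series_Rle with (fun k => 2 * thin_term theta1 f (z k)).
  + intros k. assert (Hz := Hdisc k). unfold in_disc in Hz. assert (Ht := thin_term_nonneg theta1 f (z k) Hz).
    unfold c. destruct (excluded_middle_informative (X k)) as [[Hk HX]|_]; [|lra].
    specialize (Hk0 k Hk). split; [nra|].
    unfold thin_term. destruct (Req_dec_T (Cmod (z k)) 0); [lra|].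
    assert (He := exp_pos (theta1 (1 - Cmod (z k)))). assert (Hle := Hf0le (z k)).
    assert (1 <= exp (theta1 (1 - Cmod (z k))) * Cmod (f (z k))) by nra.
    rewrite Rmult_assoc. nra.
  + apply (ex_series_scal_l 2 _ Hser).
- exact Hw.
- intros k Hk. unfold c in Hk. destruct (excluded_middle_informative (X k)) as [[HXk _]|_]; [|lra].
  specialize (Hk0 k HXk). split; intros E; rewrite E in Hk0; [lra|].
  rewrite Cmod_0 in Hk0; lra.
- exists (fun u => f0 u ^ S p * B u)%C. split; [split|split].
  + intros u Hu. apply cdiff_mult; [apply cdiff_pow, cdiff_mult|].
    * now apply Hh.
    * apply cdiff_const.
    * now apply HBd.
  + exists 1. intros u Hu. rewrite Cmod_mult, Cmod_pow.
    assert (H1 := HBb u Hu). assert (H3 := pow_le_base (Cmod (f0 u)) p (conj (Cmod_ge_0 _) (Hf01 u Hu))).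
    assert (H4 := Hf01 u Hu). assert (H5 := pow_le (Cmod (f0 u)) (S p) (Cmod_ge_0 _)). nra.
  + exists w. split; [exact Hw|]. apply Cmult_neq_0; [|exact HBw].
    apply Cpow_nz. apply Cmult_neq_0; auto.
    apply Cmod_pos_neq. rewrite Cmod_R, Rabs_pos_eq.
    * apply Rinv_0_lt_compat; lra.
    * left; apply Rinv_0_lt_compat; lra.
  + apply (ex_series_incr_n (K := R_AbsRing) (V := R_NormedModule) _ k0).
    apply ex_series_Rle with (fun k => thin_term theta1 f (z (k0 + k)%nat)).
    2:{ apply (ex_series_incr_n (K := R_AbsRing) (V := R_NormedModule) (fun k => thin_term theta1 f (z k)) k0), Hser. }
    intros j. set (k := (k0 + j)%nat). assert (Hz := Hdisc k). unfold in_disc in Hz.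
    assert (Hzk := Hk0 k ltac:(unfold k; lia)).
    split; [now apply thin_term_nonneg|].
    unfold thin_term. destruct (Req_dec_T (Cmod (z k)) 0) as [|Hnz]; [lra|].
    rewrite !Rmult_assoc. apply Rmult_le_compat_l; [lra|].
    assert (He := exp_pos (theta1 (1 - Cmod (z k)))). assert (Pf := Cmod_ge_0 (f (z k))).
    assert (Pf0 := Cmod_ge_0 (f0 (z k))).
    rewrite Cmod_mult, Cmod_pow.
    destruct (excluded_middle_informative (X k)) as [HX|HX].
    * rewrite (HB0 k), Cmod_0, !Rmult_0_r; [nra|].
      unfold c. destruct (excluded_middle_informative (X k)); [nra|contradiction].
    * assert (HX1 : exp (theta1 (1 - Cmod (z k))) * Cmod (f0 (z k)) <= 1).
      { apply Rnot_lt_le. intros H. apply HX. split; [unfold k; lia|exact H]. }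
      assert (HB1 := HBb (z k) Hz). assert (HB2 := Cmod_ge_0 (B (z k))).
      assert (Hex : exp (theta2 (1 - Cmod (z k))) <= exp (theta1 (1 - Cmod (z k))) ^ S p).
      { rewrite <- exp_mult_nat. apply exp_le_exp, Hth. lra. }
      assert (He2 := exp_pos (theta2 (1 - Cmod (z k)))).
      assert (Pfp := pow_le (Cmod (f0 (z k))) (S p) Pf0).
      (* With [x = exp theta1 * |f0| <= 1], the new factor is at most [x ^ (p + 1) <= x]: the power
         of [f0] absorbs the comparison constant. *)
      apply Rle_trans with (exp (theta1 (1 - Cmod (z k))) ^ S p * Cmod (f0 (z k)) ^ S p).
      { apply Rmult_le_compat; nra. }
      rewrite <- Rpow_mult_distr.
      eapply Rle_trans; [apply pow_le_base; split; [nra|exact HX1]|].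
      apply Rmult_le_compat_l; [lra|apply Hf0le].
Qed.

(** * Complex integrals and bisection *)

Lemma nested_intervals (u v : nat -> R) :
  (forall n, u n <= u (S n)) -> (forall n, v (S n) <= v n) -> (forall n, u n <= v n) ->
  exists x, forall n, u n <= x <= v n.
Proof.
intros Hu Hv Huv.
assert (Hum : forall n k, u n <= u (n + k)%nat).
{ intros n k. induction k as [|k IH]; [rewrite Nat.add_0_r; lra|].
  rewrite Nat.add_succ_r. assert (H := Hu (n + k)%nat). lra. }
assert (Hvm : forall n k, v (n + k)%nat <= v n).
{ intros n k. induction k as [|k IH]; [rewrite Nat.add_0_r; lra|].
  rewrite Nat.add_succ_r. assert (H := Hv (n + k)%nat). lra. }
assert (Huv' : forall n m, u n <= v m).
{ intros n m. assert (H1 := Hum n m). assert (H2 := Hvm m n).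
  assert (H3 := Huv (n + m)%nat). rewrite (Nat.add_comm m n) in H2. lra. }
destruct (completeness (fun t => exists n, t = u n)) as [x [Hx1 Hx2]].
- exists (v 0%nat). intros t [n ->]. apply Huv'.
- exists (u 0%nat). now exists 0%nat.
- exists x. intros n. split.
  + apply Hx1. now exists n.
  + apply Hx2. intros t [m ->]. apply Huv'.
Qed.

(** A failure of [P] is inherited by one of the four quarters, again and again; the failing
    rectangles shrink to a point, where the local hypothesis contradicts them. *)
Lemma rectangle_bisection (P : R -> R -> R -> R -> Prop) (a b c d : R) :
  a <= b -> c <= d ->
  (forall x1 x2 y1 y2, a <= x1 <= x2 -> x2 <= b -> c <= y1 <= y2 -> y2 <= d ->
     P x1 ((x1 + x2) / 2) y1 ((y1 + y2) / 2) ->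
     P ((x1 + x2) / 2) x2 y1 ((y1 + y2) / 2) ->
     P x1 ((x1 + x2) / 2) ((y1 + y2) / 2) y2 ->
     P ((x1 + x2) / 2) x2 ((y1 + y2) / 2) y2 -> P x1 x2 y1 y2) ->
  (forall x y, a <= x <= b -> c <= y <= d -> exists delta, 0 < delta /\
     forall x1 x2 y1 y2, a <= x1 <= x -> x <= x2 <= b -> c <= y1 <= y -> y <= y2 <= d ->
     x2 - x1 < delta -> y2 - y1 < delta -> P x1 x2 y1 y2) ->
  P a b c d.
Proof.
intros Hab Hcd Hq Hloc. apply NNPP. intros HnP.
set (good := fun s : (R * R) * (R * R) =>
  a <= fst (fst s) <= snd (fst s) /\ snd (fst s) <= b /\
  c <= fst (snd s) <= snd (snd s) /\ snd (snd s) <= d /\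
  ~ P (fst (fst s)) (snd (fst s)) (fst (snd s)) (snd (snd s))).
set (child := fun s s' : (R * R) * (R * R) =>
  fst (fst s) <= fst (fst s') /\ snd (fst s') <= snd (fst s) /\
  snd (fst s') - fst (fst s') = (snd (fst s) - fst (fst s)) / 2 /\
  fst (snd s) <= fst (snd s') /\ snd (snd s') <= snd (snd s) /\
  snd (snd s') - fst (snd s') = (snd (snd s) - fst (snd s)) / 2).
assert (Hstep : forall s, exists s', good s -> good s' /\ child s s').
{ intros [[x1 x2] [y1 y2]].
  destruct (classic (good ((x1, x2), (y1, y2)))) as [Hg|Hg].
  2:{ exists ((x1, x2), (y1, y2)). intros H; contradiction. }
  destruct Hg as [H1 [H2 [H3 [H4 H5]]]]; simpl in *.
  set (xm := (x1 + x2) / 2). set (ym := (y1 + y2) / 2).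
  destruct (classic (P x1 xm y1 ym)) as [Q1|Q1].
  2:{ exists ((x1, xm), (y1, ym)); intros _; unfold good, child, xm, ym in *; simpl; repeat split; auto; lra. }
  destruct (classic (P xm x2 y1 ym)) as [Q2|Q2].
  2:{ exists ((xm, x2), (y1, ym)); intros _; unfold good, child, xm, ym in *; simpl; repeat split; auto; lra. }
  destruct (classic (P x1 xm ym y2)) as [Q3|Q3].
  2:{ exists ((x1, xm), (ym, y2)); intros _; unfold good, child, xm, ym in *; simpl; repeat split; auto; lra. }
  destruct (classic (P xm x2 ym y2)) as [Q4|Q4].
  2:{ exists ((xm, x2), (ym, y2)); intros _; unfold good, child, xm, ym in *; simpl; repeat split; auto; lra. }
  exfalso. apply H5. apply Hq; auto. }
destruct (choice _ Hstep) as [step Hs].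
set (s := fix s (n : nat) := match n with O => ((a, b), (c, d)) | S n => step (s n) end).
assert (Hgood : forall n, good (s n)).
{ induction n as [|n IH].
  - unfold good; simpl. repeat split; auto; lra.
  - apply (Hs (s n) IH). }
assert (Hchild : forall n, child (s n) (s (S n))) by (intros n; apply (Hs (s n) (Hgood n))).
assert (Hlen : forall n, snd (fst (s n)) - fst (fst (s n)) = (b - a) * (/ 2) ^ n /\
   snd (snd (s n)) - fst (snd (s n)) = (d - c) * (/ 2) ^ n).
{ induction n as [|n [IH1 IH2]]; [simpl; lra|].
  destruct (Hchild n) as [_ [_ [E1 [_ [_ E2]]]]]. rewrite E1, E2, IH1, IH2. simpl.
  split; field. }
destruct (nested_intervals (fun n => fst (fst (s n))) (fun n => snd (fst (s n)))) as [x Hx].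
{ intros n; apply (Hchild n). } { intros n; apply (Hchild n). } { intros n; apply (Hgood n). }
destruct (nested_intervals (fun n => fst (snd (s n))) (fun n => snd (snd (s n)))) as [y Hy].
{ intros n; apply (Hchild n). } { intros n; apply (Hchild n). } { intros n; apply (Hgood n). }
destruct (Hloc x y) as [delta [Hdelta Hl]]; [apply (Hx 0%nat)|apply (Hy 0%nat)|].
assert (Hlim : is_lim_seq (fun n => ((b - a) + (d - c)) * (/ 2) ^ n) 0).
{ replace (Finite 0) with (Rbar_mult ((b - a) + (d - c)) 0) by (simpl; f_equal; ring).
  apply is_lim_seq_scal_l. apply is_lim_seq_geom. rewrite Rabs_pos_eq; lra. }
apply is_lim_seq_spec in Hlim. destruct (Hlim (mkposreal delta Hdelta)) as [N HN].
specialize (HN N (le_n N)). simpl in HN. apply Rabs_def2 in HN.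
destruct (Hlen N) as [L1 L2]. destruct (Hgood N) as [G1 [G2 [G3 [G4 G5]]]].
assert (Pn : 0 < (/ 2) ^ N) by (apply pow_lt; lra).
apply G5. apply Hl; try (split; [|apply Hx || apply Hy]); try (split; [apply Hx || apply Hy|]);
  try lra; try rewrite L1; try rewrite L2; try nra.
Qed.

(** * Integrals of complex-valued functions over real intervals *)

Definition CI (g : R -> C) (a b : R) (l : C) : Prop :=
  is_RInt (fun t => Re (g t)) a b (Re l) /\ is_RInt (fun t => Im (g t)) a b (Im l).

Definition CInt (g : R -> C) (a b : R) : C :=
  (RInt (fun t => Re (g t)) a b, RInt (fun t => Im (g t)) a b).

Definition rcont (g : R -> C) (t : R) : Prop :=
  forall eps, 0 < eps -> exists delta, 0 < delta /\
    forall s, Rabs (s - t) < delta -> Cmod (g s - g t) < eps.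

Lemma rcont_continuous (g : R -> C) (t : R) (p : C -> R) :
  (forall u v, Rabs (p u - p v) <= Cmod (u - v)) -> rcont g t ->
  continuous (fun s => p (g s)) t.
Proof.
intros Hp H. apply filterlim_locally. intros eps.
destruct (H eps (cond_pos eps)) as [d [Hd Hs]]. exists (mkposreal d Hd).
intros s Hb. specialize (Hs s Hb).
apply (Rle_lt_trans _ _ _ (Hp _ _) Hs).
Qed.

Lemma Re_lip u v : Rabs (Re u - Re v) <= Cmod (u - v).
Proof. apply (Re_Im_Cmod_le (u - v)). Qed.
Lemma Im_lip u v : Rabs (Im u - Im v) <= Cmod (u - v).
Proof. apply (Re_Im_Cmod_le (u - v)). Qed.

Lemma CI_CInt (g : R -> C) (a b : R) : a <= b ->
  (forall t, a <= t <= b -> rcont g t) -> CI g a b (CInt g a b).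
Proof.
intros Hab H. split; apply (RInt_correct (V := R_CompleteNormedModule));
  apply ex_RInt_continuous; intros t Ht; rewrite Rmin_left, Rmax_right in Ht by auto;
  apply rcont_continuous; auto; [apply Re_lip|apply Im_lip].
Qed.

Lemma CI_unique (g : R -> C) (a b : R) (l : C) : CI g a b l -> CInt g a b = l.
Proof.
intros [H1 H2]. unfold CInt. destruct l as [x y]. f_equal; now apply is_RInt_unique.
Qed.

Lemma CI_ext (g h : R -> C) (a b : R) (l : C) : a <= b ->
  (forall t, a <= t <= b -> g t = h t) -> CI g a b l -> CI h a b l.
Proof.
intros Hab E [H1 H2]. split.
- apply is_RInt_ext with (fun t => Re (g t)); auto.
  intros t Ht. rewrite Rmin_left, Rmax_right in Ht by auto. rewrite E; auto; lra.
- apply is_RInt_ext with (fun t => Im (g t)); auto.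
  intros t Ht. rewrite Rmin_left, Rmax_right in Ht by auto. rewrite E; auto; lra.
Qed.

Lemma CI_plus (g h : R -> C) (a b : R) (l m : C) :
  CI g a b l -> CI h a b m -> CI (fun t => g t + h t)%C a b (l + m)%C.
Proof.
intros [G1 G2] [H1 H2]. split.
- exact (is_RInt_plus _ _ _ _ _ _ G1 H1).
- exact (is_RInt_plus _ _ _ _ _ _ G2 H2).
Qed.

Lemma CI_scal (c : C) (g : R -> C) (a b : R) (l : C) :
  CI g a b l -> CI (fun t => c * g t)%C a b (c * l)%C.
Proof.
intros [G1 G2]. split.
- exact (is_RInt_minus _ _ _ _ _ _ (is_RInt_scal _ _ _ (Re c) _ G1) (is_RInt_scal _ _ _ (Im c) _ G2)).
- exact (is_RInt_plus _ _ _ _ _ _ (is_RInt_scal _ _ _ (Re c) _ G2) (is_RInt_scal _ _ _ (Im c) _ G1)).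
Qed.

Lemma CI_Chasles (g : R -> C) (a b c : R) (l m : C) :
  CI g a b l -> CI g b c m -> CI g a c (l + m)%C.
Proof.
intros [G1 G2] [H1 H2]. split.
- exact (is_RInt_Chasles _ _ _ _ _ _ G1 H1).
- exact (is_RInt_Chasles _ _ _ _ _ _ G2 H2).
Qed.

Lemma CI_const (c : C) (a b : R) : CI (fun _ => c) a b (RtoC (b - a) * c)%C.
Proof.
split.
- replace (Re (RtoC (b - a) * c)) with (scal (b - a) (Re c)).
  + apply (is_RInt_const a b (Re c)).
  + unfold scal; simpl; unfold mult; simpl. unfold Re; simpl; ring.
- replace (Im (RtoC (b - a) * c)) with (scal (b - a) (Im c)).
  + apply (is_RInt_const a b (Im c)).
  + unfold scal; simpl; unfold mult; simpl. unfold Im; simpl; ring.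
Qed.

Lemma CI_conj (g : R -> C) (a b : R) (l : C) :
  CI g a b l -> CI (fun t => Cconj (g t)) a b (Cconj l).
Proof.
intros [G1 G2]. split; [exact G1|]. exact (is_RInt_opp _ _ _ _ G2).
Qed.

(* Rotating [l] to the positive real axis reduces the bound to the real part. *)
Lemma CI_bound (g : R -> C) (a b : R) (l : C) (M : R) : a <= b ->
  (forall t, a <= t <= b -> Cmod (g t) <= M) -> CI g a b l -> Cmod l <= (b - a) * M.
Proof.
intros Hab HM H. assert (P := Cmod_ge_0 l).
destruct (CI_scal (Cconj l) _ _ _ _ H) as [H1 _].
assert (E : Re (Cconj l * l) = Cmod l ^ 2).
{ rewrite Cmod2_alt. destruct l as [x y]; simpl; ring. }
rewrite E in H1.
assert (Hle : Cmod l ^ 2 <= (b - a) * (Cmod l * M)).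
{ apply (is_RInt_le (fun t => Re (Cconj l * g t)) (fun _ => Cmod l * M) a b); auto.
  - apply (is_RInt_const (V := R_NormedModule)).
  - intros t Ht. eapply Rle_trans; [apply Rle_abs|]. eapply Rle_trans; [apply re_le_Cmod|].
    rewrite Cmod_mult, Cmod_conj. apply Rmult_le_compat_l; auto. apply HM; lra. }
destruct (Req_dec (Cmod l) 0) as [H0|H0].
- rewrite H0. apply Rmult_le_pos; [lra|].
  eapply Rle_trans; [apply Cmod_ge_0|apply (HM a); lra].
- apply Rmult_le_reg_l with (Cmod l); [lra|]. nra.
Qed.

Lemma rcont_const (c : C) (t : R) : rcont (fun _ => c) t.
Proof.
intros eps He. exists 1; split; [lra|]. intros s _.
replace (c - c)%C with (RtoC 0) by ring. now rewrite Cmod_0.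
Qed.

Lemma rcont_plus (g h : R -> C) (t : R) :
  rcont g t -> rcont h t -> rcont (fun s => g s + h s)%C t.
Proof.
intros Hg Hh eps He.
destruct (Hg (eps / 2) ltac:(lra)) as [d1 [Hd1 H1]].
destruct (Hh (eps / 2) ltac:(lra)) as [d2 [Hd2 H2]].
exists (Rmin d1 d2). split; [now apply Rmin_glb_lt|]. intros s Hs.
specialize (H1 s ltac:(apply (lt_Rmin _ _ _ Hs))).
specialize (H2 s ltac:(apply (lt_Rmin _ _ _ Hs))).
replace (g s + h s - (g t + h t))%C with ((g s - g t) + (h s - h t))%C by ring.
eapply Rle_lt_trans; [apply Cmod_triangle|]. lra.
Qed.

Lemma rcont_comp (f : C -> C) (g : R -> C) (t : R) :
  cdiff f (g t) -> rcont g t -> rcont (fun s => f (g s)) t.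
Proof.
intros Hf Hg eps He.
destruct (cdiff_continuous f _ Hf eps He) as [d [Hd H1]].
destruct (Hg d Hd) as [d' [Hd' H2]]. exists d'. split; auto.
Qed.

Lemma rcont_mult (g h : R -> C) (t : R) :
  rcont g t -> rcont h t -> rcont (fun s => g s * h s)%C t.
Proof.
intros Hg Hh eps He.
assert (Pg := Cmod_ge_0 (g t)). assert (Ph := Cmod_ge_0 (h t)).
set (e := Rmin 1 (eps / (Cmod (g t) + Cmod (h t) + 2))).
assert (He1 : e <= 1) by apply Rmin_l.
assert (He2 : e * (Cmod (g t) + Cmod (h t) + 2) <= eps).
{ apply Rle_trans with (eps / (Cmod (g t) + Cmod (h t) + 2) * (Cmod (g t) + Cmod (h t) + 2)).
  - apply Rmult_le_compat_r; [lra|apply Rmin_r].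
  - right; field; lra. }
assert (He0 : 0 < e) by (apply Rmin_glb_lt; [lra|apply Rdiv_lt_0_compat; lra]).
destruct (Hg e He0) as [d1 [Hd1 H1]]. destruct (Hh e He0) as [d2 [Hd2 H2]].
exists (Rmin d1 d2). split; [now apply Rmin_glb_lt|]. intros s Hs.
specialize (H1 s ltac:(apply (lt_Rmin _ _ _ Hs))).
specialize (H2 s ltac:(apply (lt_Rmin _ _ _ Hs))).
replace (g s * h s - g t * h t)%C with
  ((g s - g t) * (h s - h t) + (g s - g t) * h t + g t * (h s - h t))%C by ring.
eapply Rle_lt_trans; [apply Cmod_triangle|].
eapply Rle_lt_trans; [apply Rplus_le_compat_r; apply Cmod_triangle|].
rewrite !Cmod_mult.
assert (Q2 := Cmod_ge_0 (h s - h t)). nra.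
Qed.

Lemma rcont_inv (g : R -> C) (t : R) : rcont g t -> g t <> RtoC 0 -> rcont (fun s => / g s)%C t.
Proof.
intros Hg Hn eps He. assert (P : 0 < Cmod (g t)) by now apply Cmod_gt_0.
assert (He' : 0 < Rmin (Cmod (g t) / 2) (eps * Cmod (g t) ^ 2 / 2)).
{ apply Rmin_glb_lt; [lra|]. assert (0 < Cmod (g t) ^ 2) by (apply pow_lt; lra). nra. }
destruct (Hg _ He') as [d [Hd H]]. exists d; split; auto. intros s Hs.
specialize (H s Hs).
assert (H1 : Cmod (g s - g t) < Cmod (g t) / 2) by apply (lt_Rmin _ _ _ H).
assert (H2 : Cmod (g s - g t) < eps * Cmod (g t) ^ 2 / 2) by apply (lt_Rmin _ _ _ H).
assert (H3 := Cmod_sub_ge (g t) (g t - g s)).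
replace (g t - (g t - g s))%C with (g s) in H3 by ring.
rewrite (Cmod_sub_sym (g t) (g s)) in H3.
assert (P2 : Cmod (g t) / 2 < Cmod (g s)) by lra.
assert (Hs0 : g s <> RtoC 0) by (apply Cmod_pos_neq; lra).
replace (/ g s - / g t)%C with (- (g s - g t) * (/ g s * / g t))%C by (field; auto).
rewrite Cmod_mult, Cmod_opp, Cmod_mult, !Cmod_inv by auto.
assert (Hi : / Cmod (g s) <= 2 * / Cmod (g t)).
{ replace (2 * / Cmod (g t)) with (/ (Cmod (g t) / 2)) by (field; lra).
  apply Rinv_le_contravar; lra. }
assert (Pi : 0 < / Cmod (g t)) by now apply Rinv_0_lt_compat.
apply Rle_lt_trans with (Cmod (g s - g t) * (2 * / Cmod (g t) * / Cmod (g t))).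
- apply Rmult_le_compat_l; [apply Cmod_ge_0|]. apply Rmult_le_compat_r; lra.
- apply Rlt_le_trans with (eps * Cmod (g t) ^ 2 / 2 * (2 * / Cmod (g t) * / Cmod (g t))).
  + apply Rmult_lt_compat_r; nra.
  + right; field; lra.
Qed.

Lemma rcont_lipschitz (g : R -> C) (t L d : R) : 0 < d ->
  (forall s, Rabs (s - t) < d -> Cmod (g s - g t) <= L * Rabs (s - t)) -> rcont g t.
Proof.
intros Hd H eps He.
assert (HL : 0 < Rabs L + 1) by (assert (Q := Rabs_pos L); lra).
exists (Rmin d (eps / (Rabs L + 1))). split.
- apply Rmin_glb_lt; auto. now apply Rdiv_lt_0_compat.
- intros s Hs. eapply Rle_lt_trans.
  + apply H. eapply Rlt_le_trans; [apply Hs|apply Rmin_l].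
  + assert (H1 : Rabs (s - t) < eps / (Rabs L + 1)) by apply (lt_Rmin _ _ _ Hs).
    assert (H2 : (Rabs L + 1) * Rabs (s - t) < eps).
    { apply Rlt_le_trans with ((Rabs L + 1) * (eps / (Rabs L + 1))).
      - apply Rmult_lt_compat_l; lra.
      - right; field; lra. }
    assert (Q := Rabs_pos (s - t)). assert (Q' := Rle_abs L). nra.
Qed.

(** * Cauchy's formula *)

Lemma cos_lipschitz (u v : R) : Rabs (cos u - cos v) <= Rabs (u - v).
Proof.
rewrite <- (Rmult_1_l (Rabs (u - v))).
apply (bounded_variation cos (fun t => - sin t)).
intros t _. split.
- auto_derive; auto. ring.
- rewrite Rabs_Ropp. apply Rabs_le. assert (H := SIN_bound t). lra.
Qed.

Lemma sin_lipschitz (u v : R) : Rabs (sin u - sin v) <= Rabs (u - v).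
Proof.
rewrite <- (Rmult_1_l (Rabs (u - v))).
apply (bounded_variation sin cos).
intros t _. split.
- auto_derive; auto. ring.
- apply Rabs_le. assert (H := COS_bound t). lra.
Qed.

Definition circle (r t : R) : C := (r * cos t, r * sin t).

Lemma Cmod_circle (r t : R) : 0 <= r -> Cmod (circle r t) = r.
Proof.
intros Hr. unfold Cmod, circle; simpl.
replace (r * cos t * (r * cos t * 1) + r * sin t * (r * sin t * 1)) with (r ^ 2).
- now apply sqrt_pow2.
- assert (H := sin2_cos2 t). unfold Rsqr in H.
  replace (r * cos t * (r * cos t * 1) + r * sin t * (r * sin t * 1))
    with (r ^ 2 * (sin t * sin t + cos t * cos t)) by ring. rewrite H; ring.
Qed.

Lemma circle_lipschitz (r s t : R) : 0 <= r ->
  Cmod (circle r s - circle r t) <= 2 * r * Rabs (s - t).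
Proof.
intros Hr. eapply Rle_trans; [apply Cmod_le_abs|].
replace (Re (circle r s - circle r t)) with (r * (cos s - cos t)) by (unfold circle; simpl; ring).
replace (Im (circle r s - circle r t)) with (r * (sin s - sin t)) by (unfold circle; simpl; ring).
rewrite !Rabs_mult, (Rabs_pos_eq r) by auto.
assert (H1 := cos_lipschitz s t). assert (H2 := sin_lipschitz s t). nra.
Qed.

Lemma circle_2PI (r : R) : circle r (2 * PI) = circle r 0.
Proof. unfold circle. now rewrite cos_2PI, sin_2PI, cos_0, sin_0. Qed.

Lemma rcont_circle (r t : R) : 0 <= r -> rcont (circle r) t.
Proof.
intros Hr. apply rcont_lipschitz with (2 * r) 1; [lra|]. intros s _. now apply circle_lipschitz.
Qed.

Lemma CI_i_circle (r a b : R) :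
  CI (fun t => Ci * circle r t)%C a b (circle r b - circle r a)%C.
Proof.
split.
- apply is_RInt_ext with (fun t => - (r * sin t)).
  { intros t _. unfold circle; simpl; ring. }
  apply (is_RInt_derive (fun t => r * cos t) (fun t => - (r * sin t)) a b).
  + intros t _. auto_derive; auto. ring.
  + intros t _. apply (ex_derive_continuous (fun t => - (r * sin t))). auto_derive; auto.
- apply is_RInt_ext with (fun t => r * cos t).
  { intros t _. unfold circle; simpl; ring. }
  apply (is_RInt_derive (fun t => r * sin t) (fun t => r * cos t) a b).
  + intros t _. auto_derive; auto. ring.
  + intros t _. apply (ex_derive_continuous (fun t => r * cos t)). auto_derive; auto.
Qed.

(* Goursat's argument for the closed form [f(z) dz / (z - a)], pulled back by
   [(x, t) |-> a + x (r e^(it) - a)]. In these coordinates [x] cancels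
   from the component along [t], which is [f * winding], so that letting [x]
   tend to [0] evaluates the contour integral. *)
Section Cauchy.

Variables (f : C -> C) (r : R) (a : C).
Hypothesis f_diff : forall z, Cmod z <= r -> cdiff f z.
Hypothesis a_in : Cmod a < r.

Let G := circle r.
Let Gam (x t : R) : C := (a + RtoC x * (G t - a))%C.
(** The logarithmic derivative of [G t - a], because [Ci * G t] is the derivative of [G]. *)
Let winding (t : R) : C := (Ci * (G t / (G t - a)))%C.
Let u (x t : R) : C := f (Gam x t).

Lemma radius_pos : 0 < r.
Proof. assert (H := Cmod_ge_0 a). lra. Qed.

Lemma Cmod_contour t : Cmod (G t) = r.
Proof. apply Cmod_circle. assert (H := radius_pos). lra. Qed.

Lemma Cmod_contour_sub t : r - Cmod a <= Cmod (G t - a) <= 2 * r.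
Proof.
assert (H := Cmod_sub_ge (G t) a). assert (H' := Cmod_sub_le (G t) a).
rewrite Cmod_contour in H, H'. lra.
Qed.

Lemma contour_sub_neq0 t : (G t - a)%C <> RtoC 0.
Proof. apply Cmod_pos_neq. assert (H := Cmod_contour_sub t). lra. Qed.

Lemma Cmod_homotopy x t : 0 <= x <= 1 -> Cmod (Gam x t) <= r.
Proof.
intros Hx. unfold Gam.
replace (a + RtoC x * (G t - a))%C with (RtoC (1 - x) * a + RtoC x * G t)%C
  by (rewrite RtoC_minus; ring).
eapply Rle_trans; [apply Cmod_triangle|].
rewrite !Cmod_mult, !Cmod_R, !Rabs_pos_eq by lra. rewrite Cmod_contour. nra.
Qed.

Lemma homotopy_lipschitz x t x' t' : 0 <= x' <= 1 ->
  Cmod (Gam x t - Gam x' t') <= 2 * r * (Rabs (x - x') + Rabs (t - t')).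
Proof.
intros Hx. unfold Gam.
replace (a + RtoC x * (G t - a) - (a + RtoC x' * (G t' - a)))%C
  with (RtoC (x - x') * (G t - a) + RtoC x' * (G t - G t'))%C by (rewrite RtoC_minus; ring).
eapply Rle_trans; [apply Cmod_triangle|].
rewrite !Cmod_mult, !Cmod_R, (Rabs_pos_eq x') by lra.
assert (H1 := Cmod_contour_sub t). assert (H2 := circle_lipschitz r t t' ltac:(lra)). fold G in H2.
assert (P1 := Rabs_pos (x - x')). assert (P3 := Cmod_ge_0 (G t - G t')). nra.
Qed.

Lemma rcont_winding t : rcont winding t.
Proof.
assert (Hr := radius_pos). apply rcont_mult; [apply rcont_const|]. apply rcont_mult.
- apply rcont_circle; lra.
- apply rcont_inv; [|apply contour_sub_neq0].
  apply rcont_plus; [apply rcont_circle; lra|apply rcont_const].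
Qed.

Lemma Cmod_winding t : Cmod (winding t) <= r / (r - Cmod a).
Proof.
unfold winding. rewrite Cmod_mult, Cmod_Ci, Rmult_1_l, Cmod_div by apply contour_sub_neq0.
rewrite Cmod_contour. assert (H := Cmod_contour_sub t). apply Rmult_le_compat_l; [lra|]. apply Rinv_le_contravar; lra.
Qed.

Lemma rcont_circular x t : 0 <= x <= 1 -> rcont (fun s => u x s) t.
Proof.
intros Hx. apply (rcont_comp f (fun s => Gam x s)); [apply f_diff, Cmod_homotopy; auto|].
apply rcont_lipschitz with (2 * r) 1; [lra|]. intros s _.
assert (H := homotopy_lipschitz x s x t Hx).
replace (x - x) with 0 in H by ring. rewrite Rabs_R0, Rplus_0_l in H. exact H.
Qed.

Lemma rcont_radial x t : 0 <= x <= 1 -> rcont (fun y => u y t) x.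
Proof.
intros Hx. apply (rcont_comp f (fun y => Gam y t)); [apply f_diff, Cmod_homotopy; auto|].
apply rcont_lipschitz with (2 * r) 1; [lra|]. intros s _.
assert (H := homotopy_lipschitz s t x t Hx).
replace (t - t) with 0 in H by ring. rewrite Rabs_R0, Rplus_0_r in H. exact H.
Qed.

Lemma rcont_Rinv x : 0 < x -> rcont (fun y => RtoC (/ y)) x.
Proof.
intros Hx. intros eps He.
assert (Hc : continuous Rinv x).
{ apply (ex_derive_continuous Rinv x). auto_derive. lra. }
destruct (proj1 (filterlim_locally Rinv (/ x)) Hc (mkposreal eps He)) as [d Hd].
exists d. split; [apply cond_pos|]. intros s Hs. rewrite <- RtoC_minus, Cmod_R. exact (Hd s Hs).
Qed.

(** [A] and [D] integrate the pulled-back form along the two coordinate directions: [dz / (z - a)]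
    becomes [winding dt] for fixed [x] and [dx / x] for fixed [t]. *)
Let A (x t1 t2 : R) : C := CInt (fun t => u x t * winding t)%C t1 t2.
Let D (t x1 x2 : R) : C := CInt (fun x => u x t * RtoC (/ x))%C x1 x2.

Lemma CI_circular_part x t1 t2 : 0 <= x <= 1 -> t1 <= t2 ->
  CI (fun t => u x t * winding t)%C t1 t2 (A x t1 t2).
Proof.
intros Hx Ht. apply CI_CInt; auto. intros t _.
apply rcont_mult; [now apply rcont_circular|apply rcont_winding].
Qed.

Lemma CI_radial_part t x1 x2 : 0 < x1 -> x1 <= x2 -> x2 <= 1 ->
  CI (fun x => u x t * RtoC (/ x))%C x1 x2 (D t x1 x2).
Proof.
intros H1 H2 H3. apply CI_CInt; auto. intros x Hx.
apply rcont_mult; [apply rcont_radial; lra|apply rcont_Rinv; lra].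
Qed.

(** Integral of the form around the boundary of the coordinate rectangle, counterclockwise. *)
Let J (x1 x2 t1 t2 : R) : C := (A x2 t1 t2 - A x1 t1 t2 - (D t2 x1 x2 - D t1 x1 x2))%C.

Lemma circular_part_Chasles x t1 t2 t3 : 0 <= x <= 1 -> t1 <= t2 -> t2 <= t3 ->
  A x t1 t3 = (A x t1 t2 + A x t2 t3)%C.
Proof.
intros Hx H1 H2. apply CI_unique. apply CI_Chasles with t2; now apply CI_circular_part.
Qed.

Lemma radial_part_Chasles t x1 x2 x3 : 0 < x1 -> x1 <= x2 -> x2 <= x3 -> x3 <= 1 ->
  D t x1 x3 = (D t x1 x2 + D t x2 x3)%C.
Proof.
intros H0 H1 H2 H3. apply CI_unique. apply CI_Chasles with x2; apply CI_radial_part; lra.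
Qed.

(** Near the point, [f] is affine up to an error [eta |z - z0|]. The affine part integrates to 0
    around the rectangle, leaving an error of size [eta] times a side times a perimeter. The bound
    [s <= x] controls the factor [1 / x]. *)
Lemma goursat_local (s : R) (x0 t0 : R) (eps : R) : 0 < s -> s <= x0 <= 1 -> 0 < eps ->
  exists delta, 0 < delta /\ forall x1 x2 t1 t2,
    s <= x1 <= x0 -> x0 <= x2 <= 1 -> t1 <= t0 -> t0 <= t2 ->
    x2 - x1 < delta -> t2 - t1 < delta ->
    Cmod (J x1 x2 t1 t2) <= eps * ((x2 - x1) + (t2 - t1)) ^ 2.
Proof.
intros Hs Hx0 He. assert (Hr := radius_pos).
set (W := r / (r - Cmod a)).
assert (HW : 0 < W) by (apply Rdiv_lt_0_compat; lra).
assert (His : 0 < / s) by now apply Rinv_0_lt_compat.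
set (z0 := Gam x0 t0).
destruct (proj1 (cdiff_iff f z0) (f_diff z0 (Cmod_homotopy x0 t0 ltac:(lra)))) as [l Hl].
set (eta := eps / (4 * r * (W + / s))).
assert (Heta : 0 < eta) by (apply Rdiv_lt_0_compat; nra).
assert (Eeta : eta * (4 * r * (W + / s)) = eps) by (unfold eta; field; split; [lra|nra]).
destruct (Hl eta Heta) as [d [Hd Hrem]].
exists (d / (4 * r)). split; [apply Rdiv_lt_0_compat; lra|].
intros x1 x2 t1 t2 H1 H2 H3 H4 H5 H6.
(* The affine approximation is recentred at [a], where [Gam x t - a = x (G t - a)] makes all
   integrals explicit. The [al] parts agree on opposite sides, and the [l] parts give
   [l (x2 - x1) (G t2 - G t1)] from both pairs of sides, with opposite signs. *)
set (al := (f z0 + l * (a - z0))%C).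
set (S := (x2 - x1) + (t2 - t1)).
assert (HS : 0 <= S) by (unfold S; lra).
set (h := fun x t => (u x t - (al + l * (Gam x t - a)))%C).
assert (Hh : forall x t, x1 <= x <= x2 -> t1 <= t <= t2 -> Cmod (h x t) <= eta * (2 * r * S)).
{ intros x t Hx Ht.
  assert (HG := homotopy_lipschitz x t x0 t0 ltac:(lra)).
  assert (HA : Rabs (x - x0) + Rabs (t - t0) <= S).
  { unfold S. apply Rplus_le_compat; apply Rabs_le; lra. }
  assert (HG' : Cmod (Gam x t - z0) <= 2 * r * S).
  { eapply Rle_trans; [apply HG|]. apply Rmult_le_compat_l; lra. }
  assert (HSd : 2 * r * S < d).
  { assert (S < 2 * (d / (4 * r))) by (unfold S; lra).
    replace d with (2 * r * (2 * (d / (4 * r)))) by (field; lra).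
    apply Rmult_lt_compat_l; lra. }
  unfold h, u, al.
  replace (f (Gam x t) - (f z0 + l * (a - z0) + l * (Gam x t - a)))%C
    with (f (Gam x t) - f z0 - (Gam x t - z0) * l)%C by ring.
  eapply Rle_trans; [apply Hrem; lra|]. apply Rmult_le_compat_l; lra. }
assert (EA : forall x, x1 <= x <= x2 ->
  Cmod (A x t1 t2 - (al * CInt winding t1 t2 + l * RtoC x * (G t2 - G t1)))
   <= (t2 - t1) * (eta * (2 * r * S) * W)).
{ intros x Hx.
  apply CI_bound with (g := fun t => (h x t * winding t)%C); [lra| |].
  - intros t Ht. rewrite Cmod_mult. apply Rmult_le_compat; try apply Cmod_ge_0.
    + now apply Hh.
    + apply Cmod_winding.
  - apply CI_ext with (fun t => u x t * winding t + RtoC (-1) *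
      (al * winding t + l * RtoC x * (Ci * G t)))%C; [lra| |].
    + intros t _. unfold h, winding, Gam. field. apply contour_sub_neq0.
    + replace (A x t1 t2 - (al * CInt winding t1 t2 + l * RtoC x * (G t2 - G t1)))%C
        with (A x t1 t2 + RtoC (-1) * (al * CInt winding t1 t2 + l * RtoC x * (G t2 - G t1)))%C by ring.
      apply CI_plus; [apply CI_circular_part; lra|]. apply CI_scal.
      apply CI_plus; [apply CI_scal, CI_CInt; [lra|intros; apply rcont_winding]|].
      apply CI_scal. apply CI_i_circle. }
assert (ED : forall t, t1 <= t <= t2 ->
  Cmod (D t x1 x2 - (al * CInt (fun x => RtoC (/ x)) x1 x2 + RtoC (x2 - x1) * (l * (G t - a))))
   <= (x2 - x1) * (eta * (2 * r * S) * / s)).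
{ intros t Ht.
  apply CI_bound with (g := fun x => (h x t * RtoC (/ x))%C); [lra| |].
  - intros x Hx. assert (0 < / x) by (apply Rinv_0_lt_compat; lra).
    rewrite Cmod_mult, Cmod_R, (Rabs_pos_eq (/ x)) by lra.
    apply Rmult_le_compat; [apply Cmod_ge_0|lra|now apply Hh|].
    apply Rinv_le_contravar; lra.
  - apply CI_ext with (fun x => u x t * RtoC (/ x) + RtoC (-1) *
      (al * RtoC (/ x) + l * (G t - a)))%C; [lra| |].
    + intros x Hx. unfold h, Gam. rewrite RtoC_inv by lra. field.
      intros E. apply RtoC_inj in E. lra.
    + replace (D t x1 x2 - (al * CInt (fun x => RtoC (/ x)) x1 x2 + RtoC (x2 - x1) * (l * (G t - a))))%C
        with (D t x1 x2 + RtoC (-1) * (al * CInt (fun x => RtoC (/ x)) x1 x2 + RtoC (x2 - x1) * (l * (G t - a))))%C by ring.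
      apply CI_plus; [apply CI_radial_part; lra|]. apply CI_scal.
      apply CI_plus; [apply CI_scal, CI_CInt; [lra|intros; apply rcont_Rinv; lra]|].
      apply CI_const. }
assert (A1 := EA x1 ltac:(lra)). assert (A2 := EA x2 ltac:(lra)).
assert (D1 := ED t1 ltac:(lra)). assert (D2 := ED t2 ltac:(lra)).
unfold J.
match type of A1 with Cmod ?e <= _ => set (a1 := e) in * end.
match type of A2 with Cmod ?e <= _ => set (a2 := e) in * end.
match type of D1 with Cmod ?e <= _ => set (d1 := e) in * end.
match type of D2 with Cmod ?e <= _ => set (d2 := e) in * end.
replace (A x2 t1 t2 - A x1 t1 t2 - (D t2 x1 x2 - D t1 x1 x2))%C with ((a2 - a1) - (d2 - d1))%C.
2:{ unfold a1, a2, d1, d2. rewrite RtoC_minus. ring. }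
assert (B1 := Cmod_sub_le a2 a1). assert (B2 := Cmod_sub_le d2 d1).
eapply Rle_trans; [apply Cmod_sub_le|].
apply Rle_trans with (2 * ((t2 - t1) * (eta * (2 * r * S) * W)) + 2 * ((x2 - x1) * (eta * (2 * r * S) * / s))); [lra|].
replace (eps * S ^ 2) with (S * (eta * (2 * r * S) * W) * 2 + S * (eta * (2 * r * S) * / s) * 2).
2:{ rewrite <- Eeta. ring. }
assert (0 <= eta * (2 * r * S)) by (apply Rmult_le_pos; nra).
assert (0 <= eta * (2 * r * S) * W) by nra.
assert (0 <= eta * (2 * r * S) * / s) by nra.
unfold S at 3 5. nra.
Qed.

(** [J] is additive over quarters while the bound [eps] times a squared half perimeter is divided by
    4, so it passes from small rectangles to the whole one; [eps] is chosen so that it would then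
    give [|J| <= |J| / 2]. *)
Lemma goursat (s : R) : 0 < s <= 1 -> J s 1 0 (2 * PI) = RtoC 0.
Proof.
intros Hs. assert (Hpi := PI_RGT_0).
apply NNPP. intros Hn. apply Cmod_gt_0 in Hn.
set (T := (1 - s) + (2 * PI - 0)).
assert (HT : 0 < T) by (unfold T; lra).
set (eps := Cmod (J s 1 0 (2 * PI)) / (2 * T ^ 2)).
assert (HT2 : 0 < T ^ 2) by (apply pow_lt; lra).
assert (He : 0 < eps) by (apply Rdiv_lt_0_compat; lra).
assert (H : Cmod (J s 1 0 (2 * PI)) <= eps * T ^ 2).
{ apply (rectangle_bisection (fun x1 x2 t1 t2 =>
    Cmod (J x1 x2 t1 t2) <= eps * ((x2 - x1) + (t2 - t1)) ^ 2) s 1 0 (2 * PI)); try lra.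
  - intros x1 x2 t1 t2 H1 H2 H3 H4 Q1 Q2 Q3 Q4.
    set (xm := (x1 + x2) / 2) in *. set (tm := (t1 + t2) / 2) in *.
    assert (Hxm : xm = (x1 + x2) / 2) by reflexivity.
    assert (Htm : tm = (t1 + t2) / 2) by reflexivity.
    replace (J x1 x2 t1 t2) with ((J x1 xm t1 tm + J xm x2 t1 tm) + (J x1 xm tm t2 + J xm x2 tm t2))%C.
    2:{ unfold J.
        rewrite (circular_part_Chasles x2 t1 tm t2), (circular_part_Chasles x1 t1 tm t2), (radial_part_Chasles t2 x1 xm x2),
          (radial_part_Chasles t1 x1 xm x2) by lra. ring. }
    eapply Rle_trans; [apply Cmod_triangle|].
    eapply Rle_trans; [apply Rplus_le_compat; apply Cmod_triangle|].
    replace (xm - x1) with ((x2 - x1) / 2) in * by lra.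
    replace (x2 - xm) with ((x2 - x1) / 2) in * by lra.
    replace (tm - t1) with ((t2 - t1) / 2) in * by lra.
    replace (t2 - tm) with ((t2 - t1) / 2) in * by lra.
    replace (eps * (x2 - x1 + (t2 - t1)) ^ 2) with
      (4 * (eps * ((x2 - x1) / 2 + (t2 - t1) / 2) ^ 2)) by field.
    lra.
  - intros x t Hx Ht.
    destruct (goursat_local s x t eps ltac:(lra) Hx He) as [d [Hd HJ]].
    exists d. split; auto. intros. apply HJ; lra. }
assert (E : eps * T ^ 2 = Cmod (J s 1 0 (2 * PI)) / 2) by (unfold eps; field; lra).
lra.
Qed.

(** The sides [t = 0] and [t = 2 PI] are the same segment, so their contributions cancel and [A]
    does not depend on [x > 0]. As [x] tends to 0, [f (Gam x t)] tends to [f a] uniformly in [t]. *)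
Lemma cauchy_winding :
  CI (fun t => f (circle r t) * (Ci * (circle r t / (circle r t - a))))%C 0 (2 * PI)
    (f a * CInt (fun t => Ci * (circle r t / (circle r t - a)))%C 0 (2 * PI))%C.
Proof.
assert (Hpi := PI_RGT_0). assert (Hr := radius_pos).
assert (HA : forall s, 0 < s <= 1 -> A 1 0 (2 * PI) = A s 0 (2 * PI)).
{ intros s Hs. assert (H := goursat s Hs). unfold J in H.
  assert (ED : D (2 * PI) s 1 = D 0 s 1).
  { unfold D, u, Gam, G. now rewrite circle_2PI. }
  rewrite ED in H.
  replace (A 1 0 (2 * PI)) with ((A 1 0 (2 * PI) - A s 0 (2 * PI) - (D 0 s 1 - D 0 s 1))
    + A s 0 (2 * PI))%C by ring. rewrite H. ring. }
set (W0 := CInt winding 0 (2 * PI)).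
set (W := r / (r - Cmod a)).
assert (HW : 0 < W) by (apply Rdiv_lt_0_compat; lra).
assert (HE : A 1 0 (2 * PI) = (f a * W0)%C).
{ apply Ceq_minus. apply NNPP. intros Hn. apply Cmod_gt_0 in Hn.
  set (e := Cmod (A 1 0 (2 * PI) - f a * W0)) in *.
  set (eps := e / (4 * PI * W)).
  assert (HPW : 0 < 4 * PI * W) by nra.
  assert (He : 0 < eps) by (apply Rdiv_lt_0_compat; lra).
  destruct (cdiff_continuous f a (f_diff a ltac:(lra)) eps He) as [d [Hd Hf]].
  set (s := Rmin 1 (d / (4 * r))).
  assert (Hs : 0 < s <= 1).
  { split; [|apply Rmin_l]. apply Rmin_glb_lt; [lra|]. apply Rdiv_lt_0_compat; lra. }
  assert (Hsd : 2 * r * s < d).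
  { assert (s <= d / (4 * r)) by apply Rmin_r.
    apply Rle_lt_trans with (2 * r * (d / (4 * r))); [apply Rmult_le_compat_l; lra|].
    replace (2 * r * (d / (4 * r))) with (d / 2) by (field; lra). lra. }
  assert (Hb : e <= (2 * PI - 0) * (eps * W)).
  { unfold e. rewrite (HA s Hs).
    apply CI_bound with (g := fun t => ((u s t - f a) * winding t)%C); [lra| |].
    - intros t _. rewrite Cmod_mult. apply Rmult_le_compat; try apply Cmod_ge_0; [|apply Cmod_winding].
      left. apply Hf. unfold Gam.
      replace (a + RtoC s * (G t - a) - a)%C with (RtoC s * (G t - a))%C by ring.
      rewrite Cmod_mult, Cmod_R, Rabs_pos_eq by lra.
      assert (H := Cmod_contour_sub t). nra.
    - apply CI_ext with (fun t => u s t * winding t + (- f a) * winding t)%C; [lra| |].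
      + intros t _. ring.
      + replace (A s 0 (2 * PI) - f a * W0)%C with (A s 0 (2 * PI) + (- f a) * W0)%C by ring.
        apply CI_plus; [apply CI_circular_part; lra|]. apply CI_scal, CI_CInt; [lra|]. intros; apply rcont_winding. }
  assert (E : (2 * PI - 0) * (eps * W) = e / 2) by (unfold eps; field; lra).
  lra. }
unfold W0, winding, G in HE. rewrite <- HE.
apply CI_ext with (fun t => u 1 t * winding t)%C; [lra| |].
- intros t _. unfold u, Gam, winding, G.
  replace (a + 1 * (circle r t - a))%C with (circle r t) by ring. reflexivity.
- apply CI_circular_part; lra.
Qed.

End Cauchy.

Lemma Ci_sqr : (Ci * Ci)%C = RtoC (-1).
Proof. unfold Ci, Cmult, RtoC; simpl; f_equal; ring. Qed.

(** At [a = 0] the winding integrand is the constant [Ci], so this case is explicit before any other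
    winding number is known; the general winding number is then deduced from it. *)
Lemma mean_value (f : C -> C) (r : R) : 0 < r -> (forall z, Cmod z <= r -> cdiff f z) ->
  CI (fun t => f (circle r t)) 0 (2 * PI) (RtoC (2 * PI) * f (RtoC 0))%C.
Proof.
intros Hr Hf. assert (Hpi := PI_RGT_0).
assert (H := cauchy_winding f r (RtoC 0) Hf ltac:(rewrite Cmod_0; lra)).
assert (Hne : forall t, circle r t <> RtoC 0).
{ intros t. apply Cmod_pos_neq. rewrite Cmod_circle; lra. }
assert (HW : CInt (fun t => Ci * (circle r t / (circle r t - 0)))%C 0 (2 * PI) = (RtoC (2 * PI) * Ci)%C).
{ apply CI_unique. apply CI_ext with (fun _ => Ci); [lra| |].
  - intros t _. field. apply Hne.
  - replace (2 * PI) with (2 * PI - 0) at 2 by ring. apply CI_const. }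
rewrite HW in H. apply (CI_scal (- Ci)%C) in H.
replace (RtoC (2 * PI) * f (RtoC 0))%C with (- Ci * (f (RtoC 0) * (RtoC (2 * PI) * Ci)))%C.
2:{ replace (- Ci * (f (RtoC 0) * (RtoC (2 * PI) * Ci)))%C
      with (- (Ci * Ci) * (f (RtoC 0) * RtoC (2 * PI)))%C by ring. rewrite Ci_sqr. ring. }
revert H. apply CI_ext; [lra|]. intros t _.
replace (- Ci * (f (circle r t) * (Ci * (circle r t / (circle r t - 0)))))%C
  with (- (Ci * Ci) * f (circle r t))%C by (field; apply Hne).
rewrite Ci_sqr. ring.
Qed.

(** The parameter may have modulus above 1: for the winding number it is [a / r^2], with [z] in the
    closed disc of radius [r]. The estimates for [|a| <= 1] therefore do not cover this case. *)
Lemma cdiff_szego (b z : C) : Cmod b * Cmod z < 1 -> cdiff (szego b) z.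
Proof.
intros Hbz. apply cdiff_iff. exists (Cconj b * szego b z ^ 2)%C. intros eps He.
assert (Pb := Cmod_ge_0 b).
set (q := (1 - Cmod b * Cmod z) / 2).
assert (Hq : 0 < q) by (unfold q; lra).
assert (Hq3 : 0 < q ^ 3) by (apply pow_lt; lra).
set (K := (Cmod b + 1) ^ 2 / q ^ 3).
assert (HK : 0 < K) by (apply Rdiv_lt_0_compat; [apply pow_lt|]; lra).
exists (Rmin (q / (Cmod b + 1)) (eps / K)). split.
- apply Rmin_glb_lt; apply Rdiv_lt_0_compat; lra.
- intros w Hw.
  assert (H1 : Cmod (w - z) < q / (Cmod b + 1)) by apply (lt_Rmin _ _ _ Hw).
  assert (H2 : Cmod (w - z) < eps / K) by apply (lt_Rmin _ _ _ Hw).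
  assert (P := Cmod_ge_0 (w - z)).
  assert (H1' : (Cmod b + 1) * Cmod (w - z) < q).
  { apply Rlt_le_trans with ((Cmod b + 1) * (q / (Cmod b + 1))); [apply Rmult_lt_compat_l; lra|].
    right; field; lra. }
  assert (H2' : K * Cmod (w - z) <= eps).
  { apply Rle_trans with (K * (eps / K)); [apply Rmult_le_compat_l; lra|]. right; field; lra. }
  assert (Lz : q <= Cmod (1 - Cconj b * z)).
  { eapply Rle_trans; [|apply Cmod_sub_ge]. rewrite Cmod_1, Cmod_mult, Cmod_conj. unfold q in *; lra. }
  assert (Lw : q <= Cmod (1 - Cconj b * w)).
  { eapply Rle_trans; [|apply Cmod_sub_ge]. rewrite Cmod_1, Cmod_mult, Cmod_conj.
    assert (H := Cmod_sub_ge w z). unfold q in *; nra. }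
  assert (Nz : (1 - Cconj b * z)%C <> RtoC 0) by (apply Cmod_pos_neq; lra).
  assert (Nw : (1 - Cconj b * w)%C <> RtoC 0) by (apply Cmod_pos_neq; lra).
  unfold szego.
  replace (/ (1 - Cconj b * w) - / (1 - Cconj b * z) - (w - z) * (Cconj b * (/ (1 - Cconj b * z)) ^ 2))%C
    with (Cconj b * Cconj b * ((w - z) * (w - z)) *
      (/ (1 - Cconj b * w) * (/ (1 - Cconj b * z) * / (1 - Cconj b * z))))%C by (field; auto).
  rewrite !Cmod_mult, !Cmod_inv, Cmod_conj by auto.
  assert (Iz : 0 < / Cmod (1 - Cconj b * z) <= / q).
  { split; [apply Rinv_0_lt_compat; lra|apply Rinv_le_contravar; lra]. }
  assert (Iw : 0 < / Cmod (1 - Cconj b * w) <= / q).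
  { split; [apply Rinv_0_lt_compat; lra|apply Rinv_le_contravar; lra]. }
  apply Rle_trans with ((Cmod b + 1) ^ 2 * (Cmod (w - z) * Cmod (w - z)) * (/ q * (/ q * / q))).
  { apply Rmult_le_compat.
    - apply Rmult_le_pos; nra.
    - apply Rmult_le_pos; nra.
    - apply Rmult_le_compat_r; nra.
    - apply Rmult_le_compat; nra. }
  replace ((Cmod b + 1) ^ 2 * (Cmod (w - z) * Cmod (w - z)) * (/ q * (/ q * / q)))
    with (K * Cmod (w - z) * Cmod (w - z)) by (unfold K; field; lra).
  apply Rmult_le_compat_r; lra.
Qed.

(* On [|z| = r] the function [z / (z - a)] is the conjugate of the holomorphic
   function [1 / (1 - conj a z / r^2)], whose mean is its value [1] at [0]. *)
Lemma winding_number (r : R) (a : C) : Cmod a < r ->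
  CInt (fun t => Ci * (circle r t / (circle r t - a)))%C 0 (2 * PI) = (RtoC (2 * PI) * Ci)%C.
Proof.
intros Ha. assert (Pa := Cmod_ge_0 a). assert (Hr : 0 < r) by lra. assert (Hpi := PI_RGT_0).
set (b := (a * RtoC (/ r ^ 2))%C).
assert (Hr2 : 0 < / r ^ 2) by (apply Rinv_0_lt_compat, pow_lt; lra).
assert (Hb : Cmod b * r < 1).
{ unfold b. rewrite Cmod_mult, Cmod_R, Rabs_pos_eq by lra.
  replace (Cmod a * / r ^ 2 * r) with (Cmod a / r) by (field; lra).
  apply Rlt_div_l; lra. }
assert (H := mean_value (szego b) r Hr).
assert (Hd : forall z, Cmod z <= r -> cdiff (szego b) z).
{ intros z Hz. apply cdiff_szego. assert (P := Cmod_ge_0 b). assert (P' := Cmod_ge_0 z). nra. }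
specialize (H Hd). apply CI_conj in H. apply (CI_scal Ci) in H.
apply CI_unique.
replace (RtoC (2 * PI) * Ci)%C with (Ci * Cconj (RtoC (2 * PI) * szego b 0))%C.
2:{ unfold szego. replace (/ (1 - Cconj b * 0))%C with (RtoC 1) by (field; apply C1_nz).
    unfold Cconj, Cmult, Ci, RtoC; simpl; f_equal; ring. }
revert H. apply CI_ext; [lra|]. intros t _. f_equal.
assert (HG : (circle r t * Cconj (circle r t))%C = RtoC (r ^ 2)).
{ rewrite <- Cmod2_conj, Cmod_circle; [reflexivity|lra]. }
assert (N1 : circle r t <> RtoC 0) by (apply Cmod_pos_neq; rewrite Cmod_circle; lra).
assert (N2 : (circle r t - a)%C <> RtoC 0).
{ apply Cmod_pos_neq. assert (Hs := Cmod_sub_ge (circle r t) a). rewrite Cmod_circle in Hs; lra. }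
assert (N3 : Cconj (circle r t) <> RtoC 0).
{ apply Cmod_gt_0. rewrite Cmod_conj. now apply Cmod_gt_0. }
assert (Nb : (1 - Cconj b * circle r t)%C <> RtoC 0).
{ apply Cmod_pos_neq. assert (Hs := Cmod_sub_ge 1 (Cconj b * circle r t)).
  rewrite Cmod_1, Cmod_mult, Cmod_conj, Cmod_circle in Hs by lra. lra. }
unfold szego. rewrite Cinv_conj by exact Nb.
rewrite Cminus_conj, Cmult_conj, Cconj_conj.
rewrite Cconj_1.
unfold b. rewrite RtoC_inv by (apply pow_nonzero; lra). rewrite <- HG.
field. repeat split; auto.
Qed.

Lemma cauchy_formula (f : C -> C) (r : R) (a : C) :
  (forall z, Cmod z <= r -> cdiff f z) -> Cmod a < r ->
  CI (fun t => f (circle r t) * (circle r t / (circle r t - a)))%C 0 (2 * PI)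
    (RtoC (2 * PI) * f a)%C.
Proof.
intros Hf Ha. assert (Hpi := PI_RGT_0).
assert (H := cauchy_winding f r a Hf Ha). rewrite winding_number in H by exact Ha.
apply (CI_scal (- Ci)%C) in H.
replace (RtoC (2 * PI) * f a)%C with (- Ci * (f a * (RtoC (2 * PI) * Ci)))%C.
2:{ replace (- Ci * (f a * (RtoC (2 * PI) * Ci)))%C
      with (- (Ci * Ci) * (f a * RtoC (2 * PI)))%C by ring. rewrite Ci_sqr. ring. }
revert H. apply CI_ext; [lra|]. intros t _.
replace (- Ci * (f (circle r t) * (Ci * (circle r t / (circle r t - a)))))%C
  with (- (Ci * Ci) * (f (circle r t) * (circle r t / (circle r t - a))))%C by ring.
rewrite Ci_sqr. ring.
Qed.

(** * The residue inequality *)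

Definition lsum {A : Type} (g : A -> R) (l : list A) : R :=
  fold_right (fun a s => g a + s) 0 l.

Definition lCsum {A : Type} (g : A -> C) (l : list A) : C :=
  fold_right (fun a s => (g a + s)%C) (RtoC 0) l.

Definition lCprod {A : Type} (g : A -> C) (l : list A) : C :=
  fold_right (fun a s => (g a * s)%C) (RtoC 1) l.

Lemma lsum_le {A : Type} (g h : A -> R) (l : list A) :
  (forall a, In a l -> g a <= h a) -> lsum g l <= lsum h l.
Proof.
intros H. induction l as [|a l IH]; simpl; [lra|].
apply Rplus_le_compat; [apply H; now left|]. apply IH. intros b Hb. apply H. now right.
Qed.

Lemma lsum_ext {A : Type} (g h : A -> R) (l : list A) :
  (forall a, In a l -> g a = h a) -> lsum g l = lsum h l.
Proof.
intros H. apply Rle_antisym; apply lsum_le; intros a Ha; rewrite (H a Ha); lra.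
Qed.

Lemma lsum_scal {A : Type} (c : R) (g : A -> R) (l : list A) :
  lsum (fun a => c * g a) l = c * lsum g l.
Proof. induction l as [|a l IH]; simpl; [ring|]. rewrite IH; ring. Qed.

Lemma lsum_nonneg {A : Type} (g : A -> R) (l : list A) :
  (forall a, In a l -> 0 <= g a) -> 0 <= lsum g l.
Proof.
intros H. eapply Rle_trans; [|apply (lsum_le (fun _ => 0) g l H)].
right. induction l as [|a l IH]; simpl; [reflexivity|]. rewrite <- IH; [ring|].
intros b Hb; apply H; now right.
Qed.

Lemma Cmod_lCsum_le {A : Type} (g : A -> C) (l : list A) :
  Cmod (lCsum g l) <= lsum (fun a => Cmod (g a)) l.
Proof.
induction l as [|a l IH]; simpl; [rewrite Cmod_0; lra|].
eapply Rle_trans; [apply Cmod_triangle|]. lra.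
Qed.

Lemma lCsum_ext {A : Type} (g h : A -> C) (l : list A) :
  (forall a, In a l -> g a = h a) -> lCsum g l = lCsum h l.
Proof.
intros H. induction l as [|a l IH]; simpl; [reflexivity|].
rewrite H by now left. f_equal. apply IH. intros b Hb; apply H; now right.
Qed.

Lemma lCsum_scal {A : Type} (c : C) (g : A -> C) (l : list A) :
  (c * lCsum g l)%C = lCsum (fun a => c * g a)%C l.
Proof. induction l as [|a l IH]; simpl; [ring|]. rewrite <- IH; ring. Qed.

Lemma lCsum_plus {A : Type} (g h : A -> C) (l : list A) :
  (lCsum g l + lCsum h l)%C = lCsum (fun a => g a + h a)%C l.
Proof. induction l as [|a l IH]; simpl; [ring|]. rewrite <- IH; ring. Qed.

(* The reciprocal, up to a unimodular constant, of a Blaschke factor. *)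
Definition rblaschke (a z : C) : C := ((1 - Cconj a * z) / (z - a))%C.

(** Residue at [a] of the product of all [rblaschke j z], [j] in [Z], divided by [z - w]. *)
Definition residue_coeff (w : C) (Z : list C) (a : C) : C :=
  (RtoC (1 - Cmod a ^ 2) / (a - w) *
   lCprod (fun j => if Ceq_dec j a then RtoC 1 else rblaschke j a) Z)%C.

Lemma residue_coeff_head (w b : C) (Z : list C) : ~ In b Z ->
  residue_coeff w (b :: Z) b =
  (RtoC (1 - Cmod b ^ 2) / (b - w) * lCprod (fun j => rblaschke j b) Z)%C.
Proof.
intros Hb. unfold residue_coeff. simpl. f_equal.
destruct (Ceq_dec b b) as [_|]; [|contradiction]. rewrite Cmult_1_l.
induction Z as [|j Z IH]; simpl; [reflexivity|].
destruct (Ceq_dec j b) as [->|_]; [exfalso; apply Hb; now left|].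
rewrite IH; [reflexivity|]. intros H; apply Hb; now right.
Qed.

Lemma residue_coeff_tail (w b a : C) (Z : list C) : b <> a ->
  residue_coeff w (b :: Z) a = (rblaschke b a * residue_coeff w Z a)%C.
Proof.
intros Hb. unfold residue_coeff. simpl.
destruct (Ceq_dec b a) as [|_]; [contradiction|]. ring.
Qed.

(** Partial fractions with two simple poles: a rational function of [z] vanishing at infinity is
    determined by its residues at [p] and [b]. *)
Lemma rblaschke_split (b p z : C) : z <> b -> z <> p -> b <> p ->
  (rblaschke b z / (z - p) =
   rblaschke b p / (z - p) + RtoC (1 - Cmod b ^ 2) / (z - b) * (/ (b - p)))%C.
Proof.
intros H1 H2 H3. unfold rblaschke.
rewrite RtoC_minus, Cmod2_conj. field.
repeat split; apply Cminus_eq_contra; auto.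
Qed.

(** A new zero [b] multiplies the old expansion by [rblaschke b z], and [rblaschke_split] separates
    [b] from each old pole. The pieces at the pole [b] add up to the old expansion evaluated at
    [z = b], which is the new residue. *)
Lemma partial_fractions (w : C) (Z : list C) : NoDup Z -> ~ In w Z ->
  forall z, z <> w -> ~ In z Z ->
  (lCprod (fun j => rblaschke j z) Z / (z - w) =
   lCprod (fun j => rblaschke j w) Z / (z - w)
   + lCsum (fun a => residue_coeff w Z a / (z - a)) Z)%C.
Proof.
induction Z as [|b Z IH]; intros Hnd Hw z Hzw Hz.
- simpl. field. now apply Cminus_eq_contra.
- inversion Hnd as [|? ? Hb Hnd']; subst.
  assert (Hw' : ~ In w Z) by (intros H; apply Hw; now right).
  assert (Hbw : b <> w) by (intros H; apply Hw; now left).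
  assert (Hz' : ~ In z Z) by (intros H; apply Hz; now right).
  assert (Hzb : z <> b) by (intros H; apply Hz; now left).
  specialize (IH Hnd' Hw').
  assert (IHz := IH z Hzw Hz'). assert (IHb := IH b Hbw Hb).
  simpl lCprod. simpl lCsum. rewrite residue_coeff_head by exact Hb.
  rewrite (lCsum_ext _ (fun a => rblaschke b z * (residue_coeff w Z a / (z - a))
    + (- (RtoC (1 - Cmod b ^ 2) / (z - b))) * (residue_coeff w Z a / (b - a)))%C Z).
  2:{ intros a Ha.
      assert (Hba : b <> a) by (intros ->; contradiction).
      assert (Hza : z <> a) by (intros ->; contradiction).
      rewrite residue_coeff_tail by exact Hba.
      replace (rblaschke b z * (residue_coeff w Z a / (z - a)))%C
        with (residue_coeff w Z a * (rblaschke b z / (z - a)))%C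
        by (field; now apply Cminus_eq_contra).
      rewrite rblaschke_split by auto. field.
      repeat split; apply Cminus_eq_contra; auto. }
  rewrite <- lCsum_plus, <- !lCsum_scal.
  set (Sz := lCsum (fun a => residue_coeff w Z a / (z - a))%C Z) in *.
  set (Sb := lCsum (fun a => residue_coeff w Z a / (b - a))%C Z) in *.
  set (Pz := lCprod (fun j => rblaschke j z) Z) in *.
  set (Pb := lCprod (fun j => rblaschke j b) Z) in *.
  set (Pw := lCprod (fun j => rblaschke j w) Z) in *.
  assert (Ezw : (z - w)%C <> RtoC 0) by now apply Cminus_eq_contra.
  assert (Ezb : (z - b)%C <> RtoC 0) by now apply Cminus_eq_contra.
  assert (Ebw : (b - w)%C <> RtoC 0) by now apply Cminus_eq_contra.
  replace (rblaschke b z * Pz / (z - w))%C with (rblaschke b z * (Pz / (z - w)))%C by (field; auto).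
  rewrite IHz.
  replace (RtoC (1 - Cmod b ^ 2) / (b - w) * Pb / (z - b))%C
    with (RtoC (1 - Cmod b ^ 2) / (z - b) * (Pb / (b - w)))%C by (field; auto).
  rewrite IHb.
  assert (Hs := rblaschke_split b w z Hzb Hzw Hbw).
  replace (rblaschke b z * (Pw / (z - w) + Sz))%C
    with (Pw * (rblaschke b z / (z - w)) + rblaschke b z * Sz)%C by (field; auto).
  rewrite Hs. field. auto.
Qed.

Lemma rblaschke_near_circle (a : C) (q : R) : Cmod a < 1 -> 1 < q ->
  exists r0, r0 < 1 /\ forall z, r0 < Cmod z -> Cmod z < 1 -> Cmod (rblaschke a z) <= q.
Proof.
intros Ha Hq. assert (Pa := Cmod_ge_0 a).
(* On [|z| = s > t = |a|] the modulus is at most [(1 - t s) / (s - t)], which equals [q] exactly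
   when [s = (q t + 1) / (q + t)]. *)
set (r0 := Rmax (Cmod a) ((q * Cmod a + 1) / (q + Cmod a))).
exists r0. split.
- unfold r0. apply Rmax_lub_lt; auto. apply Rlt_div_l; nra.
- intros z Hz0 Hz1.
  assert (H1 : Cmod a < Cmod z) by (eapply Rle_lt_trans; [apply Rmax_l|apply Hz0]).
  assert (H2 : q * Cmod a + 1 < Cmod z * (q + Cmod a)).
  { apply Rlt_div_l; [lra|]. eapply Rle_lt_trans; [|apply Hz0].
    apply Rmax_r. }
  assert (Hd : 0 < Cmod (z - a)) by (assert (H := Cmod_sub_ge z a); lra).
  unfold rblaschke. rewrite Cmod_div by now apply Cmod_pos_neq.
  apply Rle_div_l; [exact Hd|].
  assert (Hi := pick_identity a z). rewrite (Cmod_sub_sym a z) in Hi.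
  assert (Hge := Cmod_sub_ge z a).
  set (s := Cmod z) in *. set (t := Cmod a) in *.
  assert (Hs : (s - t) ^ 2 <= Cmod (z - a) ^ 2) by nra.
  apply pow2_le; [nra|]. rewrite Rpow_mult_distr.
  assert (Hk : (1 - t ^ 2) * (1 - s ^ 2) <= (q ^ 2 - 1) * (s - t) ^ 2).
  { assert (E : (1 - t ^ 2) * (1 - s ^ 2) = (1 - t * s) ^ 2 - (s - t) ^ 2) by ring.
    rewrite E. assert (0 <= 1 - t * s) by nra. assert (1 - t * s <= q * (s - t)) by nra.
    assert ((1 - t * s) ^ 2 <= (q * (s - t)) ^ 2) by (apply pow_incr; lra). nra. }
  assert (Hl : (q ^ 2 - 1) * (s - t) ^ 2 <= (q ^ 2 - 1) * Cmod (z - a) ^ 2)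
    by (apply Rmult_le_compat_l; nra).
  lra.
Qed.

Lemma rblaschke_prod_near_circle (Z : list C) (q : R) : 1 < q ->
  (forall a, In a Z -> Cmod a < 1) ->
  exists r0, r0 < 1 /\ forall z, r0 < Cmod z -> Cmod z < 1 ->
    Cmod (lCprod (fun j => rblaschke j z) Z) <= q.
Proof.
revert q. induction Z as [|a Z IH]; intros q Hq HZ.
- exists 0. split; [lra|]. intros z _ _. simpl. rewrite Cmod_1. lra.
- assert (Hs : 1 < sqrt q) by (rewrite <- sqrt_1; apply sqrt_lt_1; lra).
  destruct (rblaschke_near_circle a (sqrt q) (HZ a (or_introl eq_refl)) Hs) as [r1 [Hr1 H1]].
  destruct (IH (sqrt q) Hs (fun b Hb => HZ b (or_intror Hb))) as [r2 [Hr2 H2]].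
  exists (Rmax r1 r2). split; [now apply Rmax_lub_lt|]. intros z Hz Hz1.
  simpl. rewrite Cmod_mult. rewrite <- (sqrt_sqrt q) by lra.
  apply Rmult_le_compat; try apply Cmod_ge_0.
  + apply H1; auto. eapply Rle_lt_trans; [apply Rmax_l|apply Hz].
  + apply H2; auto. eapply Rle_lt_trans; [apply Rmax_r|apply Hz].
Qed.

Lemma CI_lCsum {A : Type} (g : A -> R -> C) (v : A -> C) (x y : R) (l : list A) :
  (forall a, In a l -> CI (g a) x y (v a)) ->
  CI (fun t => lCsum (fun a => g a t) l) x y (lCsum v l).
Proof.
intros H. induction l as [|a l IH]; simpl.
- assert (H0 := CI_const 0 x y). rewrite Cmult_0_r in H0. exact H0.
- apply CI_plus; [apply H; now left|]. apply IH. intros b Hb; apply H; now right.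
Qed.

Lemma list_max_Cmod (Z : list C) : (forall a, In a Z -> Cmod a < 1) ->
  exists r0, 0 <= r0 < 1 /\ forall a, In a Z -> Cmod a <= r0.
Proof.
induction Z as [|a Z IH]; intros H.
- exists 0. split; [lra|]. intros a [].
- destruct IH as [r0 [H0 H1]]; [intros b Hb; apply H; now right|].
  assert (Ha := H a (or_introl eq_refl)). exists (Rmax r0 (Cmod a)). split.
  + split; [eapply Rle_trans; [apply H0|apply Rmax_l]|apply Rmax_lub_lt; lra].
  + intros b [<-|Hb]; [apply Rmax_r|]. eapply Rle_trans; [now apply H1|apply Rmax_l].
Qed.

(* Residue theorem for [f(z) / (B(z) (z - w))], [B] the Blaschke product of
   [Z]: on circles of radius close to [1] the factor [1 / B] is nearly unimodular. *)
Lemma residue_inequality (f : C -> C) (M : R) (w : C) (Z : list C) :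
  (forall z, Cmod z < 1 -> cdiff f z) -> (forall z, Cmod z < 1 -> Cmod (f z) <= M) ->
  Cmod w < 1 -> (forall a, In a Z -> Cmod a < 1) -> NoDup Z -> ~ In w Z ->
  Cmod (lCprod (fun j => rblaschke j w) Z) * Cmod (f w) <=
  4 * M / (1 - Cmod w) + lsum (fun a => Cmod (residue_coeff w Z a) * Cmod (f a)) Z.
Proof.
intros Hf HM Hw HZ Hnd HwZ. assert (HM0 : 0 <= M) by (eapply Rle_trans; [apply Cmod_ge_0|apply (HM w Hw)]).
(* Any bound above 1 is available. The value 2, together with [|z - w| >= (1 - |w|) / 2] on the
   circle, accounts for the constant 4. *)
destruct (rblaschke_prod_near_circle Z 2 ltac:(lra) HZ) as [r1 [Hr1 H1]].
destruct (list_max_Cmod Z HZ) as [r2 [Hr2 H2]].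
set (r3 := Rmax (Rmax r1 r2) ((1 + Cmod w) / 2)).
assert (Hr3 : r3 < 1) by (unfold r3; repeat apply Rmax_lub_lt; lra).
set (r := (r3 + 1) / 2).
assert (Hrr : r3 < r < 1) by (unfold r; lra).
assert (Hr1r : r1 < r /\ r2 < r /\ (1 + Cmod w) / 2 < r).
{ assert (A := Rmax_l (Rmax r1 r2) ((1 + Cmod w) / 2)). assert (A' := Rmax_r (Rmax r1 r2) ((1 + Cmod w) / 2)).
  assert (B := Rmax_l r1 r2). assert (B' := Rmax_r r1 r2). unfold r3 in Hrr. lra. }
destruct Hr1r as [Hr1r [Hr2r Hwr]].
assert (Hr : 0 < r) by lra.
assert (Hfr : forall z, Cmod z <= r -> cdiff f z) by (intros z Hz; apply Hf; lra).
assert (Hpi := PI_RGT_0).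
set (Pw0 := lCprod (fun j => rblaschke j w) Z).
set (I := (RtoC (2 * PI) * (Pw0 * f w + lCsum (fun a => residue_coeff w Z a * f a) Z))%C).
assert (HI : CI (fun t => f (circle r t) * circle r t *
   (lCprod (fun j => rblaschke j (circle r t)) Z / (circle r t - w)))%C 0 (2 * PI) I).
{ assert (Hc : CI (fun t => Pw0 * (f (circle r t) * (circle r t / (circle r t - w)))
     + lCsum (fun a => residue_coeff w Z a * (f (circle r t) * (circle r t / (circle r t - a)))) Z)%C
     0 (2 * PI) (Pw0 * (RtoC (2 * PI) * f w)
     + lCsum (fun a => residue_coeff w Z a * (RtoC (2 * PI) * f a)) Z)%C).
  { apply CI_plus.
    - apply CI_scal, cauchy_formula; auto. lra.
    - apply (CI_lCsum (fun a t => residue_coeff w Z a * (f (circle r t) * (circle r t / (circle r t - a))))%C).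
      intros a Ha. apply CI_scal, cauchy_formula; auto. assert (H := H2 a Ha). lra. }
  replace I with (Pw0 * (RtoC (2 * PI) * f w)
     + lCsum (fun a => residue_coeff w Z a * (RtoC (2 * PI) * f a)) Z)%C.
  2:{ unfold I. rewrite (lCsum_ext _ (fun a => RtoC (2 * PI) * (residue_coeff w Z a * f a))%C Z)
       by (intros; ring). rewrite <- lCsum_scal. ring. }
  revert Hc. apply CI_ext; [lra|]. intros t _.
  assert (HG : Cmod (circle r t) = r) by (apply Cmod_circle; lra).
  assert (Hne : forall a, Cmod a < r -> circle r t <> a) by (intros a Ha E; rewrite E in HG; lra).
  assert (Nw : circle r t <> w) by (apply Hne; lra).
  assert (Ew := Cminus_eq_contra _ _ Nw).
  rewrite (partial_fractions w Z Hnd HwZ (circle r t) Nw).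
  2:{ intros Ha. apply (Hne (circle r t)); auto. assert (H := H2 _ Ha). lra. }
  fold Pw0. rewrite Cmult_plus_distr_l, lCsum_scal. f_equal; [field; auto|].
  apply lCsum_ext. intros a Ha. field. apply Cminus_eq_contra, Hne. assert (H := H2 a Ha). lra. }
assert (Hb : Cmod I <= (2 * PI - 0) * (4 * M / (1 - Cmod w))).
{ refine (CI_bound _ _ _ _ _ _ _ HI); [lra|]. intros t _.
  assert (HG : Cmod (circle r t) = r) by (apply Cmod_circle; lra).
  assert (Hs := Cmod_sub_ge (circle r t) w). rewrite HG in Hs.
  assert (Nw : (circle r t - w)%C <> RtoC 0) by (apply Cmod_pos_neq; lra).
  rewrite !Cmod_mult, Cmod_div, HG by exact Nw.
  assert (B1 := HM (circle r t) ltac:(lra)).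
  assert (B2 := H1 (circle r t) ltac:(lra) ltac:(lra)).
  assert (Q1 := Cmod_ge_0 (f (circle r t))).
  assert (Q2 := Cmod_ge_0 (lCprod (fun j => rblaschke j (circle r t)) Z)).
  assert (B3 : / Cmod (circle r t - w) <= 2 / (1 - Cmod w)).
  { replace (2 / (1 - Cmod w)) with (/ ((1 - Cmod w) / 2)) by (field; lra).
    apply Rinv_le_contravar; lra. }
  assert (Q3 : 0 < / Cmod (circle r t - w)) by (apply Rinv_0_lt_compat; lra).
  replace (4 * M / (1 - Cmod w)) with ((M * 1) * (2 * (2 / (1 - Cmod w)))) by (field; lra).
  unfold Rdiv at 1.
  apply Rmult_le_compat; [nra| |nra|].
  - apply Rmult_le_pos; lra.
  - apply Rmult_le_compat; lra. }
unfold I in Hb. rewrite Cmod_mult, Cmod_R, Rabs_pos_eq, Rminus_0_r in Hb by lra.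
apply Rmult_le_reg_l in Hb; [|lra].
assert (Hc := Cmod_lCsum_le (fun a => residue_coeff w Z a * f a)%C Z).
rewrite (lsum_ext (fun a => Cmod (residue_coeff w Z a) * Cmod (f a))
  (fun a => Cmod (residue_coeff w Z a * f a)) Z) by (intros; now rewrite Cmod_mult).
rewrite <- Cmod_mult.
set (Sg := lCsum (fun a => residue_coeff w Z a * f a)%C Z) in *.
assert (Ht := Cmod_sub_ge (Pw0 * f w) (- Sg)). rewrite Cmod_opp in Ht.
replace (Pw0 * f w - - Sg)%C with (Pw0 * f w + Sg)%C in Ht by ring. lra.
Qed.

(** This is [1 - rho^2] for the pseudo-hyperbolic distance [rho]; it turns products of distances
    into sums. *)
Definition pick (a j : C) : R :=
  (1 - Cmod j ^ 2) * (1 - Cmod a ^ 2) / Cmod (1 - Cconj j * a) ^ 2.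

Lemma Cmod_rblaschke_sqr (j a : C) : Cmod j < 1 -> Cmod a < 1 -> a <> j ->
  Cmod (rblaschke j a) ^ 2 * (1 - pick a j) = 1.
Proof.
intros Hj Ha Hne. assert (Hi := pick_identity j a). unfold pick, rblaschke.
rewrite Cmod_div by now apply Cminus_eq_contra.
assert (H1 : 0 < Cmod (a - j)) by now apply Cmod_gt_0, Cminus_eq_contra.
assert (H2 : 0 < Cmod (1 - Cconj j * a)) by (apply one_sub_conj_pos; lra).
rewrite <- Hi, (Cmod_sub_sym j a). field. lra.
Qed.

Lemma exp_pow2 (x : R) : exp x ^ 2 = exp (2 * x).
Proof. replace (2 * x) with (x + x) by ring. rewrite exp_plus. ring. Qed.

(** For [x <= 16/17], [1 / (1 - x) = 1 + x / (1 - x) <= 1 + 17 x <= exp (17 x)]; the square root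
    gives 17/2. The threshold 16/17 is the separation constant of the nodes. *)
Lemma Cmod_rblaschke_le (j a : C) : Cmod j < 1 -> Cmod a < 1 -> a <> j ->
  pick a j <= 16 / 17 -> Cmod (rblaschke j a) <= exp (17 / 2 * pick a j).
Proof.
intros Hj Ha Hne Hx. assert (H := Cmod_rblaschke_sqr j a Hj Ha Hne).
assert (Hx0 : 0 <= pick a j).
{ unfold pick. assert (P1 := Cmod_ge_0 a). assert (P2 := Cmod_ge_0 j).
  assert (H2 : 0 < Cmod (1 - Cconj j * a)) by (apply one_sub_conj_pos; lra).
  apply Rmult_le_pos; [apply Rmult_le_pos; nra|]. left. apply Rinv_0_lt_compat, pow_lt, H2. }
apply pow2_le; [left; apply exp_pos|]. rewrite exp_pow2.
set (x := pick a j) in *.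
replace (2 * (17 / 2 * x)) with (17 * x) by field.
assert (He := exp_ineq1_le (17 * x)). nra.
Qed.

Lemma Cmod_rblaschke_ge (j a : C) : Cmod j < 1 -> Cmod a < 1 -> a <> j ->
  exp (pick a j / 2) <= Cmod (rblaschke j a).
Proof.
intros Hj Ha Hne. assert (H := Cmod_rblaschke_sqr j a Hj Ha Hne).
apply pow2_le; [apply Cmod_ge_0|]. rewrite exp_pow2.
set (x := pick a j) in *. replace (2 * (x / 2)) with x by field.
assert (He := exp_ineq1_le (- x)). rewrite exp_Ropp in He.
assert (Hp := exp_pos x).
assert (Hs : 0 <= Cmod (rblaschke j a) ^ 2) by apply pow2_ge_0.
assert (H1 : Cmod (rblaschke j a) ^ 2 * (1 + - x) <= Cmod (rblaschke j a) ^ 2 * / exp x)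
  by now apply Rmult_le_compat_l.
replace (1 + - x) with (1 - x) in H1 by ring. rewrite H in H1.
apply Rmult_le_reg_r with (/ exp x); [now apply Rinv_0_lt_compat|].
rewrite Rinv_r by lra. exact H1.
Qed.

Lemma pick_ge (a w : C) : Cmod a < 1 -> Cmod w < 1 ->
  (1 - Cmod w) / 4 * (1 - Cmod a) <= pick w a.
Proof.
intros Ha Hw. unfold pick. assert (P1 := Cmod_ge_0 a). assert (P2 := Cmod_ge_0 w).
assert (H2 : 0 < Cmod (1 - Cconj a * w)) by (apply one_sub_conj_pos; lra).
assert (H3 : Cmod (1 - Cconj a * w) <= 2).
{ eapply Rle_trans; [apply Cmod_sub_le|]. rewrite Cmod_1, Cmod_mult, Cmod_conj. nra. }
assert (H4 : 0 < Cmod (1 - Cconj a * w) ^ 2 <= 4) by nra.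
apply (proj1 (Rle_div_r _ _ (Cmod (1 - Cconj a * w) ^ 2) ltac:(lra))).
assert (H5 : (1 - Cmod a) * (1 - Cmod w) <= (1 - Cmod a ^ 2) * (1 - Cmod w ^ 2))
  by (apply Rmult_le_compat; nra).
assert (H6 : 0 <= (1 - Cmod a) * (1 - Cmod w)) by nra.
replace ((1 - Cmod w) / 4 * (1 - Cmod a) * Cmod (1 - Cconj a * w) ^ 2)
  with ((1 - Cmod a) * (1 - Cmod w) * (Cmod (1 - Cconj a * w) ^ 2 / 4)) by field.
eapply Rle_trans; [|exact H5]. rewrite <- (Rmult_1_r ((1 - Cmod a) * (1 - Cmod w))) at 2.
apply Rmult_le_compat_l; lra.
Qed.

(** For fixed [w] each zero adds at least a multiple of [1 - |a|] to [log (1 / |B_Z w|)]; hence a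
    large mass forces the Blaschke product to be small at [w]. *)
Lemma rblaschke_prod_ge (w : C) (Z : list C) : Cmod w < 1 ->
  (forall a, In a Z -> Cmod a < 1) -> ~ In w Z ->
  exp ((1 - Cmod w) / 8 * lsum (fun a => 1 - Cmod a) Z) <=
  Cmod (lCprod (fun j => rblaschke j w) Z).
Proof.
intros Hw. induction Z as [|a Z IH]; intros HZ HwZ; simpl.
- rewrite Rmult_0_r, exp_0, Cmod_1. lra.
- rewrite Cmod_mult, Rmult_plus_distr_l, exp_plus.
  apply Rmult_le_compat; try (left; apply exp_pos).
  + assert (Ha := HZ a (or_introl eq_refl)).
    eapply Rle_trans; [|apply Cmod_rblaschke_ge; auto].
    * assert (H := pick_ge a w Ha Hw).
      apply exp_le_exp. lra.
    * intros E; apply HwZ; now left.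
  + apply IH; [intros b Hb; apply HZ; now right|]. intros H; apply HwZ; now right.
Qed.

Lemma residue_coeff_bound (w a : C) (Z : list C) : Cmod a < 1 ->
  (forall j, In j Z -> Cmod j < 1) -> a <> w ->
  (forall j, In j Z -> j <> a -> pick a j <= 16 / 17) ->
  Cmod (residue_coeff w Z a) <=
  (1 - Cmod a ^ 2) / Cmod (a - w) * exp (17 / 2 * lsum (pick a) Z).
Proof.
intros Ha HZ Haw Hp. assert (Pa := Cmod_ge_0 a). unfold residue_coeff.
assert (Naw := Cminus_eq_contra _ _ Haw). assert (Paw := proj1 (Cmod_gt_0 _) Naw).
rewrite Cmod_mult, Cmod_div, Cmod_R, Rabs_pos_eq by (auto; nra).
apply Rmult_le_compat_l.
{ apply Rmult_le_pos; [nra|]. left; now apply Rinv_0_lt_compat. }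
clear Haw Naw Paw. induction Z as [|j Z IH]; simpl.
- rewrite Cmod_1, Rmult_0_r, exp_0. lra.
- rewrite Cmod_mult, Rmult_plus_distr_l, exp_plus.
  assert (Hj := HZ j (or_introl eq_refl)).
  apply Rmult_le_compat; try apply Cmod_ge_0.
  (* The excluded factor counts as 1 on the left; its nonnegative term on the right is kept so that
     the sum may run over all of [Z]. *)
  + destruct (Ceq_dec j a) as [->|Hne].
    * rewrite Cmod_1, <- exp_0. assert (Hpk : 0 < 17 / 2 * pick a a).
      { unfold pick. assert (0 < 1 - Cmod a ^ 2) by nra.
        assert (H2 : 0 < Cmod (1 - Cconj a * a)) by (apply one_sub_conj_pos; lra).
        apply Rmult_lt_0_compat; [lra|]. apply Rdiv_lt_0_compat; [nra|]. now apply pow_lt. }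
      left. now apply exp_increasing.
    * apply Cmod_rblaschke_le; auto. apply Hp; auto. now left.
  + apply IH; intros i Hi; [apply HZ; now right|]. intros Hne; apply Hp; auto. now right.
Qed.

(** * Dyadic nodes *)

(* Cayley parametrisation of an arc of the unit circle: it is rational, so that
   distances between points of the arc are explicit. *)
Definition arc (x : R) : C := ((1 - x ^ 2) / (1 + x ^ 2), 2 * x / (1 + x ^ 2)).

Lemma one_plus_sqr_pos (x : R) : 0 < 1 + x ^ 2.
Proof. assert (H := pow2_ge_0 x). lra. Qed.

Lemma Cmod_arc (x : R) : Cmod (arc x) = 1.
Proof.
assert (H := one_plus_sqr_pos x).
assert (E : Cmod (arc x) ^ 2 = 1).
{ rewrite Cmod2_alt. unfold arc; simpl. field. simpl in H. lra. }
assert (P := Cmod_ge_0 (arc x)). nra.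
Qed.

Lemma Cmod_arc_sub (x y : R) :
  Cmod (arc x - arc y) ^ 2 = 4 * (x - y) ^ 2 / ((1 + x ^ 2) * (1 + y ^ 2)).
Proof.
assert (Hx := one_plus_sqr_pos x). assert (Hy := one_plus_sqr_pos y).
rewrite Cmod2_alt. unfold arc; simpl. field. simpl in *. lra.
Qed.

Lemma Cmod_arc_sub_le (x y : R) : Cmod (arc x - arc y) <= 2 * Rabs (x - y).
Proof.
assert (P := Rabs_pos (x - y)).
apply pow2_le; [lra|]. rewrite Cmod_arc_sub, Rpow_mult_distr, pow2_abs.
assert (H := pow2_ge_0 (x - y)).
apply (proj2 (Rle_div_l _ _ ((1 + x ^ 2) * (1 + y ^ 2)) ltac:(nra))).
assert (1 <= (1 + x ^ 2) * (1 + y ^ 2)) by nra. nra.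
Qed.

Lemma Cmod_arc_sub_ge (x y : R) : 0 <= x <= 1 -> 0 <= y <= 1 ->
  (x - y) ^ 2 <= Cmod (arc x - arc y) ^ 2.
Proof.
intros Hx Hy. rewrite Cmod_arc_sub.
assert (Hx2 : 1 <= 1 + x ^ 2 <= 2) by nra. assert (Hy2 : 1 <= 1 + y ^ 2 <= 2) by nra.
assert (H := pow2_ge_0 (x - y)).
apply (proj1 (Rle_div_r _ _ ((1 + x ^ 2) * (1 + y ^ 2)) ltac:(nra))).
assert ((1 + x ^ 2) * (1 + y ^ 2) <= 4) by nra. nra.
Qed.

Definition depth (n : nat) : R := (/ 2) ^ n.

Lemma depth_pos n : 0 < depth n.
Proof. apply pow_lt; lra. Qed.

Lemma depth_S n : depth (S n) = depth n / 2.
Proof. unfold depth; simpl; lra. Qed.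

Lemma depth_add n k : depth (n + k) = depth n * depth k.
Proof. apply pow_add. Qed.

Lemma depth_inv n : depth n * 2 ^ n = 1.
Proof. unfold depth. rewrite <- Rpow_mult_distr. replace (/ 2 * 2) with 1 by field. apply pow1. Qed.

Lemma depth_le1 n : depth n <= 1.
Proof. induction n; [unfold depth; simpl; lra|]. rewrite depth_S. lra. Qed.

Lemma depth_le_half n : (1 <= n)%nat -> depth n <= / 2.
Proof.
intros Hn. destruct n; [lia|]. rewrite depth_S. assert (H := depth_le1 n). lra.
Qed.

Lemma depth_antitone n l : (n <= l)%nat -> depth l <= depth n.
Proof.
intros H. induction H; [lra|]. rewrite depth_S. assert (P := depth_pos m). lra.
Qed.

Lemma depth_lim : is_lim_seq depth 0.
Proof. apply is_lim_seq_geom. rewrite Rabs_pos_eq; lra. Qed.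

(** The point at height [2^-n] above the left endpoint of the dyadic interval number [i]. For
    [i < 2^n] the parameters stay in [[0, 1]], a quarter of the circle on which chords and parameter
    differences are comparable. At level 0 the node is the origin, hence the recurring condition
    [1 <= n]. *)
Definition node (n i : nat) : C := (RtoC (1 - depth n) * arc (INR i * depth n))%C.

Lemma Cmod_node n i : Cmod (node n i) = 1 - depth n.
Proof.
unfold node. rewrite Cmod_mult, Cmod_arc, Cmod_R, Rabs_pos_eq; [ring|].
assert (H := depth_le1 n). lra.
Qed.

Lemma Cmod_node_lt1 n i : Cmod (node n i) < 1.
Proof. rewrite Cmod_node. assert (H := depth_pos n). lra. Qed.

Lemma INR_pow2 n : INR (2 ^ n) = 2 ^ n.
Proof. rewrite pow_INR. reflexivity. Qed.

Lemma node_param n i : (i < 2 ^ n)%nat -> 0 <= INR i * depth n <= 1.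
Proof.
intros Hi. assert (P := depth_pos n). assert (Q := pos_INR i). split; [nra|].
rewrite <- (depth_inv n), Rmult_comm. apply Rmult_le_compat_l; [lra|].
rewrite <- INR_pow2. apply le_INR; lia.
Qed.

Lemma pick_sym (a j : C) : pick a j = pick j a.
Proof.
unfold pick. rewrite <- (Cmod_conj (1 - Cconj a * j)).
rewrite Cminus_conj, Cmult_conj, Cconj_conj.
rewrite Cconj_1.
replace (a * Cconj j)%C with (Cconj j * a)%C by ring. unfold Rdiv. ring.
Qed.

Lemma Cmod_one_sub_conj_polar (r s : R) (u v : C) : Cmod u = 1 -> Cmod v = 1 ->
  Cmod (1 - Cconj (RtoC r * u) * (RtoC s * v)) ^ 2 = (1 - r * s) ^ 2 + r * s * Cmod (u - v) ^ 2.
Proof.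
intros Hu Hv.
assert (Eu : Re u ^ 2 + Im u ^ 2 = 1) by (rewrite <- Cmod2_alt, Hu; ring).
assert (Ev : Re v ^ 2 + Im v ^ 2 = 1) by (rewrite <- Cmod2_alt, Hv; ring).
rewrite !Cmod2_alt. destruct u as [u1 u2], v as [v1 v2]. simpl in *.
assert (E : (u1 * (u1 * 1) + u2 * (u2 * 1)) * (v1 * (v1 * 1) + v2 * (v2 * 1)) = 1) by (rewrite Eu, Ev; ring).
ring_simplify. ring_simplify in Eu. ring_simplify in Ev. ring_simplify in E.
replace (u2 ^ 2) with (1 - u1 ^ 2) by lra. replace (v2 ^ 2) with (1 - v1 ^ 2) by lra. ring.
Qed.

Lemma pick_node n i l j :
  pick (node n i) (node l j) =
  (1 - (1 - depth l) ^ 2) * (1 - (1 - depth n) ^ 2) /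
  ((1 - (1 - depth l) * (1 - depth n)) ^ 2 + (1 - depth l) * (1 - depth n) *
    Cmod (arc (INR j * depth l) - arc (INR i * depth n)) ^ 2).
Proof.
unfold pick. rewrite !Cmod_node. f_equal. unfold node.
apply Cmod_one_sub_conj_polar; apply Cmod_arc.
Qed.

(** In units of [depth n], the parameter of [(l, j)] exceeds that of its ancestor on level [n], the
    integer quotient [j / 2 ^ (l - n)], by some [rho] in [[0, 1]], which costs only constants. The
    numerator is at most [4 * depth n * depth l] and the denominator at least
    [depth n ^ 2 * (1 + del ^ 2) / 16], whence 64. *)
Lemma pick_node_decay n i l j : (1 <= n)%nat -> (n <= l)%nat ->
  (i < 2 ^ n)%nat -> (j < 2 ^ l)%nat ->
  pick (node n i) (node l j) <=
  64 * depth (l - n) * / (1 + (INR i - INR (j / 2 ^ (l - n))) ^ 2).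
Proof.
intros Hn Hl Hi Hj. rewrite pick_node.
assert (Hxi := node_param n i Hi). assert (Hxj := node_param l j Hj).
assert (Hge := Cmod_arc_sub_ge _ _ Hxj Hxi).
set (D2 := Cmod (arc (INR j * depth l) - arc (INR i * depth n)) ^ 2) in *.
assert (Ht : 0 < depth n <= / 2) by (split; [apply depth_pos|now apply depth_le_half]).
assert (Ht' : 0 < depth l <= depth n) by (split; [apply depth_pos|now apply depth_antitone]).
set (q := (j / 2 ^ (l - n))%nat).
set (rem := (j mod 2 ^ (l - n))%nat).
assert (Hp0 : (2 ^ (l - n) <> 0)%nat) by (apply Nat.pow_nonzero; lia).
assert (Hdiv : INR j = 2 ^ (l - n) * INR q + INR rem).
{ rewrite <- INR_pow2, <- mult_INR, <- plus_INR. f_equal. apply Nat.div_mod; auto. }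
assert (Hrem : 0 <= INR rem * depth (l - n) <= 1).
{ apply node_param. apply Nat.mod_upper_bound; auto. }
assert (El : depth l = depth n * depth (l - n)) by (rewrite <- depth_add; f_equal; lia).
set (rho := INR rem * depth (l - n)) in *.
assert (Ej : INR j * depth l = (INR q + rho) * depth n).
{ rewrite Hdiv, El. unfold rho. assert (Hi' := depth_inv (l - n)).
  transitivity ((INR q * (depth (l - n) * 2 ^ (l - n)) + INR rem * depth (l - n)) * depth n); [ring|].
  rewrite Hi'. ring. }
rewrite Ej in Hge.
set (del := INR i - INR q) in *.
assert (Hge' : depth n ^ 2 * (del - rho) ^ 2 <= D2).
{ eapply Rle_trans; [|exact Hge]. right. unfold del. ring. }
set (t := depth n) in *. set (t' := depth l) in *. set (s := depth (l - n)) in *.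
assert (Hs : 0 < s) by apply depth_pos.
assert (HD2 : 0 <= D2) by apply pow2_ge_0.
assert (Hden1 : t ^ 2 <= (1 - (1 - t') * (1 - t)) ^ 2).
{ apply pow_incr. split; [lra|]. nra. }
assert (Hden2 : D2 / 4 <= (1 - t') * (1 - t) * D2).
{ replace (D2 / 4) with (/ 4 * D2) by field. apply Rmult_le_compat_r; [auto|]. nra. }
assert (Hnum : (1 - (1 - t') ^ 2) * (1 - (1 - t) ^ 2) <= 4 * t * t').
{ replace ((1 - (1 - t') ^ 2) * (1 - (1 - t) ^ 2)) with ((t' * t) * ((2 - t') * (2 - t))) by ring.
  replace (4 * t * t') with (t' * t * 4) by ring. apply Rmult_le_compat_l; nra. }
assert (Hdel : del ^ 2 <= 2 * (del - rho) ^ 2 + 2).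
{ assert (H0 := pow2_ge_0 (del - 2 * rho)). nra. }
assert (Hpos : 0 < 1 + del ^ 2) by apply one_plus_sqr_pos.
assert (Hden : t ^ 2 * (1 + del ^ 2) / 16 <= (1 - (1 - t') * (1 - t)) ^ 2 + (1 - t') * (1 - t) * D2).
{ assert (0 < t ^ 2) by (apply pow_lt; lra). nra. }
assert (Hpd : 0 < t ^ 2 * (1 + del ^ 2) / 16).
{ assert (0 < t ^ 2) by (apply pow_lt; lra). nra. }
apply (proj2 (Rle_div_l _ _ _ (Rlt_le_trans _ _ _ Hpd Hden))).
eapply Rle_trans; [exact Hnum|].
apply Rle_trans with (64 * s * / (1 + del ^ 2) * (t ^ 2 * (1 + del ^ 2) / 16)).
- right. fold s in El. rewrite El. field. lra.
- apply Rmult_le_compat_l; [|exact Hden].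
  apply Rmult_le_pos; [lra|]. left; now apply Rinv_0_lt_compat.
Qed.

(** Different levels differ in depth by a factor of at least 2, which already gives 8/9. The
    constant 16/17 comes from neighbours on one level: [X ^ 2 <= 4 t ^ 2] against an angular term of
    at least [t ^ 2 / 4]. *)
Lemma pick_node_separated n i l j : (1 <= n)%nat -> (1 <= l)%nat ->
  (i < 2 ^ n)%nat -> (j < 2 ^ l)%nat -> (n, i) <> (l, j) ->
  pick (node n i) (node l j) <= 16 / 17.
Proof.
assert (Hlt : forall n i l j, (1 <= n)%nat -> (n < l)%nat -> pick (node n i) (node l j) <= 16 / 17).
{ clear. intros n i l j Hn Hl. rewrite pick_node.
  assert (Ht : 0 < depth n <= / 2) by (split; [apply depth_pos|now apply depth_le_half]).
  assert (Ht' : 0 < depth l <= depth n / 2).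
  { split; [apply depth_pos|]. rewrite <- depth_S. apply depth_antitone; lia. }
  assert (HD2 := pow2_ge_0 (Cmod (arc (INR j * depth l) - arc (INR i * depth n)))).
  set (D2 := Cmod (arc (INR j * depth l) - arc (INR i * depth n)) ^ 2) in *.
  set (t := depth n) in *. set (t' := depth l) in *.
  assert (Hp : 0 <= (1 - t') * (1 - t) * D2) by (apply Rmult_le_pos; nra).
  assert (Hq : 0 < t + t' - t * t') by nra.
  assert (E : 1 - (1 - t') * (1 - t) = t + t' - t * t') by ring. rewrite E.
  assert (Hq2 : 0 < (t + t' - t * t') ^ 2) by now apply pow_lt.
  apply (proj2 (Rle_div_l _ _ _ (Rlt_le_trans _ _ ((t + t' - t * t') ^ 2 + (1 - t') * (1 - t) * D2) Hq2 ltac:(lra)))).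
  apply Rle_trans with (16 / 17 * (t + t' - t * t') ^ 2); [|lra].
  replace ((1 - (1 - t') ^ 2) * (1 - (1 - t) ^ 2)) with ((t + t' - t * t') ^ 2 - (t - t') ^ 2) by ring.
  assert ((t + t' - t * t') ^ 2 <= (3 * (t - t')) ^ 2) by (apply pow_incr; nra). nra. }
intros Hn Hl Hi Hj Hne.
destruct (Nat.lt_trichotomy n l) as [H|[<-|H]].
- now apply Hlt.
- rewrite pick_node.
  assert (Hxi := node_param n i Hi). assert (Hxj := node_param n j Hj).
  assert (Hge := Cmod_arc_sub_ge _ _ Hxj Hxi).
  set (D2 := Cmod (arc (INR j * depth n) - arc (INR i * depth n)) ^ 2) in *.
  assert (Ht : 0 < depth n <= / 2) by (split; [apply depth_pos|now apply depth_le_half]).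
  assert (Hij : 1 <= (INR j - INR i) ^ 2).
  { assert (Hd : i <> j) by congruence.
    destruct (Nat.lt_gt_cases i j) as [Hc _]. destruct (Hc Hd) as [H|H].
    - apply (le_INR (S i)) in H. rewrite S_INR in H. nra.
    - apply (le_INR (S j)) in H. rewrite S_INR in H. nra. }
  set (t := depth n) in *.
  assert (HD : t ^ 2 <= D2).
  { eapply Rle_trans; [|exact Hge].
    replace ((INR j * t - INR i * t) ^ 2) with ((INR j - INR i) ^ 2 * t ^ 2) by ring.
    assert (0 <= t ^ 2) by apply pow2_ge_0. nra. }
  assert (Hr : / 4 * t ^ 2 <= (1 - t) * (1 - t) * D2) by (apply Rmult_le_compat; try apply pow2_ge_0; nra).
  set (X := 1 - (1 - t) ^ 2).
  assert (HX : 0 <= X <= 2 * t) by (unfold X; nra).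
  replace (1 - (1 - t) * (1 - t)) with X by (unfold X; ring).
  assert (Ht2 : 0 < t ^ 2) by (apply pow_lt; lra).
  assert (HX2 : X ^ 2 <= 4 * t ^ 2) by nra. assert (HX3 := pow2_ge_0 X).
  apply (proj2 (Rle_div_l _ _ (X ^ 2 + (1 - t) * (1 - t) * D2) ltac:(lra))).
  replace (X * X) with (X ^ 2) by ring. lra.
- rewrite pick_sym. now apply Hlt.
Qed.

(** * Finite sums over lists, and the weights [1 / (1 + d^2)] *)

Lemma lsum_app {A : Type} (g : A -> R) (l m : list A) : lsum g (l ++ m) = lsum g l + lsum g m.
Proof. induction l as [|a l IH]; simpl; [ring|]. rewrite IH; ring. Qed.

Lemma lsum_plus {A : Type} (g h : A -> R) (l : list A) :
  lsum g l + lsum h l = lsum (fun a => g a + h a) l.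
Proof. induction l as [|a l IH]; simpl; [ring|]. rewrite <- IH; ring. Qed.

Lemma lsum_flat_map {A B : Type} (g : B -> R) (f : A -> list B) (l : list A) :
  lsum g (flat_map f l) = lsum (fun a => lsum g (f a)) l.
Proof.
induction l as [|a l IH]; simpl; [reflexivity|]. now rewrite lsum_app, IH.
Qed.

Lemma lsum_map {A B : Type} (g : B -> R) (f : A -> B) (l : list A) :
  lsum g (map f l) = lsum (fun a => g (f a)) l.
Proof. induction l as [|a l IH]; simpl; [reflexivity|]. now rewrite IH. Qed.

Lemma lsum_incl {A : Type} (g : A -> R) (l l' : list A) :
  NoDup l -> incl l l' -> (forall a, In a l' -> 0 <= g a) -> lsum g l <= lsum g l'.
Proof.
revert l'. induction l as [|a l IH]; intros l' Hnd Hin Hg; simpl.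
- now apply lsum_nonneg.
- inversion Hnd as [|? ? Ha Hnd']; subst.
  destruct (in_split a l') as [l1 [l2 ->]]; [apply Hin; now left|].
  assert (H : lsum g l <= lsum g (l1 ++ l2)).
  { apply IH; auto.
    - intros b Hb. assert (Hb' : In b (l1 ++ a :: l2)) by (apply Hin; now right).
      apply in_app_iff in Hb'. apply in_app_iff. destruct Hb' as [|[<-|]]; auto. contradiction.
    - intros b Hb. apply Hg. apply in_app_iff. apply in_app_iff in Hb. destruct Hb; auto. right; now right. }
  rewrite lsum_app in H. rewrite lsum_app. simpl. lra.
Qed.

Lemma lsum_seq_S (g : nat -> R) (s n : nat) : lsum g (seq s (S n)) = lsum g (seq s n) + g (s + n)%nat.
Proof.
revert s. induction n as [|n IH]; intros s.
- simpl. rewrite Nat.add_0_r. ring.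
- transitivity (g s + lsum g (seq (S s) (S n))); [reflexivity|]. rewrite IH.
  replace (S s + n)%nat with (s + S n)%nat by lia.
  change (lsum g (seq s (S n))) with (g s + lsum g (seq (S s) n)). ring.
Qed.

(** Telescoping: below [i] the sum is dominated by 4 over the remaining distance, and from [i] on
    each term is at most a difference of consecutive values of [- 4 / (m + 1)]. Each side
    contributes at most 4. *)
Lemma cauchy_weights_seq (i N : nat) :
  lsum (fun j => / (1 + (INR i - INR j) ^ 2)) (seq 0 N) <= 8.
Proof.
set (g := fun j => / (1 + (INR i - INR j) ^ 2)).
assert (H1 : forall N, (N <= i)%nat -> lsum g (seq 0 N) <= 4 / (INR i - INR N + 1)).
{ induction N0 as [|M IH]; intros HM.
  - simpl. left. apply Rdiv_lt_0_compat; [lra|]. assert (P := pos_INR i). lra.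
  - rewrite lsum_seq_S. specialize (IH ltac:(lia)). rewrite Nat.add_0_l. unfold g at 2.
    apply (le_INR (S M)) in HM. rewrite S_INR in *.
    set (d := INR i - INR M) in *.
    assert (Hd : 1 <= d) by (unfold d; lra).
    replace (INR i - (INR M + 1) + 1) with d by (unfold d; ring).
    apply Rle_trans with (4 / (d + 1) + / (1 + d ^ 2)); [lra|].
    assert (0 < 1 + d ^ 2) by apply one_plus_sqr_pos.
    assert (E : 4 / d - (4 / (d + 1) + / (1 + d ^ 2)) = (3 * d ^ 2 - d + 4) / (d * (d + 1) * (1 + d ^ 2))).
    { field. nra. }
    assert (0 <= (3 * d ^ 2 - d + 4) / (d * (d + 1) * (1 + d ^ 2))).
    { apply Rmult_le_pos; [nra|]. left. apply Rinv_0_lt_compat. apply Rmult_lt_0_compat; [nra|lra]. }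
    lra. }
assert (H2 : forall m, lsum g (seq 0 (i + m)) <= 8 - 4 / (INR m + 1)).
{ induction m as [|m IH].
  - rewrite Nat.add_0_r. eapply Rle_trans; [apply H1; lia|]. simpl. right; field_simplify; lra.
  - rewrite Nat.add_succ_r, lsum_seq_S, Nat.add_0_l. unfold g at 2.
    rewrite plus_INR, S_INR. assert (P := pos_INR m). set (d := INR m) in *.
    replace (INR i - (INR i + d)) with (- d) by ring.
    replace ((- d) ^ 2) with (d ^ 2) by ring.
    assert (0 < 1 + d ^ 2) by apply one_plus_sqr_pos.
    assert (E : (8 - 4 / (d + 1 + 1)) - (8 - 4 / (d + 1) + / (1 + d ^ 2))
      = (3 * d ^ 2 - 3 * d + 2) / ((d + 1) * (d + 2) * (1 + d ^ 2))).
    { field. nra. }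
    assert (0 <= (3 * d ^ 2 - 3 * d + 2) / ((d + 1) * (d + 2) * (1 + d ^ 2))).
    { apply Rmult_le_pos; [nra|]. left. apply Rinv_0_lt_compat. apply Rmult_lt_0_compat; [nra|lra]. }
    lra. }
assert (Hle : forall m, 8 - 4 / (INR m + 1) <= 8).
{ intros m. assert (P := pos_INR m). assert (0 < 4 / (INR m + 1)) by (apply Rdiv_lt_0_compat; lra). lra. }
apply Rle_trans with (lsum g (seq 0 (i + N))).
- apply lsum_incl.
  + apply seq_NoDup.
  + intros j Hj. apply in_seq in Hj. apply in_seq. lia.
  + intros j _. unfold g. left. apply Rinv_0_lt_compat, one_plus_sqr_pos.
- eapply Rle_trans; [apply H2|apply Hle].
Qed.

Lemma cauchy_weights (i : nat) (l : list nat) : NoDup l ->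
  lsum (fun j => / (1 + (INR i - INR j) ^ 2)) l <= 8.
Proof.
intros Hl. eapply Rle_trans; [|apply (cauchy_weights_seq i (S (list_max l)))].
apply lsum_incl; auto.
- intros j Hj. apply in_seq. split; [lia|].
  assert (H := proj1 (list_max_le l (list_max l)) (le_n _)).
  rewrite Forall_forall in H. specialize (H j Hj). lia.
- intros j _. left. apply Rinv_0_lt_compat, one_plus_sqr_pos.
Qed.

(** * The Cantor-type tree *)

(* Dyadic Cantor-type tree: [tree n] lists the surviving dyadic intervals
   [i/2^n, (i+1)/2^n]; every survivor keeps both halves, except that at the
   levels where [K] jumps only the left half is kept. *)
Section Tree.

Variable K : nat -> nat.
Hypothesis K_0 : K 0 = 0%nat.
Hypothesis K_S : forall n, K (S n) = K n \/ K (S n) = S (K n).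

Fixpoint tree (n : nat) : list nat :=
  match n with
  | O => (0 :: nil)%nat
  | S m => flat_map (fun i =>
      if Nat.eq_dec (K (S m)) (K m) then (2 * i :: 2 * i + 1 :: nil)%nat
      else (2 * i :: nil)%nat) (tree m)
  end.

Lemma in_tree_S m j : In j (tree (S m)) -> In (j / 2)%nat (tree m).
Proof.
intros H. cbn [tree] in H. apply in_flat_map in H. destruct H as [i [Hi Hj]].
assert (E : (j / 2 = i)%nat).
{ destruct (Nat.eq_dec (K (S m)) (K m)); simpl in Hj.
  - destruct Hj as [<-|[<-|[]]].
    + replace (i + (i + 0))%nat with (i * 2)%nat by lia. apply Nat.div_mul; lia.
    + replace (i + (i + 0) + 1)%nat with (1 + i * 2)%nat by lia.
      rewrite Nat.div_add by lia. simpl. reflexivity.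
  - destruct Hj as [<-|[]].
    replace (i + (i + 0))%nat with (i * 2)%nat by lia. apply Nat.div_mul; lia. }
now rewrite E.
Qed.

Lemma tree_lt n i : In i (tree n) -> (i < 2 ^ n)%nat.
Proof.
revert i. induction n as [|m IH]; intros i Hi.
- destruct Hi as [<-|[]]. simpl; lia.
- apply in_tree_S in Hi. specialize (IH _ Hi). simpl.
  assert (H := Nat.div_mod i 2 ltac:(lia)). assert (H' := Nat.mod_upper_bound i 2 ltac:(lia)). lia.
Qed.

Lemma tree_0 n : In 0%nat (tree n).
Proof.
induction n as [|m IH]; [now left|]. simpl. apply in_flat_map. exists 0%nat. split; auto.
destruct (Nat.eq_dec (K (S m)) (K m)); now left.
Qed.

Lemma tree_NoDup n : NoDup (tree n).
Proof.
induction n as [|m IH].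
- constructor; [intros []|constructor].
- simpl. induction (tree m) as [|i l IHl]; simpl; [constructor|].
  inversion IH as [|? ? Hi Hl]; subst. specialize (IHl Hl).
  assert (Hno : forall x, (x = 2 * i \/ x = 2 * i + 1)%nat ->
    ~ In x (flat_map (fun i0 => if Nat.eq_dec (K (S m)) (K m)
        then (2 * i0 :: 2 * i0 + 1 :: nil)%nat else (2 * i0 :: nil)%nat) l)).
  { intros x Hx Hin. apply in_flat_map in Hin. destruct Hin as [i' [Hi' Hin]].
    assert (i' = i).
    { destruct (Nat.eq_dec (K (S m)) (K m)); simpl in Hin.
      - destruct Hin as [E|[E|[]]]; lia.
      - destruct Hin as [E|[]]; lia. }
    subst; contradiction. }
  simpl in Hno. destruct (Nat.eq_dec (K (S m)) (K m)); simpl.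
  + apply NoDup_cons; [|apply NoDup_cons; [apply Hno; lia|exact IHl]].
    intros [E|Hin]; [lia|]. now apply (Hno (i + (i + 0))%nat); [left|].
  + apply NoDup_cons; [apply Hno; now left|exact IHl].
Qed.

(** All survivors of level [n] have equally many descendants on level [n + k]: 2 to the power [k]
    minus the number of jumps of [K] in between. The prefactor is this number. *)
Lemma lsum_tree_ancestor (g : nat -> R) n k :
  lsum (fun j => g (j / 2 ^ k)%nat) (tree (n + k)) =
  depth n / depth (n + k) * (depth (K (n + k)) / depth (K n)) * lsum g (tree n).
Proof.
induction k as [|k IH].
- rewrite Nat.add_0_r. rewrite (lsum_ext _ g).
  + assert (P := depth_pos n). assert (Q := depth_pos (K n)). field. lra.
  + intros j _. change (2 ^ 0)%nat with 1%nat. now rewrite Nat.div_1_r.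
- rewrite Nat.add_succ_r. rewrite depth_S.
  set (N := (n + k)%nat) in *.
  assert (P := depth_pos N). assert (P' := depth_pos n). assert (Q := depth_pos (K n)).
  assert (E2 : forall i, ((2 * i) / 2 ^ S k = i / 2 ^ k)%nat).
  { intros i. change (2 ^ S k)%nat with (2 * 2 ^ k)%nat. rewrite <- Nat.Div0.div_div.
    f_equal. rewrite Nat.mul_comm. apply Nat.div_mul; lia. }
  assert (E3 : forall i, ((2 * i + 1) / 2 ^ S k = i / 2 ^ k)%nat).
  { intros i. change (2 ^ S k)%nat with (2 * 2 ^ k)%nat. rewrite <- Nat.Div0.div_div.
    f_equal. rewrite Nat.add_comm, Nat.mul_comm, Nat.div_add by lia. reflexivity. }
  change (tree (S N)) with (flat_map (fun i =>
      if Nat.eq_dec (K (S N)) (K N) then (2 * i :: 2 * i + 1 :: nil)%nat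
      else (2 * i :: nil)%nat) (tree N)).
  rewrite lsum_flat_map.
  destruct (Nat.eq_dec (K (S N)) (K N)) as [E|Hne].
  + rewrite (lsum_ext _ (fun i => 2 * g (i / 2 ^ k)%nat)).
    2:{ intros i _. unfold lsum, fold_right. rewrite E2, E3. ring. }
    rewrite lsum_scal, IH, E. field. lra.
  + destruct (K_S N) as [H|H]; [contradiction|].
    rewrite (lsum_ext _ (fun i => g (i / 2 ^ k)%nat)).
    2:{ intros i _. unfold lsum, fold_right. rewrite E2. ring. }
    rewrite IH, H, depth_S. field. lra.
Qed.

Lemma lsum_tree_1 n : lsum (fun _ => 1) (tree n) = depth (K n) / depth n.
Proof.
assert (H := lsum_tree_ancestor (fun _ => 1) 0 n). rewrite Nat.add_0_l in H. rewrite H, K_0.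
assert (P := depth_pos n). unfold depth at 1 4. simpl. field. lra.
Qed.

(** Grouping level [l] by ancestors on level [n], the decay [depth (l - n)] cancels the factor
    [2 ^ (l - n)] in the number of descendants, so only the thinning ratio remains. The constant is
    [64 * 8]. *)
Lemma pick_sum_fine n i l : (1 <= n)%nat -> (n <= l)%nat -> In i (tree n) ->
  lsum (fun j => pick (node n i) (node l j)) (tree l) <= 512 * (depth (K l) / depth (K n)).
Proof.
intros Hn Hl Hi. set (k := (l - n)%nat).
assert (El : l = (n + k)%nat) by (unfold k; lia).
apply Rle_trans with (lsum (fun j => 64 * depth k * / (1 + (INR i - INR (j / 2 ^ k)%nat) ^ 2)) (tree l)).
- apply lsum_le. intros j Hj. apply pick_node_decay; auto; now apply tree_lt.
- rewrite lsum_scal, El.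
  rewrite (lsum_tree_ancestor (fun q => / (1 + (INR i - INR q) ^ 2)) n k).
  assert (H := cauchy_weights i (tree n) (tree_NoDup n)).
  set (X := lsum (fun q => / (1 + (INR i - INR q) ^ 2)) (tree n)) in *.
  assert (P := depth_pos n). assert (P' := depth_pos k). assert (Q := depth_pos (K n)).
  assert (Q' := depth_pos (K (n + k))).
  rewrite depth_add.
  assert (Hr : 0 < depth (K (n + k)) / depth (K n)) by now apply Rdiv_lt_0_compat.
  replace (64 * depth k * (depth n / (depth n * depth k) * (depth (K (n + k)) / depth (K n)) * X))
    with (64 * (depth (K (n + k)) / depth (K n)) * X) by (field; lra).
  nra.
Qed.

(** By symmetry the ancestor is now taken of [i]. Each node of level [l] occurs once, so the decay
    [depth (n - l)] survives and is summable over the coarser levels. *)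
Lemma pick_sum_coarse n i l : (1 <= l)%nat -> (l <= n)%nat -> In i (tree n) ->
  lsum (fun j => pick (node n i) (node l j)) (tree l) <= 512 * depth (n - l).
Proof.
intros Hl Hn Hi.
apply Rle_trans with (lsum (fun j => 64 * depth (n - l) * / (1 + (INR (i / 2 ^ (n - l))%nat - INR j) ^ 2)) (tree l)).
- apply lsum_le. intros j Hj. rewrite pick_sym.
  eapply Rle_trans; [apply pick_node_decay; auto; now apply tree_lt|].
  right. f_equal. f_equal. ring.
- rewrite lsum_scal. assert (H := cauchy_weights (i / 2 ^ (n - l)) (tree l) (tree_NoDup l)).
  assert (P := depth_pos (n - l)). nra.
Qed.

Variable active : nat -> Prop.
Hypothesis active_dec : forall n, {active n} + {~ active n}.

Definition block (s len : nat) : list (nat * nat) :=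
  flat_map (fun l => if active_dec l then map (pair l) (tree l) else nil) (seq s len).

Definition node_of (p : nat * nat) : C := node (fst p) (snd p).

Lemma in_block s len l j : In (l, j) (block s len) <->
  (s <= l < s + len)%nat /\ active l /\ In j (tree l).
Proof.
unfold block. rewrite in_flat_map. split.
- intros [l' [Hl' H]]. apply in_seq in Hl'.
  destruct (active_dec l') as [Ha|Ha]; [|destruct H].
  apply in_map_iff in H. destruct H as [j' [E Hj']]. inversion E; subst. auto.
- intros [Hl [Ha Hj]]. exists l. split; [now apply in_seq|].
  destruct (active_dec l); [|contradiction]. apply in_map_iff. now exists j.
Qed.

Lemma block_NoDup s len : NoDup (block s len).
Proof.
unfold block. revert s. induction len as [|len IH]; intros s; simpl; [constructor|].
apply NoDup_app; auto.
- destruct (active_dec s); [|constructor].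
  apply FinFun.Injective_map_NoDup; [|apply tree_NoDup]. intros x y E. now inversion E.
- intros [l j] H1 H2. destruct (active_dec s); [|destruct H1].
  apply in_map_iff in H1. destruct H1 as [j' [E _]]. inversion E; subst.
  apply in_flat_map in H2. destruct H2 as [l' [Hl' H2]]. apply in_seq in Hl'.
  destruct (active_dec l'); [|destruct H2].
  apply in_map_iff in H2. destruct H2 as [j'' [E' _]]. inversion E'; subst. lia.
Qed.

Lemma lsum_block (g : nat * nat -> R) s len :
  lsum g (block s len) =
  lsum (fun l => if active_dec l then lsum (fun j => g (l, j)) (tree l) else 0) (seq s len).
Proof.
unfold block. rewrite lsum_flat_map. apply lsum_ext. intros l _.
destruct (active_dec l); [|reflexivity]. now rewrite lsum_map.
Qed.

Definition mass (s len : nat) : R :=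
  lsum (fun l => if active_dec l then depth (K l) else 0) (seq s len).

Lemma block_mass s len :
  lsum (fun p => 1 - Cmod (node_of p)) (block s len) = mass s len.
Proof.
rewrite lsum_block. apply lsum_ext. intros l _. destruct (active_dec l); auto.
rewrite (lsum_ext _ (fun j => depth l * 1)).
- rewrite lsum_scal, lsum_tree_1. assert (P := depth_pos l). field. lra.
- intros j _. unfold node_of; simpl. rewrite Cmod_node. ring.
Qed.

(** Finer levels add up to the mass divided by [depth (K n)], the coarser ones to a geometric series
    of sum at most 2, whatever the length of the block. *)
Lemma block_pick_sum s len n i : (1 <= s)%nat -> (1 <= n)%nat -> In i (tree n) ->
  lsum (fun p => pick (node n i) (node_of p)) (block s len) <=
  512 * (mass s len / depth (K n) + 2).
Proof.
intros Hs Hn Hi. rewrite lsum_block.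
assert (Q := depth_pos (K n)).
(* For [m > n] the subtraction [S n - m] truncates to 0, so the bound remains 2 once all levels up
   to [n] are counted. *)
assert (Hgeo : forall m, lsum (fun l => if le_dec l n then depth (n - l) else 0) (seq 0 m)
    <= 2 * depth (S n - m)).
{ induction m as [|m IH].
  - simpl. assert (P := depth_pos (S n)). lra.
  - rewrite lsum_seq_S, Nat.add_0_l. destruct (le_dec m n) as [H|H].
    + replace (S n - m)%nat with (S (n - m)) in IH by lia. rewrite depth_S in IH.
      replace (S n - S m)%nat with (n - m)%nat by lia. lra.
    + replace (S n - S m)%nat with (S n - m)%nat by lia. lra. }
apply Rle_trans with (lsum (fun l => 512 * / depth (K n) * (if active_dec l then depth (K l) else 0)) (seq s len)
  + lsum (fun l => 512 * (if le_dec l n then depth (n - l) else 0)) (seq s len)).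
- rewrite lsum_plus. apply lsum_le. intros l Hl. apply in_seq in Hl.
  assert (P := depth_pos (K l)). assert (Qi := Rinv_0_lt_compat _ Q).
  destruct (active_dec l) as [Ha|Ha].
  + destruct (le_dec l n) as [H|H].
    * assert (H1 := pick_sum_coarse n i l ltac:(lia) H Hi).
      unfold node_of; simpl.
      assert (0 < 512 * / depth (K n) * depth (K l)) by (apply Rmult_lt_0_compat; nra). lra.
    * assert (H1 := pick_sum_fine n i l Hn ltac:(lia) Hi). unfold node_of; simpl.
      replace (512 * / depth (K n) * depth (K l) + 512 * 0) with (512 * (depth (K l) / depth (K n)))
        by (field; lra). exact H1.
  + destruct (le_dec l n); [assert (P' := depth_pos (n - l))|]; lra.
- rewrite !lsum_scal. fold (mass s len).
  assert (H : lsum (fun l => if le_dec l n then depth (n - l) else 0) (seq s len) <= 2).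
  { apply Rle_trans with (lsum (fun l => if le_dec l n then depth (n - l) else 0) (seq 0 (s + len))).
    - apply lsum_incl; [apply seq_NoDup| |].
      + intros x Hx. apply in_seq in Hx. apply in_seq. lia.
      + intros x _. destruct (le_dec x n); [left; apply depth_pos|lra].
    - eapply Rle_trans; [apply Hgeo|]. assert (P := depth_le1 (S n - (s + len))). lra. }
  unfold Rdiv. lra.
Qed.

End Tree.

(** * Choice of the levels *)

Lemma lsum_seq_app (g : nat -> R) (s m n : nat) :
  lsum g (seq s (m + n)) = lsum g (seq s m) + lsum g (seq (s + m) n).
Proof.
induction n as [|n IH].
- rewrite Nat.add_0_r. simpl. ring.
- rewrite Nat.add_succ_r, !lsum_seq_S, IH. replace (s + (m + n))%nat with (s + m + n)%nat by lia. ring.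
Qed.

(** Terms of size at most 1 make the first partial sum beyond [X] overshoot by at most 1, which
    bounds the mass of a block from above as well. *)
Lemma first_passage (q : nat -> R) (s : nat) (X : R) : 0 <= X ->
  (forall n, (s <= n)%nat -> q n <= 1) ->
  (exists len, X <= lsum q (seq s len)) ->
  exists len, X <= lsum q (seq s len) <= X + 1.
Proof.
intros HX Hq [len Hlen]. induction len as [|len IH].
- exists 0%nat. simpl in *. lra.
- destruct (Rle_dec X (lsum q (seq s len))) as [H|H]; [now apply IH|].
  exists (S len). rewrite lsum_seq_S in *. assert (H1 := Hq (s + len)%nat ltac:(lia)). lra.
Qed.

Lemma INR_succ_le_pow2 (m : nat) : INR m + 1 <= 2 ^ m.
Proof.
induction m as [|m IH]; [simpl; lra|]. rewrite S_INR. simpl.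
assert (P := pos_INR m). lra.
Qed.

(** From [exp x >= (x / 3) ^ 3] and [m + 1 <= 2 ^ m], with [54 = 2 * 27]. It turns the contributions
    of the blocks to the thinness series into a geometric series. *)
Lemma exp_neg_pow2_le (m : nat) : (2 * INR m + 2) * exp (- 2 ^ m) <= 54 * depth m.
Proof.
assert (Hp : 1 <= 2 ^ m) by (apply pow_R1_Rle; lra).
assert (Hm := INR_succ_le_pow2 m).
assert (He : (2 ^ m / 3) ^ 3 <= exp (2 ^ m)).
{ replace (exp (2 ^ m)) with (exp (2 ^ m / 3) ^ 3).
  - apply pow_incr. assert (H := exp_ineq1_le (2 ^ m / 3)). lra.
  - rewrite <- exp_mult_nat. f_equal. simpl. field. }
rewrite exp_Ropp. assert (Hpos := exp_pos (2 ^ m)).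
apply (proj2 (Rle_div_l _ _ (exp (2 ^ m)) Hpos)).
assert (Hd := depth_inv m). assert (Pd := depth_pos m).
set (x := 2 ^ m) in *.
apply Rle_trans with (54 * depth m * (x / 3) ^ 3); [|apply Rmult_le_compat_l; lra].
replace (54 * depth m * (x / 3) ^ 3) with (2 * (depth m * x) * x ^ 2) by field.
rewrite Hd. nra.
Qed.

Section Levels.

Variables th1 th2 : nat -> R.
Hypothesis th2_pos : forall n, (1 <= n)%nat -> 0 < th2 n.
Hypothesis th2_mono : forall n, (1 <= n)%nat -> th2 n <= th2 (S n).
Hypothesis th2_div : forall s B, (1 <= s)%nat ->
  exists len, B <= lsum (fun n => / th2 n) (seq s len).
Hypothesis th1_large : forall A, exists N, forall n, (N <= n)%nat -> A * th2 n <= th1 n.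

Let kap : R := Rmax 1 (/ th2 1).

Lemma normalization_ge1 : 1 <= kap.
Proof. apply Rmax_l. Qed.

Lemma th2_ge n : (1 <= n)%nat -> th2 1 <= th2 n.
Proof.
intros H. induction H as [|m Hm IH]; [lra|]. assert (H := th2_mono m Hm). lra.
Qed.

Lemma normalization_spec n : (1 <= n)%nat -> 1 <= kap * th2 n.
Proof.
intros H. assert (H1 := th2_pos 1 (le_n _)). assert (H2 := th2_ge n H).
assert (H3 : / th2 1 <= kap) by apply Rmax_r.
apply Rle_trans with (/ th2 1 * th2 1); [rewrite Rinv_l; lra|].
apply Rmult_le_compat; try lra. left; now apply Rinv_0_lt_compat.
Qed.

(** Lagging levels cost at most 1 and the greedy choice loses at most a factor 2, so [2 m + 1]
    leaves a mass of at least [m]. *)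
Let goal (m : nat) : R := 2 * INR m + 1.
(** [4352 = 512 * 17 / 2] joins the bound on sums of [pick] to the exponent of the residue bound. In
    the bracket, [2 m + 2] bounds the mass, the factor 2 comes from [2 ^ K n <= 2 tau n], and the
    final 2 is the geometric part, absorbed by [tau n >= 1]. *)
Let growth (m : nat) : R := 4352 * ((2 * INR m + 2) * 2 + 2) * (kap * 2 ^ m).

Let is_block (m s len : nat) : Prop :=
  (1 <= s)%nat /\ (m <= s)%nat /\ (1 <= len)%nat /\
  (forall n, (s <= n)%nat -> growth m * th2 n <= th1 n) /\
  goal m <= lsum (fun n => / (kap * 2 ^ m * th2 n)) (seq s len) <= goal m + 1.

Lemma pow2_ge1 m : 1 <= 2 ^ m.
Proof. apply pow_R1_Rle; lra. Qed.

Lemma block_exists m N : exists p : nat * nat, (N <= fst p)%nat /\ is_block m (fst p) (snd p).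
Proof.
destruct (th1_large (growth m)) as [N1 HN1].
set (s := (N + N1 + m + 1)%nat).
assert (Hk := normalization_ge1). assert (Hp := pow2_ge1 m). assert (Pm := pos_INR m).
assert (Hkp : 0 < kap * 2 ^ m) by nra.
destruct (first_passage (fun n => / (kap * 2 ^ m * th2 n)) s (goal m)) as [len Hlen].
- unfold goal. lra.
- intros n Hn. assert (H := normalization_spec n ltac:(unfold s in *; lia)).
  rewrite <- Rinv_1. apply Rinv_le_contravar; [lra|].
  replace (kap * 2 ^ m * th2 n) with (2 ^ m * (kap * th2 n)) by ring. nra.
- destruct (th2_div s (goal m * (kap * 2 ^ m)) ltac:(unfold s; lia)) as [len Hlen].
  exists len. rewrite (lsum_ext _ (fun n => / (kap * 2 ^ m) * / th2 n)).
  + rewrite lsum_scal. apply Rmult_le_reg_l with (kap * 2 ^ m); [lra|].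
    rewrite <- Rmult_assoc, Rinv_r by lra. lra.
  + intros n Hn. apply in_seq in Hn. rewrite Rinv_mult. reflexivity.
- exists (s, len). simpl. split; [unfold s; lia|]. repeat split; try (unfold s; lia); try apply Hlen.
  + destruct len; [|lia]. simpl in Hlen. unfold goal in Hlen. lra.
  + intros n Hn. apply HN1. unfold s in Hn; lia.
Qed.

Lemma blocks_exist : exists s len : nat -> nat,
  (forall m, is_block m (s m) (len m)) /\ forall m, (s m + len m <= s (S m))%nat.
Proof.
destruct (choice (fun (mN : nat * nat) (p : nat * nat) =>
  (snd mN <= fst p)%nat /\ is_block (fst mN) (fst p) (snd p))) as [nxt Hn].
{ intros [m N]. apply block_exists. }
set (b := fix b (m : nat) : nat * nat := match m with
  | O => nxt (0, 0)%nat
  | S m => nxt (S m, fst (b m) + snd (b m))%nat end).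
exists (fun m => fst (b m)), (fun m => snd (b m)). split.
- intros [|m]; simpl.
  + apply (Hn (0, 0)%nat).
  + apply (Hn (S m, fst (b m) + snd (b m))%nat).
- intros m. apply (Hn (S m, fst (b m) + snd (b m))%nat).
Qed.

(* Greedy choice: [2 ^ K n] tries to keep up with the target [tau n], gaining
   at most one factor 2 per level. The levels where it lags behind are levels
   where [K] has just increased, so [sum 2 ^ (- K n)] over them is at most 1. *)
Section Greedy.

Variable tau : nat -> R.
Hypothesis tau_ge1 : forall n, (1 <= n)%nat -> 1 <= tau n.
Hypothesis tau_mono : forall n, (1 <= n)%nat -> tau n <= tau (S n).

Fixpoint greedy (n : nat) : nat :=
  match n with
  | O => O
  | S m => if Rlt_dec (2 ^ greedy m) (tau (S m)) then S (greedy m) else greedy m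
  end.

Lemma greedy_S n : greedy (S n) = greedy n \/ greedy (S n) = S (greedy n).
Proof. simpl. destruct (Rlt_dec (2 ^ greedy n) (tau (S n))); auto. Qed.

Lemma greedy_le n : (1 <= n)%nat -> 2 ^ greedy n <= 2 * tau n.
Proof.
intros H. induction H as [|m Hm IH].
- simpl. assert (H := tau_ge1 1 (le_n _)).
  destruct (Rlt_dec 1 (tau 1)); simpl; lra.
- assert (H := tau_mono m Hm). simpl.
  destruct (Rlt_dec (2 ^ greedy m) (tau (S m))); simpl; lra.
Qed.

Lemma greedy_lag_sum n :
  lsum (fun l => if Rlt_dec (2 ^ greedy l) (tau l) then / tau l else 0) (seq 1 n)
  <= 1 - depth (greedy n).
Proof.
induction n as [|n IH].
- simpl. unfold depth; simpl; lra.
- rewrite lsum_seq_S. change (1 + n)%nat with (S n).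
  destruct (Rlt_dec (2 ^ greedy (S n)) (tau (S n))) as [H|H].
  + assert (E : greedy (S n) = S (greedy n)).
    { destruct (greedy_S n) as [E|E]; auto. exfalso.
      revert E. simpl. destruct (Rlt_dec (2 ^ greedy n) (tau (S n))) as [H1|H1]; [lia|].
      intros _. simpl in H. destruct (Rlt_dec (2 ^ greedy n) (tau (S n))); [lra|]. lra. }
    assert (Hle : / tau (S n) <= depth (greedy (S n))).
    { unfold depth. rewrite pow_inv. apply Rinv_le_contravar; [apply pow_lt|]; lra. }
    rewrite E, depth_S in *. lra.
  + assert (Hle : depth (greedy (S n)) <= depth (greedy n)).
    { apply depth_antitone. destruct (greedy_S n); lia. }
    lra.
Qed.

End Greedy.

(** The third clause bounds [theta2] on the active levels, the fourth feeds the residue inequality,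
    and the last is the thinness series, a level having total mass [depth (K n)]. Levels outside the
    blocks are never active, but [K] keeps following its target there. *)
Lemma level_selection : exists (K : nat -> nat) (active : nat -> Prop)
    (active_dec : forall n, {active n} + {~ active n}),
  K 0%nat = 0%nat /\
  (forall n, K (S n) = K n \/ K (S n) = S (K n)) /\
  (forall n, active n -> (1 <= n)%nat /\ th2 n <= 2 ^ K n) /\
  (forall m, exists s len, (1 <= s)%nat /\ (m <= s)%nat /\
     INR m <= mass K active active_dec s len /\
     forall n, (s <= n < s + len)%nat -> active n ->
       4352 * (mass K active active_dec s len / depth (K n) + 2) <= th1 n) /\
  (exists S, forall N,
     lsum (fun n => if active_dec n then depth (K n) * exp (- 2 ^ K n) else 0) (seq 0 N) <= S).
Proof.
destruct blocks_exist as [s [len [Hblk Hnext]]].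
assert (Hsinc : forall m k, (s m + len m <= s (m + S k))%nat).
{ intros m k. induction k as [|k IH].
  - rewrite Nat.add_1_r. apply Hnext.
  - rewrite Nat.add_succ_r. assert (H := Hnext (m + S k)%nat). lia. }
set (mm := fix mm (n : nat) : nat := match n with
  | O => O
  | S n => if Nat.eq_dec (S n) (s (S (mm n))) then S (mm n) else mm n end).
assert (HmmS : forall n, mm (S n) = if Nat.eq_dec (S n) (s (S (mm n))) then S (mm n) else mm n)
  by reflexivity.
assert (Hlen : forall m, (1 <= len m)%nat) by (intros m; apply (Hblk m)).
assert (Hs1 : forall m, (1 <= s m)%nat) by (intros m; apply (Hblk m)).
assert (Hmm : forall n, (n < s (S (mm n)))%nat /\ (mm n = 0%nat \/ (s (mm n) <= n)%nat)).
{ induction n as [|n [IH1 IH2]].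
  - simpl. split; [apply Hs1|auto].
  - rewrite HmmS. destruct (Nat.eq_dec (S n) (s (S (mm n)))) as [E|E].
    + split; [|right; lia]. assert (H := Hnext (S (mm n))). assert (H' := Hlen (S (mm n))). lia.
    + split; [lia|]. destruct IH2; auto. }
assert (Hmmeq : forall m n, (s m <= n < s (S m))%nat -> mm n = m).
{ intros m n Hn. destruct (Hmm n) as [H1 H2].
  destruct (Nat.lt_trichotomy (mm n) m) as [H|[H|H]]; auto; exfalso.
  - assert (Hx : (s (S (mm n)) <= s m)%nat).
    { destruct (Nat.eq_dec (S (mm n)) m) as [<-|Hne]; [lia|].
      assert (H' := Hsinc (S (mm n)) (m - S (mm n) - 1)%nat).
      replace (S (mm n) + S (m - S (mm n) - 1))%nat with m in H' by lia. lia. }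
    lia.
  - assert (Hx : (s (S m) <= s (mm n))%nat).
    { destruct (Nat.eq_dec (S m) (mm n)) as [->|Hne]; [lia|].
      assert (H' := Hsinc (S m) (mm n - S m - 1)%nat).
      replace (S m + S (mm n - S m - 1))%nat with (mm n) in H' by lia. lia. }
    destruct H2; lia. }
set (tau := fun n => kap * 2 ^ mm n * th2 n).
assert (Hk := normalization_ge1).
(* The normalisation [kap * th2 n >= 1] leaves the full factor [2 ^ mm n]; on an active level this
   gives [exp (- 2 ^ K n) <= exp (- 2 ^ m)]. *)
assert (Htau2 : forall n, (1 <= n)%nat -> 2 ^ mm n <= tau n).
{ intros n Hn. unfold tau. assert (H := normalization_spec n Hn). assert (H' := pow2_ge1 (mm n)).
  replace (kap * 2 ^ mm n * th2 n) with (2 ^ mm n * (kap * th2 n)) by ring. nra. }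
assert (Htau1 : forall n, (1 <= n)%nat -> 1 <= tau n).
{ intros n Hn. assert (H := Htau2 n Hn). assert (H' := pow2_ge1 (mm n)). lra. }
assert (Htaum : forall n, (1 <= n)%nat -> tau n <= tau (S n)).
{ intros n Hn. unfold tau. assert (Q := th2_pos n Hn). assert (Q' := th2_mono n Hn).
  assert (H' := pow2_ge1 (mm n)).
  apply Rmult_le_compat; try nra. apply Rmult_le_compat_l; [lra|].
  apply Rle_pow; [lra|]. rewrite HmmS. destruct (Nat.eq_dec (S n) (s (S (mm n)))); lia. }
set (K := greedy tau).
set (active := fun n => (s (mm n) <= n < s (mm n) + len (mm n))%nat /\ tau n <= 2 ^ K n).
assert (active_dec : forall n, {active n} + {~ active n}).
{ intros n. apply excluded_middle_informative. }
exists K, active, active_dec.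
assert (Hdepth : forall n, depth n = / 2 ^ n) by (intros n; apply pow_inv).
assert (Hin : forall m n, (s m <= n < s m + len m)%nat -> mm n = m).
{ intros m n Hn. apply Hmmeq. assert (H := Hnext m). lia. }
assert (Hact1 : forall n, active n -> (1 <= n)%nat).
{ intros n [[H _] _]. assert (H' := Hs1 (mm n)). lia. }
assert (Hblksum : forall m, mass K active active_dec (s m) (len m) <= 2 * INR m + 2 /\
   INR m <= mass K active active_dec (s m) (len m) /\
   lsum (fun n => if active_dec n then depth (K n) * exp (- 2 ^ K n) else 0) (seq (s m) (len m))
     <= (2 * INR m + 2) * exp (- 2 ^ m)).
{ intros m. destruct (Hblk m) as [B1 [B2 [B3 [B4 [B5 B6]]]]].
  assert (Esum : lsum (fun n => / (kap * 2 ^ m * th2 n)) (seq (s m) (len m))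
     = lsum (fun n => / tau n) (seq (s m) (len m))).
  { apply lsum_ext. intros n Hn. apply in_seq in Hn. unfold tau. now rewrite (Hin m n Hn). }
  rewrite Esum in B5, B6. unfold goal in B5, B6.
  assert (Hterm : forall n, In n (seq (s m) (len m)) -> active n -> depth (K n) <= / tau n).
  { intros n Hn [_ Ha]. apply in_seq in Hn. rewrite Hdepth.
    apply Rinv_le_contravar; auto. assert (H := Htau1 n ltac:(lia)). lra. }
  assert (Htp : forall n, In n (seq (s m) (len m)) -> 0 < / tau n).
  { intros n Hn. apply in_seq in Hn. apply Rinv_0_lt_compat.
    assert (H := Htau1 n ltac:(lia)). lra. }
  split; [|split].
  - eapply Rle_trans; [|eapply Rle_trans; [apply B6|lra]]. apply lsum_le. intros n Hn.
    destruct (active_dec n) as [Ha|_]; [now apply Hterm|]. left; now apply Htp.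
  (* A level of the block either is active, with [1 / tau <= 2 * depth (K n)], or lags behind. The
     lagging levels take at most 1 from the sum of [1 / tau], and half of the rest is mass. *)
  - set (lag := fun l => if Rlt_dec (2 ^ greedy tau l) (tau l) then / tau l else 0).
    assert (Hlag : lsum lag (seq (s m) (len m)) <= 1).
    { apply Rle_trans with (lsum lag (seq 1 (s m + len m))).
      - apply lsum_incl; [apply seq_NoDup| |].
        + intros x Hx. apply in_seq in Hx. apply in_seq. lia.
        + intros x Hx. apply in_seq in Hx. unfold lag.
          destruct (Rlt_dec (2 ^ greedy tau x) (tau x)); [|lra].
          left. apply Rinv_0_lt_compat. assert (H := Htau1 x ltac:(lia)). lra.
      - eapply Rle_trans; [apply greedy_lag_sum|].
        assert (P := depth_pos (greedy tau (s m + len m))). lra. }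
    assert (Hcmp : lsum (fun n => / tau n) (seq (s m) (len m)) <=
       lsum (fun n => 2 * (if active_dec n then depth (K n) else 0)) (seq (s m) (len m))
       + lsum lag (seq (s m) (len m))).
    { rewrite lsum_plus. apply lsum_le. intros n Hn. assert (Hp := Htp n Hn).
      apply in_seq in Hn. unfold lag.
      destruct (active_dec n) as [Ha|Ha].
      - assert (H : / tau n <= 2 * depth (K n)).
        { rewrite Hdepth. assert (H := greedy_le tau Htau1 Htaum n ltac:(lia)). fold K in H.
          assert (H' := pow2_ge1 (K n)). assert (H'' := Htau1 n ltac:(lia)).
          replace (2 * / 2 ^ K n) with (/ (2 ^ K n / 2)) by (field; lra).
          apply Rinv_le_contravar; lra. }
        destruct (Rlt_dec (2 ^ greedy tau n) (tau n)); lra.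
      - destruct (Rlt_dec (2 ^ greedy tau n) (tau n)) as [H|H]; [lra|].
        exfalso. apply Ha. split; [rewrite (Hin m n Hn); lia|]. fold K in H. lra. }
    rewrite lsum_scal in Hcmp. unfold mass. lra.
  - apply Rle_trans with (lsum (fun n => exp (- 2 ^ m) * / tau n) (seq (s m) (len m))).
    + apply lsum_le. intros n Hn. assert (Hp := Htp n Hn).
      assert (He := exp_pos (- 2 ^ m)).
      destruct (active_dec n) as [Ha|_]; [|nra].
      rewrite Rmult_comm. apply Rmult_le_compat; [left; apply exp_pos|left; apply depth_pos| |now apply Hterm].
      apply in_seq in Hn. destruct Ha as [_ Ha]. assert (H := Htau2 n ltac:(lia)).
      rewrite (Hin m n Hn) in H.
      apply exp_le_exp. lra.
    + rewrite lsum_scal. assert (He := exp_pos (- 2 ^ m)).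
      rewrite Rmult_comm. apply Rmult_le_compat_r; lra. }
split; [reflexivity|]. split; [apply greedy_S|]. split; [|split].
- intros n Ha. assert (Hn := Hact1 n Ha). split; auto. destruct Ha as [_ Ha].
  eapply Rle_trans; [|exact Ha]. unfold tau.
  assert (H' := pow2_ge1 (mm n)). assert (Q := th2_pos n Hn).
  assert (1 <= kap * 2 ^ mm n) by nra. nra.
- intros m. exists (s m), (len m). destruct (Hblk m) as [B1 [B2 [B3 [B4 _]]]].
  destruct (Hblksum m) as [S1 [S2 _]]. repeat split; auto.
  intros n Hn Ha. eapply Rle_trans; [|apply B4; lia].
  assert (Hg := greedy_le tau Htau1 Htaum n ltac:(lia)). fold K in Hg.
  assert (Ht := Htau1 n ltac:(lia)).
  assert (Et : tau n = kap * 2 ^ m * th2 n) by (unfold tau; now rewrite (Hin m n Hn)).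
  unfold growth.
  replace (4352 * ((2 * INR m + 2) * 2 + 2) * (kap * 2 ^ m) * th2 n)
    with (4352 * (((2 * INR m + 2) * 2 + 2) * tau n)) by (rewrite Et; ring).
  apply Rmult_le_compat_l; [lra|].
  rewrite Hdepth. unfold Rdiv. rewrite Rinv_inv.
  assert (Pm := pos_INR m). assert (H' := pow2_ge1 (K n)).
  assert (mass K active active_dec (s m) (len m) * 2 ^ K n <= (2 * INR m + 2) * (2 * tau n)).
  { apply Rmult_le_compat; lra. }
  lra.
(* Block [m] contributes at most [54 * depth m = 108 * (depth m - depth (S m))], so the sum over
   blocks telescopes; the gaps between blocks contribute nothing. *)
- exists 108. intros N.
  set (g := fun n => if active_dec n then depth (K n) * exp (- 2 ^ K n) else 0).
  assert (Hg : forall n, 0 <= g n).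
  { intros n. unfold g. destruct (active_dec n); [|lra].
    apply Rmult_le_pos; left; [apply depth_pos|apply exp_pos]. }
  assert (Hpart : forall m, lsum g (seq 0 (s m)) <= 108 - 108 * depth m).
  { assert (Hgap : forall l x, (forall n, (x <= n < x + l)%nat -> ~ active n) -> lsum g (seq x l) = 0).
    { intros l. induction l as [|l IH]; intros x Hx; [reflexivity|].
      simpl. rewrite IH by (intros n Hn; apply Hx; lia).
      unfold g. destruct (active_dec x) as [Ha|]; [|ring]. exfalso; apply (Hx x); [lia|exact Ha]. }
    induction m as [|m IH].
    - rewrite Hgap; [unfold depth; simpl; lra|]. intros n Hn [[Ha _] _].
      destruct (Hmm n) as [_ [E|E]].
      + rewrite E in Ha. lia.
      + destruct (Nat.eq_dec (mm n) 0) as [E0|E0]; [rewrite E0 in Ha; lia|].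
        assert (H := Hsinc 0%nat (mm n - 1)%nat).
        replace (0 + S (mm n - 1))%nat with (mm n) in H by lia. lia.
    - set (gap := (s (S m) - (s m + len m))%nat).
      assert (Hgp := Hnext m).
      replace (s (S m)) with (s m + (len m + gap))%nat by (unfold gap; lia).
      rewrite lsum_seq_app, lsum_seq_app, Nat.add_0_l.
      rewrite (Hgap gap (s m + len m)%nat).
      2:{ intros n Hn [Ha _]. rewrite (Hmmeq m n) in Ha by (unfold gap in Hn; lia). lia. }
      destruct (Hblksum m) as [_ [_ S3]]. assert (S4 := exp_neg_pow2_le m).
      change (lsum g (seq (s m) (len m)) <= (2 * INR m + 2) * exp (- 2 ^ m)) in S3.
      rewrite depth_S. lra. }
  assert (HsN : (N <= s N)%nat) by apply (Hblk N).
  apply Rle_trans with (lsum g (seq 0 (s N))).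
  + apply lsum_incl; [apply seq_NoDup| |auto].
    intros x Hx. apply in_seq in Hx. apply in_seq. lia.
  + eapply Rle_trans; [apply Hpart|]. assert (P := depth_pos N). lra.
Qed.

End Levels.

(** * Dyadic samples and enumeration of the nodes *)

Lemma depth_lt_eventually (eps : R) : 0 < eps -> exists N, forall n, (N <= n)%nat -> depth n < eps.
Proof.
intros He. assert (H := depth_lim). apply is_lim_seq_spec in H.
destruct (H (mkposreal eps He)) as [N HN]. exists N. intros n Hn. specialize (HN n Hn).
simpl in HN. apply Rabs_def2 in HN. lra.
Qed.

Lemma depth_in_01 n : (1 <= n)%nat -> 0 < depth n < 1.
Proof. intros Hn. assert (H := depth_le_half n Hn). assert (P := depth_pos n). lra. Qed.

Lemma ball_0_depth (d : R) (n : nat) : depth n < d -> ball (M := R_UniformSpace) 0 d (depth n).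
Proof.
intros H. assert (P := depth_pos n).
unfold ball; simpl; unfold AbsRing_ball, abs, minus, plus, opp; simpl.
rewrite Rabs_pos_eq; lra.
Qed.

Section DyadicSamples.

Variable theta2 : R -> R.
Hypothesis theta2_pos : positive_on_01 theta2.
Hypothesis theta2_cont : continuous_on_01 theta2.
Hypothesis theta2_mono : nonincreasing_on_01 theta2.

Let g (t : R) : R := / (t * theta2 t).

Lemma dyadic_integrand_continuous t : 0 < t < 1 -> continuous g t.
Proof.
intros Ht. assert (P := theta2_pos t Ht). unfold g.
apply (continuous_comp (fun t => t * theta2 t) Rinv).
- apply (continuous_mult (K := R_AbsRing)); [apply continuous_id|now apply theta2_cont].
- apply (ex_derive_continuous Rinv). auto_derive. nra.
Qed.

Lemma dyadic_integrand_integrable a b : 0 < a -> a <= b -> b < 1 -> ex_RInt g a b.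
Proof.
intros Ha Hab Hb. apply (ex_RInt_continuous (V := R_CompleteNormedModule)).
intros t Ht. rewrite Rmin_left, Rmax_right in Ht by auto. apply dyadic_integrand_continuous; lra.
Qed.

(** On [[2^-(n+1), 2^-n]] monotonicity bounds the integrand by [1 / (2^-(n+1) theta2 (2^-n))], and
    the interval has length [2^-(n+1)], so the powers of 2 cancel exactly. *)
Lemma RInt_dyadic_le s k : (1 <= s)%nat ->
  RInt g (depth (s + k)) (depth s) <= lsum (fun n => / theta2 (depth n)) (seq s k).
Proof.
intros Hs. induction k as [|k IH].
- rewrite Nat.add_0_r. rewrite RInt_point. simpl. unfold zero; simpl. lra.
- rewrite Nat.add_succ_r, lsum_seq_S. set (n := (s + k)%nat) in *.
  assert (Hn : (1 <= n)%nat) by (unfold n; lia).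
  assert (D1 := depth_in_01 n Hn). assert (D3 := depth_in_01 s Hs). assert (D4 := depth_S n).
  assert (D5 : depth n <= depth s) by (apply depth_antitone; unfold n; lia).
  rewrite <- (RInt_Chasles (V := R_CompleteNormedModule) g (depth (S n)) (depth n) (depth s))
    by (apply dyadic_integrand_integrable; lra).
  unfold plus; simpl. rewrite Rplus_comm. apply Rplus_le_compat; auto.
  assert (Pn := theta2_pos _ D1).
  apply Rle_trans with (RInt (fun _ => / (depth (S n) * theta2 (depth n))) (depth (S n)) (depth n)).
  + apply RInt_le; [lra|apply dyadic_integrand_integrable; lra|apply ex_RInt_const|].
    intros t Ht. unfold g. assert (Pm := theta2_mono t (depth n) ltac:(lra) ltac:(lra) ltac:(lra)).
    apply Rinv_le_contravar; [nra|]. apply Rmult_le_compat; lra.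
  + rewrite RInt_const. unfold scal; simpl; unfold mult; simpl. right. rewrite D4. field. lra.
Qed.

Lemma dyadic_divergence : int_diverges_at_0 g -> forall s B, (1 <= s)%nat ->
  exists len, B <= lsum (fun n => / theta2 (depth n)) (seq s len).
Proof.
intros [e0 He0] s B Hs.
destruct (depth_lt_eventually e0 (cond_pos e0)) as [N1 HN1].
(* The start is moved deeper, into the neighbourhood of 0 where divergence of the integral is known;
   the positive terms between [s] and [s'] are added back at the end. *)
set (s' := (s + N1)%nat).
assert (Hd := depth_in_01 s' ltac:(unfold s'; lia)).
assert (Hb : ball (M := R_UniformSpace) 0 e0 (depth s')).
{ apply ball_0_depth, HN1. unfold s'; lia. }
assert (Hlim := He0 (depth s') Hb (proj1 Hd)).
destruct (Hlim (fun v => B < v)) as [d Hdd]; [now exists B|].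
destruct (depth_lt_eventually d (cond_pos d)) as [N2 HN2].
set (n := (s' + N2)%nat).
assert (Hb2 : ball (M := R_UniformSpace) 0 d (depth n)).
{ apply ball_0_depth, HN2. unfold n; lia. }
assert (H := Hdd (depth n) Hb2 (depth_pos n)).
exists (N1 + N2)%nat. left. eapply Rlt_le_trans; [exact H|].
eapply Rle_trans; [apply RInt_dyadic_le; unfold s'; lia|].
apply lsum_incl; [apply seq_NoDup| |].
- intros x Hx. apply in_seq in Hx. apply in_seq. unfold s' in Hx. lia.
- intros x Hx. apply in_seq in Hx. left. apply Rinv_0_lt_compat, theta2_pos, depth_in_01. lia.
Qed.

Lemma dyadic_ratio (theta1 : R -> R) :
  filterlim (fun t => theta1 t / theta2 t) (at_right 0) (Rbar_locally p_infty) ->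
  forall A, exists N, forall n, (N <= n)%nat -> A * theta2 (depth n) <= theta1 (depth n).
Proof.
intros Hl A. destruct (Hl (fun v => A < v)) as [d Hd]; [now exists A|].
destruct (depth_lt_eventually d (cond_pos d)) as [N HN].
exists (S N). intros n Hn.
assert (Hb : ball (M := R_UniformSpace) 0 d (depth n)).
{ apply ball_0_depth, HN. lia. }
assert (H := Hd (depth n) Hb (depth_pos n)).
assert (P := theta2_pos _ (depth_in_01 n ltac:(lia))).
apply (Rlt_div_r A (theta1 (depth n)) (theta2 (depth n)) P) in H. lra.
Qed.

End DyadicSamples.

(** * Enumeration of an infinite set of nodes *)

Lemma increasing_enumeration (P : nat -> Prop) :
  (forall N, exists k, (N <= k)%nat /\ P k) ->
  exists e : nat -> nat, (forall k, P (e k)) /\ (forall k, (e k < e (S k))%nat) /\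
    forall c, P c -> exists k, e k = c.
Proof.
intros Hinf.
assert (Hleast : forall N, exists k, ((N <= k)%nat /\ P k) /\
  forall j, (N <= j)%nat -> P j -> (k <= j)%nat).
{ intros N. destruct (Hinf N) as [k0 Hk0].
  induction k0 as [k0 IH] using lt_wf_ind.
  destruct (classic (exists j, (j < k0)%nat /\ (N <= j)%nat /\ P j)) as [[j [Hj1 Hj2]]|Hno].
  - now apply (IH j).
  - exists k0. split; [exact Hk0|]. intros j Hj1 Hj2.
    destruct (Nat.le_gt_cases k0 j); auto. exfalso. apply Hno. now exists j. }
destruct (choice _ Hleast) as [nx Hnx].
set (e := fix e (k : nat) : nat := match k with O => nx 0%nat | S k => nx (S (e k)) end).
assert (Hlt : forall k, (e k < e (S k))%nat).
{ intros k. destruct (Hnx (S (e k))) as [[H _] _]. exact H. }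
exists e. split; [|split; auto].
- intros [|k]; apply (Hnx _).
- intros c Hc.
  assert (Hle : forall k, (k <= e k)%nat).
  { induction k as [|k IH]; [lia|]. assert (H := Hlt k). lia. }
  assert (Hfind : forall k, (c < e k)%nat -> exists k', e k' = c).
  { induction k as [|k IH]; intros Hk.
    - exfalso. assert (H := proj2 (Hnx 0%nat) c ltac:(lia) Hc). simpl in Hk. lia.
    - destruct (Nat.lt_trichotomy c (e k)) as [H|[H|H]].
      + now apply IH.
      + now exists k.
      + exfalso. assert (H' := proj2 (Hnx (S (e k))) c H Hc). simpl in Hk. lia. }
  apply (Hfind (S c)). assert (H := Hle (S c)). lia.
Qed.

(* The nodes [(n, i)], [i < 2^n], are numbered by [2^n + i]. *)
Lemma node_enumeration (sel : nat * nat -> Prop) :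
  (forall n i, sel (n, i) -> (i < 2 ^ n)%nat) ->
  (forall N, exists n i, (N <= n)%nat /\ sel (n, i)) ->
  exists p : nat -> nat * nat,
    (forall k, sel (p k)) /\ (forall k l, p k = p l -> k = l) /\
    (forall q, sel q -> exists k, p k = q) /\
    (forall N, exists k0, forall k, (k0 <= k)%nat -> (N <= fst (p k))%nat).
Proof.
intros Hlt Hinf.
set (code := fun q : nat * nat => (2 ^ fst q + snd q)%nat).
set (P := fun c => exists q, sel q /\ code q = c).
assert (Hnpow : forall n, (n < 2 ^ n)%nat) by (intros n; apply Nat.pow_gt_lin_r; lia).
destruct (increasing_enumeration P) as [e [He1 [He2 He3]]].
{ intros N. destruct (Hinf N) as [n [i [Hn Hs]]]. exists (code (n, i)). split.
  - unfold code; simpl. assert (H := Hnpow n). lia.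
  - now exists (n, i). }
destruct (choice (fun k q => sel q /\ code q = e k)) as [p Hp]; [exact He1|].
assert (Hinj : forall q q', sel q -> sel q' -> code q = code q' -> q = q').
{ intros [n i] [n' i'] H H' E. apply Hlt in H. apply Hlt in H'. unfold code in E; simpl in E.
  destruct (Nat.lt_trichotomy n n') as [Hc|[<-|Hc]].
  - exfalso. apply (Nat.pow_le_mono_r 2 (S n) n') in Hc; [|lia]. simpl in Hc. lia.
  - f_equal. lia.
  - exfalso. apply (Nat.pow_le_mono_r 2 (S n') n) in Hc; [|lia]. simpl in Hc. lia. }
assert (Hmon : forall k l, (k < l)%nat -> (e k < e l)%nat).
{ intros k l H. induction H as [|l H IH]; [apply He2|]. assert (H' := He2 l). lia. }
exists p. split; [intros k; apply (Hp k)|]. split; [|split].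
- intros k l E. assert (E' : e k = e l).
  { rewrite <- (proj2 (Hp k)), <- (proj2 (Hp l)). now rewrite E. }
  destruct (Nat.lt_trichotomy k l) as [H|[H|H]]; auto; apply Hmon in H; lia.
- intros q Hq. destruct (He3 (code q)) as [k Hk]; [now exists q|].
  exists k. destruct (Hp k) as [H1 H2]. apply Hinj; auto. congruence.
(* A node of level below [N] has code less than [2 ^ N], whereas the [k]-th code is at least [k]. *)
- intros N. exists (2 ^ N)%nat. intros k Hk.
  destruct (Hp k) as [H1 H2]. destruct (p k) as [n i]. simpl.
  destruct (Nat.le_gt_cases N n) as [H|H]; auto. exfalso.
  apply Hlt in H1. unfold code in H2; simpl in H2.
  apply (Nat.pow_le_mono_r 2 (S n) N) in H; [|lia]. simpl in H.
  assert (Hek : (k <= e k)%nat).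
  { clear - He2. induction k as [|k IH]; [lia|]. assert (H := He2 k). lia. }
  lia.
Qed.

(** * An outer function with small values on the tree *)

Definition cexp (z : C) : C := (exp (Re z) * cos (Im z), exp (Re z) * sin (Im z)).

Lemma Cmod_cexp z : Cmod (cexp z) = exp (Re z).
Proof.
assert (E := exp_pos (Re z)).
change (cexp z) with (circle (exp (Re z)) (Im z)). apply Cmod_circle. lra.
Qed.

Lemma cexp_plus z w : cexp (z + w) = (cexp z * cexp w)%C.
Proof.
unfold cexp, Cmult, Re, Im; simpl. rewrite exp_plus, cos_plus, sin_plus. f_equal; ring.
Qed.

Lemma cexp_neq0 z : cexp z <> RtoC 0.
Proof. apply Cmod_pos_neq. rewrite Cmod_cexp. apply exp_pos. Qed.

Lemma derivable_at_0 (f : R -> R) (l : R) : derivable_pt_lim f 0 l ->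
  forall eps, 0 < eps -> exists d, 0 < d /\
    forall h, Rabs h < d -> Rabs (f h - f 0 - l * h) <= eps * Rabs h.
Proof.
intros H eps He. destruct (H eps He) as [d Hd]. exists d. split; [apply cond_pos|].
intros h Hh. destruct (Req_dec h 0) as [->|Hn].
- replace (f 0 - f 0 - l * 0) with 0 by ring. rewrite Rabs_R0. lra.
- specialize (Hd h Hn Hh). rewrite Rplus_0_l in Hd.
  replace (f h - f 0 - l * h) with (((f h - f 0) / h - l) * h) by (field; auto).
  rewrite Rabs_mult. apply Rmult_le_compat_r; [apply Rabs_pos|lra].
Qed.

(** By the addition formula, differentiability of [cexp] anywhere reduces to this expansion at 0,
    which follows from the derivatives of [exp], [cos] and [sin] there. *)
Lemma cexp_at_0 : forall eps, 0 < eps -> exists d, 0 < d /\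
  forall h, Cmod h < d -> Cmod (cexp h - 1 - h) <= eps * Cmod h.
Proof.
intros eps He. set (e := Rmin 1 (eps / 10)).
assert (He0 : 0 < e) by (apply Rmin_glb_lt; lra).
assert (He1 : e <= 1) by apply Rmin_l. assert (He2 : e <= eps / 10) by apply Rmin_r.
destruct (derivable_at_0 exp 1) with (eps := e) as [d1 [Hd1 H1]]; auto.
{ apply derivable_pt_lim_exp_0. }
destruct (derivable_at_0 cos 0) with (eps := e) as [d2 [Hd2 H2]]; auto.
{ replace 0 with (- sin 0) at 2 by (rewrite sin_0; ring). apply derivable_pt_lim_cos. }
destruct (derivable_at_0 sin 1) with (eps := e) as [d3 [Hd3 H3]]; auto.
{ replace 1 with (cos 0) by apply cos_0. apply derivable_pt_lim_sin. }
exists (Rmin (Rmin d1 (e / 2)) (Rmin d2 d3)). split.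
{ repeat apply Rmin_glb_lt; lra. }
intros h Hh.
assert (Hl := Rmin_l (Rmin d1 (e / 2)) (Rmin d2 d3)).
assert (Hr := Rmin_r (Rmin d1 (e / 2)) (Rmin d2 d3)).
assert (Hl1 := Rmin_l d1 (e / 2)). assert (Hl2 := Rmin_r d1 (e / 2)).
assert (Hr1 := Rmin_l d2 d3). assert (Hr2 := Rmin_r d2 d3).
destruct (Re_Im_Cmod_le h) as [Hx Hy].
set (x := Re h) in *. set (y := Im h) in *.
specialize (H1 x ltac:(lra)). specialize (H2 y ltac:(lra)). specialize (H3 y ltac:(lra)).
rewrite exp_0 in H1. rewrite cos_0 in H2. rewrite sin_0 in H3.
replace (exp x - 1 - 1 * x) with (exp x - 1 - x) in H1 by ring.
replace (cos y - 1 - 0 * y) with (cos y - 1) in H2 by ring.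
replace (sin y - 0 - 1 * y) with (sin y - y) in H3 by ring.
assert (Py := Rabs_pos y). assert (Hex : Rabs (exp x - 1) <= e).
{ replace (exp x - 1) with ((exp x - 1 - x) + x) by ring.
  eapply Rle_trans; [apply Rabs_triang|]. nra. }
assert (Hex2 : Rabs (exp x) <= 2).
{ replace (exp x) with ((exp x - 1) + 1) by ring.
  eapply Rle_trans; [apply Rabs_triang|]. rewrite (Rabs_pos_eq 1); lra. }
eapply Rle_trans; [apply Cmod_le_abs|].
replace (Re (cexp h - 1 - h)) with ((exp x - 1 - x) + exp x * (cos y - 1))
  by (unfold cexp, x, y; simpl; unfold Re; ring).
replace (Im (cexp h - 1 - h)) with (exp x * (sin y - y) + (exp x - 1) * y)
  by (unfold cexp, x, y; simpl; unfold Im; ring).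
assert (A1 := Rabs_triang (exp x - 1 - x) (exp x * (cos y - 1))).
assert (A2 := Rabs_triang (exp x * (sin y - y)) ((exp x - 1) * y)).
rewrite Rabs_mult in A1. rewrite !Rabs_mult in A2.
assert (Q := Rabs_pos (exp x)). assert (Q1 := Rabs_pos (cos y - 1)). assert (Q2 := Rabs_pos (sin y - y)).
assert (B1 : Rabs (exp x) * Rabs (cos y - 1) <= 2 * (e * Cmod h)).
{ apply Rmult_le_compat; auto. nra. }
assert (B2 : Rabs (exp x) * Rabs (sin y - y) <= 2 * (e * Cmod h)).
{ apply Rmult_le_compat; auto. nra. }
assert (B3 : Rabs (exp x - 1) * Rabs y <= e * Cmod h).
{ apply Rmult_le_compat; auto. apply Rabs_pos. }
assert (B4 : Rabs (exp x - 1 - x) <= e * Cmod h) by nra.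
assert (B5 : e * Cmod h <= eps / 10 * Cmod h) by nra.
assert (B6 : 0 <= eps * Cmod h) by nra.
lra.
Qed.

Lemma cdiff_cexp_comp (g : C -> C) (z : C) : cdiff g z -> cdiff (fun w => cexp (g w)) z.
Proof.
intros Hg. assert (Hc := cdiff_continuous g z Hg).
apply cdiff_iff in Hg. destruct Hg as [l Hl]. apply cdiff_iff.
exists (cexp (g z) * l)%C. intros eps He.
set (E := Cmod (cexp (g z))).
assert (HE : 0 < E) by (unfold E; rewrite Cmod_cexp; apply exp_pos).
assert (Pl := Cmod_ge_0 l).
set (e := Rmin 1 (eps / (E * (Cmod l + 2)))).
assert (He0 : 0 < e) by (apply Rmin_glb_lt; [lra|apply Rdiv_lt_0_compat; nra]).
assert (He1 : e <= 1) by apply Rmin_l.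
assert (He2 : E * (Cmod l + 2) * e <= eps).
{ apply Rle_trans with (E * (Cmod l + 2) * (eps / (E * (Cmod l + 2)))).
  - apply Rmult_le_compat_l; [nra|apply Rmin_r].
  - right; field; split; lra. }
destruct (cexp_at_0 e He0) as [d1 [Hd1 H1]].
destruct (Hc d1 Hd1) as [d2 [Hd2 H2]].
destruct (Hl e He0) as [d3 [Hd3 H3]].
exists (Rmin d2 d3). split; [now apply Rmin_glb_lt|]. intros w Hw.
assert (Hw2 : Cmod (w - z) < d2) by apply (lt_Rmin _ _ _ Hw).
assert (Hw3 : Cmod (w - z) < d3) by apply (lt_Rmin _ _ _ Hw).
specialize (H2 w Hw2). specialize (H3 w Hw3). set (h := (g w - g z)%C) in *.
specialize (H1 h H2).
assert (Eg : cexp (g w) = (cexp (g z) * cexp h)%C).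
{ rewrite <- cexp_plus. f_equal. unfold h. ring. }
rewrite Eg.
replace (cexp (g z) * cexp h - cexp (g z) - (w - z) * (cexp (g z) * l))%C
  with (cexp (g z) * ((cexp h - 1 - h) + (h - (w - z) * l)))%C by ring.
rewrite Cmod_mult. fold E.
assert (A1 := Cmod_triangle (cexp h - 1 - h) (h - (w - z) * l)).
assert (A2 : Cmod h <= (Cmod l + 1) * Cmod (w - z)).
{ replace h with ((h - (w - z) * l) + (w - z) * l)%C by ring.
  eapply Rle_trans; [apply Cmod_triangle|]. rewrite Cmod_mult.
  assert (P := Cmod_ge_0 (w - z)). nra. }
assert (P := Cmod_ge_0 (w - z)).
apply Rle_trans with (E * (e * ((Cmod l + 1) * Cmod (w - z)) + e * Cmod (w - z))).
- apply Rmult_le_compat_l; [lra|]. nra.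
- replace (E * (e * ((Cmod l + 1) * Cmod (w - z)) + e * Cmod (w - z)))
    with (E * (Cmod l + 2) * e * Cmod (w - z)) by ring.
  apply Rmult_le_compat_r; lra.
Qed.

Lemma Re_lCsum {A : Type} (g : A -> C) (l : list A) : Re (lCsum g l) = lsum (fun a => Re (g a)) l.
Proof. induction l as [|a l IH]; simpl; [reflexivity|]. now rewrite <- IH. Qed.

Lemma Im_lCsum {A : Type} (g : A -> C) (l : list A) : Im (lCsum g l) = lsum (fun a => Im (g a)) l.
Proof. induction l as [|a l IH]; simpl; [reflexivity|]. now rewrite <- IH. Qed.

Lemma Re_scal_R (c : R) (z : C) : Re (RtoC c * z) = c * Re z.
Proof. unfold Re; simpl; ring. Qed.

Lemma Im_scal_R (c : R) (z : C) : Im (RtoC c * z) = c * Im z.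
Proof. unfold Im; simpl; ring. Qed.

Lemma Re_szego (a z : C) : (1 - Cconj a * z)%C <> RtoC 0 ->
  Re (szego a z) = (Cmod (1 - Cconj a * z) ^ 2 + (1 - Cmod a ^ 2 * Cmod z ^ 2))
    / (2 * Cmod (1 - Cconj a * z) ^ 2).
Proof.
intros Hn. set (q := (1 - Cconj a * z)%C) in *.
assert (Hq : 0 < Cmod q) by now apply Cmod_gt_0.
assert (E1 : Re (/ q) = Re q / Cmod q ^ 2).
{ rewrite Cmod2_alt. unfold Re, Im, Cinv; simpl. reflexivity. }
unfold szego. fold q. rewrite E1.
assert (E2 : 2 * Re q = Cmod q ^ 2 + (1 - Cmod a ^ 2 * Cmod z ^ 2)).
{ rewrite !Cmod2_alt. unfold q. destruct a as [a1 a2], z as [x y]; simpl. ring. }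
rewrite <- E2. field. lra.
Qed.

Section Potential.

Variable K : nat -> nat.
Hypothesis K_0 : K 0%nat = 0%nat.
Hypothesis K_S : forall n, K (S n) = K n \/ K (S n) = S (K n).

Let w (n : nat) : R := depth n / depth (K n).

Lemma weight_pos n : 0 < w n.
Proof. apply Rdiv_lt_0_compat; apply depth_pos. Qed.

Lemma weight_total n : w n * lsum (fun _ => 1) (tree K n) = 1.
Proof.
rewrite (lsum_tree_1 K K_0 K_S). unfold w. assert (P := depth_pos n). assert (Q := depth_pos (K n)).
field. lra.
Qed.

(* Integration against the uniform measure on the left endpoints of level [n];
   these measures converge to the Cantor measure of the tree. *)
Let av (n : nat) (g : nat -> C) : C := (RtoC (w n) * lCsum g (tree K n))%C.

Lemma Cmod_av_le n (g : nat -> C) (M : R) :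
  (forall i, In i (tree K n) -> Cmod (g i) <= M) -> Cmod (av n g) <= M.
Proof.
intros H. unfold av. rewrite Cmod_mult, Cmod_R, Rabs_pos_eq by (left; apply weight_pos).
apply Rle_trans with (w n * (M * lsum (fun _ => 1) (tree K n))).
- apply Rmult_le_compat_l; [left; apply weight_pos|].
  eapply Rle_trans; [apply Cmod_lCsum_le|]. rewrite <- lsum_scal. apply lsum_le.
  intros i Hi. rewrite Rmult_1_r. now apply H.
- right. replace (w n * (M * lsum (fun _ => 1) (tree K n)))
    with (M * (w n * lsum (fun _ => 1) (tree K n))) by ring. rewrite weight_total. ring.
Qed.

(** Survivors of one level have equally many descendants, so the ancestor map carries the uniform
    measure of level [n + k] to that of level [n]. *)
Lemma av_ancestor n k (g : nat -> C) : av (n + k) (fun j => g (j / 2 ^ k)%nat) = av n g.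
Proof.
assert (Hw : w (n + k) * (depth n / depth (n + k) * (depth (K (n + k)) / depth (K n))) = w n).
{ unfold w. assert (P' := depth_pos (n + k)).
  assert (Q := depth_pos (K n)). assert (Q' := depth_pos (K (n + k))). field. lra. }
assert (Hext : forall u v : C, Re u = Re v -> Im u = Im v -> u = v).
{ intros [u1 u2] [v1 v2]; simpl; intros -> ->; reflexivity. }
unfold av. apply Hext.
- rewrite !Re_scal_R, !Re_lCsum.
  rewrite (lsum_tree_ancestor K K_0 K_S (fun q => Re (g q)) n k). rewrite <- Hw. ring.
- rewrite !Im_scal_R, !Im_lCsum.
  rewrite (lsum_tree_ancestor K K_0 K_S (fun q => Im (g q)) n k). rewrite <- Hw. ring.
Qed.

Lemma av_minus n (g h : nat -> C) : (av n g - av n h)%C = av n (fun i => g i - h i)%C.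
Proof.
unfold av. induction (tree K n) as [|i l IH]; simpl; [ring|].
replace (RtoC (w n) * (g i - h i + lCsum (fun i0 => g i0 - h i0) l))%C
  with (RtoC (w n) * (g i - h i) + RtoC (w n) * lCsum (fun i0 => g i0 - h i0) l)%C by ring.
rewrite <- IH. ring.
Qed.

Lemma av_scal n (c : C) (g : nat -> C) : (c * av n g)%C = av n (fun i => c * g i)%C.
Proof. unfold av. rewrite <- lCsum_scal. ring. Qed.

Let endpoint (n i : nat) : C := arc (INR i * depth n).

Let sz (n : nat) (z : C) : C := av n (fun i => szego (endpoint n i) z).

(** Lifting the level [n] average to level [n + 1] by ancestors, only endpoints are moved: by at
    most half of [depth n] in the parameter, hence [depth n] on the circle. The increments are thus
    geometrically summable. *)
Lemma sz_increment n z : Cmod z < 1 ->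
  Cmod (sz (S n) z - sz n z) <= depth n * / (1 - Cmod z) ^ 2.
Proof.
intros Hz. unfold sz.
rewrite <- (av_ancestor n 1 (fun i => szego (endpoint n i) z)), Nat.add_1_r, av_minus.
apply Cmod_av_le. intros j Hj.
change (2 ^ 1)%nat with 2%nat. set (q := (j / 2)%nat).
assert (Hd : Cmod (endpoint (S n) j - endpoint n q) <= depth n).
{ eapply Rle_trans; [apply Cmod_arc_sub_le|]. rewrite depth_S.
  assert (Hj2 : INR j = 2 * INR q + INR (j mod 2)).
  { rewrite <- (mult_INR 2), <- plus_INR. f_equal. apply Nat.div_mod; lia. }
  replace (INR j * (depth n / 2) - INR q * depth n) with (INR (j mod 2) * (depth n / 2))
    by (rewrite Hj2; field).
  assert (Hr : INR (j mod 2) <= 1).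
  { assert (H := Nat.mod_upper_bound j 2 ltac:(lia)). apply (le_INR (j mod 2) 1). lia. }
  assert (Pr := pos_INR (j mod 2)). assert (P := depth_pos n).
  rewrite Rabs_pos_eq; nra. }
assert (Ha : Cmod (endpoint (S n) j) = 1) by apply Cmod_arc.
assert (Hb : Cmod (endpoint n q) = 1) by apply Cmod_arc.
set (a := endpoint (S n) j) in *. set (b := endpoint n q) in *.
assert (E : (szego a z - szego b z = Cconj (a - b) * z * (szego a z * szego b z))%C).
{ unfold szego. rewrite Cminus_conj. field. split; apply one_sub_conj_neq0; lra. }
rewrite E, !Cmod_mult, Cmod_conj.
assert (S1 := Cmod_szego_le a z ltac:(lra) Hz). assert (S2 := Cmod_szego_le b z ltac:(lra) Hz).
assert (Q1 := Cmod_ge_0 (szego a z)). assert (Q2 := Cmod_ge_0 (szego b z)).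
assert (Pz := Cmod_ge_0 z). assert (Pab := Cmod_ge_0 (a - b)).
replace (/ (1 - Cmod z) ^ 2) with (/ (1 - Cmod z) * / (1 - Cmod z)) by (field; lra).
apply Rmult_le_compat; nra.
Qed.

Lemma sz_converges : exists S : C -> C, forall z, Cmod z < 1 -> Clim (fun n => sz n z) (S z).
Proof.
assert (H : forall z, exists l, Cmod z < 1 -> Clim (fun n => sz n z) l).
{ intros z. destruct (Rlt_dec (Cmod z) 1) as [Hz|Hz].
  - destruct (Clim_of_summable_increments (fun n => sz n z)
      (fun n => depth n * / (1 - Cmod z) ^ 2)) as [l Hl].
    + intros n. now apply sz_increment.
    + apply ex_series_ext with (fun n => / (1 - Cmod z) ^ 2 * depth n).
      * intros n. apply Rmult_comm.
      * apply (ex_series_scal_l (/ (1 - Cmod z) ^ 2) depth).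
        apply ex_series_geom. rewrite Rabs_pos_eq; lra.
    + now exists l.
  - exists (RtoC 0). intros Hz'; contradiction. }
destruct (choice _ H) as [S HS]. now exists S.
Qed.

Lemma sz_remainder n z v : Cmod z < 1 -> Cmod (v - z) < (1 - Cmod z) / 2 ->
  Cmod (sz n v - sz n z - (v - z) * av n (fun i => Cconj (endpoint n i) * szego (endpoint n i) z ^ 2)%C)
  <= 2 / (1 - Cmod z) ^ 3 * Cmod (v - z) ^ 2.
Proof.
intros Hz Hv. unfold sz. rewrite av_minus, av_scal, av_minus.
apply Cmod_av_le. intros i _. apply szego_remainder; auto.
unfold endpoint. rewrite Cmod_arc. lra.
Qed.

Lemma Re_sz_nonneg n z : Cmod z < 1 -> 0 <= Re (sz n z).
Proof.
intros Hz. unfold sz, av. rewrite Re_scal_R, Re_lCsum.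
apply Rmult_le_pos; [left; apply weight_pos|]. apply lsum_nonneg. intros i _.
assert (Ha : Cmod (endpoint n i) = 1) by apply Cmod_arc.
assert (Hn : (1 - Cconj (endpoint n i) * z)%C <> RtoC 0) by (apply one_sub_conj_neq0; lra).
rewrite Re_szego by exact Hn. rewrite Ha.
assert (P : 0 < Cmod (1 - Cconj (endpoint n i) * z) ^ 2) by (apply pow_lt; now apply Cmod_gt_0).
assert (Pz := Cmod_ge_0 z).
apply Rmult_le_pos; [nra|]. left. apply Rinv_0_lt_compat. lra.
Qed.

(** Only the descendants of the node itself are counted. They carry measure [depth n / depth (K n)],
    and there [|1 - conj a z|^2 <= t^2 + (2 t)^2 = 5 t^2] makes the real part of the kernel at least
    [1 / (10 t)]. Independence of [k] lets the bound pass to the limit. *)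
Lemma Re_sz_node n k i : (1 <= n)%nat -> In i (tree K n) ->
  / (10 * depth (K n)) <= Re (sz (n + k) (node n i)).
Proof.
intros Hn Hi. set (z := node n i). set (t := depth n).
assert (Ht : 0 < t <= / 2) by (split; [apply depth_pos|now apply depth_le_half]).
assert (Hz : Cmod z = 1 - t) by apply Cmod_node.
unfold sz, av. rewrite Re_scal_R, Re_lCsum.
set (g := fun q => if Nat.eq_dec q i then / (10 * t) else 0).
assert (Hg : / (10 * t) <= lsum g (tree K n)).
{ apply Rle_trans with (lsum g (i :: nil)).
  - simpl. unfold g. destruct (Nat.eq_dec i i); [lra|contradiction].
  - apply lsum_incl.
    + constructor; [intros []|constructor].
    + intros x [<-|[]]. exact Hi.
    + intros x _. unfold g. destruct (Nat.eq_dec x i); [|lra].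
      left. apply Rinv_0_lt_compat. lra. }
assert (Hcmp : lsum (fun j => g (j / 2 ^ k)%nat) (tree K (n + k)) <=
  lsum (fun j => Re (szego (endpoint (n + k) j) z)) (tree K (n + k))).
{ apply lsum_le. intros j Hj.
  assert (Ha : Cmod (endpoint (n + k) j) = 1) by apply Cmod_arc.
  assert (Hne : (1 - Cconj (endpoint (n + k) j) * z)%C <> RtoC 0) by (apply one_sub_conj_neq0; lra).
  rewrite Re_szego by exact Hne. rewrite Ha, Hz.
  assert (Hq : 0 < Cmod (1 - Cconj (endpoint (n + k) j) * z) ^ 2) by (apply pow_lt; now apply Cmod_gt_0).
  unfold g. destruct (Nat.eq_dec (j / 2 ^ k) i) as [E|E].
  2:{ apply Rmult_le_pos; [nra|]. left. apply Rinv_0_lt_compat. lra. }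
  assert (Hden : Cmod (1 - Cconj (endpoint (n + k) j) * z) ^ 2 <= 5 * t ^ 2).
  { replace (endpoint (n + k) j) with (RtoC 1 * endpoint (n + k) j)%C by ring.
    unfold z, node. fold t.
    rewrite (Cmod_one_sub_conj_polar 1 (1 - t) (endpoint (n + k) j) (arc (INR i * t))) by apply Cmod_arc.
    assert (Hp0 : (2 ^ k <> 0)%nat) by (apply Nat.pow_nonzero; lia).
    assert (Hdiv : INR j = 2 ^ k * INR i + INR (j mod 2 ^ k)).
    { rewrite <- INR_pow2, <- mult_INR, <- plus_INR, <- E. f_equal. apply Nat.div_mod; auto. }
    assert (Hrem : 0 <= INR (j mod 2 ^ k) * depth k <= 1).
    { apply node_param. apply Nat.mod_upper_bound; auto. }
    assert (Hx : INR j * depth (n + k) - INR i * t = INR (j mod 2 ^ k) * depth k * t).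
    { rewrite depth_add. fold t. rewrite Hdiv.
      transitivity (INR i * t * (depth k * 2 ^ k) - INR i * t + INR (j mod 2 ^ k) * depth k * t); [ring|].
      rewrite depth_inv. ring. }
    assert (Hs := Cmod_arc_sub_le (INR j * depth (n + k)) (INR i * t)).
    rewrite Hx, Rabs_pos_eq in Hs by nra.
    fold (endpoint (n + k) j) in Hs.
    assert (Hs0 := Cmod_ge_0 (endpoint (n + k) j - arc (INR i * t))).
    assert (Hs1 : Cmod (endpoint (n + k) j - arc (INR i * t)) <= 2 * t) by nra.
    assert (Hs2 : Cmod (endpoint (n + k) j - arc (INR i * t)) ^ 2 <= (2 * t) ^ 2) by (apply pow_incr; lra).
    assert (0 <= Cmod (endpoint (n + k) j - arc (INR i * t)) ^ 2) by apply pow2_ge_0.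
    nra. }
  set (D := Cmod (1 - Cconj (endpoint (n + k) j) * z) ^ 2) in *.
  assert (Hnum : t <= 1 - 1 ^ 2 * (1 - t) ^ 2) by nra.
  apply (proj1 (Rle_div_r _ _ (2 * D) ltac:(lra))).
  apply Rle_trans with (/ (10 * t) * (10 * t ^ 2)).
  - apply Rmult_le_compat_l; [left; apply Rinv_0_lt_compat; lra|]. lra.
  - replace (/ (10 * t) * (10 * t ^ 2)) with t by (field; lra). lra. }
apply Rle_trans with (w (n + k) * lsum (fun j => g (j / 2 ^ k)%nat) (tree K (n + k))).
- rewrite (lsum_tree_ancestor K K_0 K_S g n k).
  assert (P' := depth_pos (n + k)). assert (Q := depth_pos (K n)). assert (Q' := depth_pos (K (n + k))).
  fold t. replace (w (n + k) * (t / depth (n + k) * (depth (K (n + k)) / depth (K n)) * lsum g (tree K n)))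
    with (t / depth (K n) * lsum g (tree K n)) by (unfold w; field; lra).
  apply Rle_trans with (t / depth (K n) * / (10 * t)).
  + right. field. lra.
  + apply Rmult_le_compat_l; auto. left. apply Rdiv_lt_0_compat; lra.
- apply Rmult_le_compat_l; auto. left; apply weight_pos.
Qed.

Lemma outer_function : exists f : C -> C,
  Hinf f /\ nonzero_on_disc f /\
  forall n i, (1 <= n)%nat -> In i (tree K n) -> Cmod (f (node n i)) <= exp (- 2 * 2 ^ K n).
Proof.
destruct sz_converges as [S HS].
assert (HSd : forall z, Cmod z < 1 -> cdiff S z).
{ intros z Hz.
  apply cdiff_limit with (F := sz) (D := fun n => av n (fun i => Cconj (endpoint n i) * szego (endpoint n i) z ^ 2)%C)
    (d := (1 - Cmod z) / 2) (K := 2 / (1 - Cmod z) ^ 3).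
  - lra.
  - left. apply Rdiv_lt_0_compat; [lra|apply pow_lt; lra].
  - intros n v Hv. now apply sz_remainder.
  - intros v Hv. apply HS. assert (H := Cmod_close z v Hv). lra. }
assert (HRe : forall z m N, Cmod z < 1 -> (forall n, (N <= n)%nat -> m <= Re (sz n z)) -> m <= Re (S z)).
{ intros z m N Hz Hm. apply le_epsilon. intros eps He.
  destruct (proj1 (Clim_iff _ _) (HS z Hz) eps He) as [N1 HN1].
  specialize (HN1 (N + N1)%nat ltac:(lia)). specialize (Hm (N + N1)%nat ltac:(lia)).
  assert (H := Re_lip (sz (N + N1) z) (S z)).
  assert (H' := Rle_abs (Re (sz (N + N1) z) - Re (S z))). lra. }
(* With [Re S >= 2 ^ K n / 10] at the nodes, 20 yields [exp (- 2 * 2 ^ K n)]: one half of the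
   exponent offsets [exp theta2], the other makes the thinness series converge. Since [Re S >= 0],
   the modulus is at most 1. *)
exists (fun z => cexp (RtoC (-20) * S z)). split; [split|split].
- intros z Hz. apply cdiff_cexp_comp. apply cdiff_mult; [apply cdiff_const|now apply HSd].
- exists 1. intros z Hz. rewrite Cmod_cexp, Re_scal_R.
  assert (H := HRe z 0 0%nat Hz (fun n _ => Re_sz_nonneg n z Hz)).
  rewrite <- exp_0. apply exp_le_exp. lra.
- exists (RtoC 0). split; [unfold in_disc; rewrite Cmod_0; lra|apply cexp_neq0].
- intros n i Hn Hi. rewrite Cmod_cexp, Re_scal_R.
  assert (H : / (10 * depth (K n)) <= Re (S (node n i))).
  { apply (HRe (node n i) _ n); [apply Cmod_node_lt1|]. intros l Hl.
    replace l with (n + (l - n))%nat by lia. now apply Re_sz_node. }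
  assert (E : / (10 * depth (K n)) = 2 ^ K n / 10).
  { unfold depth. rewrite pow_inv. field. apply pow_nonzero. lra. }
  rewrite E in H.
  assert (H1 : -20 * Re (S (node n i)) <= -2 * 2 ^ K n) by lra.
  now apply exp_le_exp.
Qed.

End Potential.

(** * The separating sequence *)

Lemma lsum_seq_sum_n (a : nat -> R) (n : nat) : lsum a (seq 0 (S n)) = sum_n a n.
Proof.
induction n as [|n IH].
- rewrite sum_O. simpl. ring.
- rewrite lsum_seq_S, IH, sum_Sn. reflexivity.
Qed.

Lemma ex_series_bounded (a : nat -> R) (S : R) :
  (forall n, 0 <= a n) -> (forall n, sum_n a n <= S) -> ex_series a.
Proof.
intros Ha HS.
destruct (ex_finite_lim_seq_incr (sum_n a) S) as [l Hl]; auto.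
- intros n. rewrite sum_Sn. unfold plus; simpl. assert (H := Ha (Datatypes.S n)). lra.
- now exists l.
Qed.

Lemma sum_n_le_Series (a : nat -> R) (n : nat) :
  (forall n, 0 <= a n) -> ex_series a -> sum_n a n <= Series a.
Proof.
intros Ha Hs. apply (is_lim_seq_incr_compare (sum_n a)).
- apply Series_correct, Hs.
- intros m. rewrite sum_Sn. unfold plus; simpl. assert (H := Ha (S m)). lra.
Qed.

Lemma NoDup_map_inj_in {A B : Type} (f : A -> B) (l : list A) :
  (forall x y, In x l -> In y l -> f x = f y -> x = y) -> NoDup l -> NoDup (map f l).
Proof.
intros Hf Hl. induction l as [|x l IH]; simpl; [constructor|].
inversion Hl; subst. apply NoDup_cons.
- intros Hin. apply in_map_iff in Hin. destruct Hin as [y [E Hy]].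
  assert (y = x) by (apply Hf; [now right|now left|exact E]). subst; contradiction.
- apply IH; auto. intros u v Hu Hv. apply Hf; now right.
Qed.

Lemma pseudohyp_sqr (z w : C) : Cmod z < 1 -> Cmod w < 1 ->
  pseudohyp z w ^ 2 = 1 - pick z w.
Proof.
intros Hz Hw. rewrite pick_sym. unfold pseudohyp, pick.
assert (Hn : (1 - Cconj z * w)%C <> RtoC 0) by (apply one_sub_conj_neq0; lra).
rewrite Cmod_div by exact Hn. assert (P := proj1 (Cmod_gt_0 _) Hn).
rewrite <- pick_identity. field. lra.
Qed.

Section Construction.

Variables (theta1 theta2 : R -> R) (K : nat -> nat) (active : nat -> Prop).
Hypothesis active_dec : forall n, {active n} + {~ active n}.
Hypothesis K_0 : K 0%nat = 0%nat.
Hypothesis K_S : forall n, K (S n) = K n \/ K (S n) = S (K n).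
Hypothesis active_theta2 : forall n, active n -> (1 <= n)%nat /\ theta2 (depth n) <= 2 ^ K n.

Let sel (q : nat * nat) : Prop := active (fst q) /\ In (snd q) (tree K (fst q)).

Variable p : nat -> nat * nat.
Hypothesis p_sel : forall k, sel (p k).
Hypothesis p_inj : forall k l, p k = p l -> k = l.
Hypothesis p_onto : forall q, sel q -> exists k, p k = q.
Hypothesis p_depth : forall N, exists k0, forall k, (k0 <= k)%nat -> (N <= fst (p k))%nat.

Lemma sel_lt q : sel q -> (1 <= fst q)%nat /\ (snd q < 2 ^ fst q)%nat.
Proof.
intros [Ha Hi]. split; [now apply active_theta2|]. apply (tree_lt K K_0 _ _ Hi).
Qed.

Lemma sel_pick q q' : sel q -> sel q' -> q <> q' -> pick (node_of q) (node_of q') <= 16 / 17.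
Proof.
intros H H' Hne. destruct (sel_lt q H), (sel_lt q' H').
apply pick_node_separated; auto. destruct q, q'; exact Hne.
Qed.

(** Coinciding nodes would have [pick] equal to 1, above the separation bound. *)
Lemma node_of_inj q q' : sel q -> sel q' -> node_of q = node_of q' -> q = q'.
Proof.
intros H H' E. apply NNPP. intros Hne. assert (Hp := sel_pick q q' H H' Hne).
rewrite E in Hp. assert (Hlt := Cmod_node_lt1 (fst q') (snd q')).
fold (node_of q') in Hlt. assert (Hs := pseudohyp_sqr _ _ Hlt Hlt).
unfold pseudohyp in Hs.
replace ((node_of q' - node_of q') / (1 - Cconj (node_of q') * node_of q'))%C with (RtoC 0) in Hs.
- rewrite Cmod_0 in Hs. simpl in Hs. lra.
- field. apply one_sub_conj_neq0; lra.
Qed.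

Let z (k : nat) : C := node_of (p k).

Lemma z_disc_sequence : disc_sequence z.
Proof.
split.
- intros k. apply Cmod_node_lt1.
- apply is_lim_seq_spec. intros eps.
  destruct (depth_lt_eventually eps (cond_pos eps)) as [N HN].
  destruct (p_depth N) as [k0 Hk0]. exists k0. intros k Hk.
  unfold z, node_of. rewrite Cmod_node. specialize (HN _ (Hk0 k Hk)).
  assert (P := depth_pos (fst (p k))).
  replace (1 - depth (fst (p k)) - 1) with (- depth (fst (p k))) by ring.
  rewrite Rabs_Ropp, Rabs_pos_eq; lra.
Qed.

Lemma z_separated : separated z.
Proof.
(* The bound on [pick] gives [rho^2 >= 1/17 > 1/25]. *)
unfold separated. apply Rbar_lt_le_trans with (Finite (/ 5)); [simpl; lra|].
apply Glb_Rbar_correct. intros r [n [k [Hnk ->]]]. simpl.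
assert (H1 := Cmod_node_lt1 (fst (p n)) (snd (p n))).
assert (H2 := Cmod_node_lt1 (fst (p k)) (snd (p k))).
assert (Hs := pseudohyp_sqr (z n) (z k) H1 H2).
assert (Hp : pick (z n) (z k) <= 16 / 17).
{ apply sel_pick; auto. }
assert (P : 0 <= pseudohyp (z n) (z k)) by apply Cmod_ge_0.
nra.
Qed.

(** An active level has [depth (K l) / depth l] nodes of depth [depth l], and at each of them
    [exp theta2 * |f|] is at most [exp (2 ^ K l) * exp (- 2 * 2 ^ K l)]. *)
Lemma z_thin (S : R) :
  (forall N, lsum (fun n => if active_dec n then depth (K n) * exp (- 2 ^ K n) else 0) (seq 0 N) <= S) ->
  thin theta2 z.
Proof.
intros HS. destruct (outer_function K K_0 K_S) as [f [Hf [Hnz Hfb]]].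
exists f. split; [exact Hf|split; [exact Hnz|]].
set (term := fun q => thin_term theta2 f (node_of q)).
assert (Hterm0 : forall q, 0 <= term q) by (intros q; apply thin_term_nonneg, Cmod_node_lt1).
apply ex_series_bounded with S; [intros n; apply Hterm0|]. intros n.
rewrite <- lsum_seq_sum_n. change (fun k => thin_term theta2 f (z k)) with (fun k => term (p k)).
rewrite <- (lsum_map term p).
set (N := Datatypes.S (list_max (map (fun k => fst (p k)) (seq 0 (Datatypes.S n))))).
apply Rle_trans with (lsum term (block K active active_dec 0 N)).
- apply lsum_incl; [| |intros; apply Hterm0].
  + apply FinFun.Injective_map_NoDup; [intros x y; apply p_inj|apply seq_NoDup].
  + intros q Hq. apply in_map_iff in Hq. destruct Hq as [k [<- Hk]].
    destruct (p k) as [l j] eqn:E. assert (Hs := p_sel k). rewrite E in Hs.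
    apply in_block. destruct Hs as [Ha Hj]. split; [|now split].
    split; [lia|]. simpl. unfold N.
    assert (Hm := proj1 (list_max_le (map (fun k => fst (p k)) (seq 0 (Datatypes.S n))) _) (le_n _)).
    rewrite Forall_forall in Hm. specialize (Hm l).
    assert (Hl : (l <= list_max (map (fun k => fst (p k)) (seq 0 (Datatypes.S n))))%nat).
    { apply Hm. apply in_map_iff. exists k. rewrite E. auto. }
    lia.
- eapply Rle_trans; [|apply (HS N)]. rewrite lsum_block. apply lsum_le. intros l _.
  destruct (active_dec l) as [Ha|_]; [|lra].
  destruct (active_theta2 l Ha) as [Hl Hth].
  assert (Pl := depth_pos l).
  apply Rle_trans with (lsum (fun _ => depth l * exp (- 2 ^ K l) * 1) (tree K l)).
  + apply lsum_le. intros j Hj. rewrite Rmult_1_r. unfold term, thin_term, node_of; simpl.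
    assert (P0 : 0 <= depth l * exp (- 2 ^ K l)) by (apply Rmult_le_pos; left; [auto|apply exp_pos]).
    destruct (Req_dec_T (Cmod (node l j)) 0); [exact P0|].
    rewrite Cmod_node. replace (1 - (1 - depth l)) with (depth l) by ring.
    rewrite Rmult_assoc. apply Rmult_le_compat_l; [lra|].
    apply Rle_trans with (exp (2 ^ K l) * exp (- 2 * 2 ^ K l)).
    * apply Rmult_le_compat; [left; apply exp_pos|apply Cmod_ge_0| |now apply Hfb].
      now apply exp_le_exp.
    * rewrite <- exp_plus. right. f_equal. ring.
  + rewrite lsum_scal, (lsum_tree_1 K K_0 K_S). right. field. lra.
Qed.

Lemma block_sum_le_Series (term : nat * nat -> R) (s len : nat) :
  (forall q, 0 <= term q) -> ex_series (fun k => term (p k)) ->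
  lsum term (block K active active_dec s len) <= Series (fun k => term (p k)).
Proof.
intros Ht Hs.
destruct (choice (fun q k => sel q -> p k = q)) as [idx Hidx].
{ intros q. destruct (classic (sel q)) as [H|H].
  - destruct (p_onto q H) as [k Hk]. now exists k.
  - exists 0%nat. intros H'; contradiction. }
assert (Hsel : forall q, In q (block K active active_dec s len) -> sel q).
{ intros [l j] H. apply in_block in H. destruct H as [_ [Ha Hj]]. now split. }
set (B := block K active active_dec s len) in *.
set (N := list_max (map idx B)).
apply Rle_trans with (sum_n (fun k => term (p k)) N); [|apply sum_n_le_Series; auto].
rewrite <- lsum_seq_sum_n.
rewrite (lsum_ext term (fun q => term (p (idx q))) B) by (intros q Hq; now rewrite Hidx by auto).
rewrite <- (lsum_map (fun k => term (p k)) idx).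
apply lsum_incl; [| |auto].
- apply NoDup_map_inj_in; [|apply (block_NoDup K K_0)].
  intros x y Hx Hy E. rewrite <- (Hidx x), <- (Hidx y), E by auto. reflexivity.
- intros k Hk. apply in_seq. split; [lia|].
  assert (Hm := proj1 (list_max_le (map idx B) N) (le_n _)).
  rewrite Forall_forall in Hm. specialize (Hm k Hk). lia.
Qed.

Lemma z_not_thin :
  (forall m, exists s len, (1 <= s)%nat /\ (m <= s)%nat /\
     INR m <= mass K active active_dec s len /\
     forall n, (s <= n < s + len)%nat -> active n ->
       4352 * (mass K active active_dec s len / depth (K n) + 2) <= theta1 (depth n)) ->
  ~ thin theta1 z.
Proof.
intros Hblk [f [[Hh [M HM]] [[w [Hw Hfw]] Hser]]]. unfold in_disc in Hw.
set (term := fun q => thin_term theta1 f (node_of q)).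
assert (Hterm0 : forall q, 0 <= term q) by (intros q; apply thin_term_nonneg, Cmod_node_lt1).
set (T := Series (fun k => term (p k))).
set (rw := 1 - Cmod w). assert (Hrw : 0 < rw) by (unfold rw; lra).
(* From level [N] on, the nodes are closer than [rw / 2] to the circle, so they stay at distance at
   least [rw / 2] from [w]. *)
destruct (depth_lt_eventually (rw / 2) ltac:(lra)) as [N HN].
(* The right side does not depend on the block, while the left side grows linearly in [m] unless
   [f w = 0]; [exp x >= 1 + x] suffices for this. *)
assert (Hmain : forall m, rw / 8 * INR m * Cmod (f w) <= 4 / rw * (M + T)).
{ intros m. destruct (Hblk (m + N)%nat) as [s [len [Hs1 [Hsm [Hmass Hth]]]]].
  set (B := block K active active_dec s len).
  set (mu := mass K active active_dec s len) in *.
  assert (HB : forall q, In q B -> sel q /\ (s <= fst q < s + len)%nat).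
  { intros [l j] H. apply in_block in H. destruct H as [Hl [Ha Hj]]. split; [split|]; auto. }
  set (Z := map node_of B).
  assert (HZ : forall a, In a Z -> Cmod a < 1).
  { intros a Ha. apply in_map_iff in Ha. destruct Ha as [q [<- _]]. apply Cmod_node_lt1. }
  assert (Hfar : forall q, In q B -> rw / 2 <= Cmod (node_of q - w)).
  { intros q Hq. destruct (HB q Hq) as [_ Hl]. specialize (HN (fst q) ltac:(lia)).
    eapply Rle_trans; [|apply Cmod_sub_ge]. unfold node_of. rewrite Cmod_node. unfold rw in *. lra. }
  assert (HwZ : ~ In w Z).
  { intros H. apply in_map_iff in H. destruct H as [q [E Hq]]. specialize (Hfar q Hq).
    rewrite E in Hfar. replace (w - w)%C with (RtoC 0) in Hfar by ring. rewrite Cmod_0 in Hfar. lra. }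
  assert (HndZ : NoDup Z).
  { apply NoDup_map_inj_in; [|apply (block_NoDup K K_0)].
    intros x y Hx Hy. apply node_of_inj; now apply HB. }
  assert (Hres := residue_inequality f M w Z Hh HM Hw HZ HndZ HwZ).
  assert (Hprod := rblaschke_prod_ge w Z Hw HZ HwZ).
  assert (Hms : lsum (fun a => 1 - Cmod a) Z = mu).
  { unfold Z. rewrite lsum_map. apply (block_mass K K_0 K_S). }
  rewrite Hms in Hprod. fold rw in Hprod.
  assert (Hsum : lsum (fun a => Cmod (residue_coeff w Z a) * Cmod (f a)) Z <= 4 / rw * T).
  { apply Rle_trans with (4 / rw * lsum term B).
    2:{ apply Rmult_le_compat_l; [left; apply Rdiv_lt_0_compat; lra|].
        now apply block_sum_le_Series. }
    unfold Z at 2. rewrite lsum_map, <- lsum_scal. apply lsum_le. intros q Hq.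
    destruct (HB q Hq) as [Hsel Hl]. destruct (sel_lt q Hsel) as [Hq1 Hq2].
    assert (Hf1 := Hfar q Hq).
    assert (Hcq : Cmod (node_of q) = 1 - depth (fst q)) by apply Cmod_node.
    assert (Ht : 0 < depth (fst q) <= / 2) by (split; [apply depth_pos|now apply depth_le_half]).
    assert (Hco : Cmod (residue_coeff w Z (node_of q)) <=
       (1 - Cmod (node_of q) ^ 2) / Cmod (node_of q - w) * exp (17 / 2 * lsum (pick (node_of q)) Z)).
    { apply residue_coeff_bound; auto.
      - apply Cmod_node_lt1.
      - intros E. apply HwZ. rewrite <- E. now apply in_map.
      - intros j Hj Hne. apply in_map_iff in Hj. destruct Hj as [q' [<- Hq']].
        apply sel_pick; [exact Hsel|now apply HB|]. intros E. apply Hne. now rewrite E. }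
    assert (Hpk : lsum (pick (node_of q)) Z <= 512 * (mu / depth (K (fst q)) + 2)).
    { unfold Z. rewrite lsum_map. apply (block_pick_sum K K_0 K_S); auto. apply Hsel. }
    assert (Hthq := Hth (fst q) Hl (proj1 Hsel)).
    (* Here [17 / 2 * 512 = 4352] meets the constant of the block condition: the loss from small
       pseudo-hyperbolic distances is paid for by the weight [exp theta1]. *)
    assert (Hexp : exp (17 / 2 * lsum (pick (node_of q)) Z) <= exp (theta1 (depth (fst q)))).
    { assert (H : 17 / 2 * lsum (pick (node_of q)) Z <= theta1 (depth (fst q))) by lra.
      now apply exp_le_exp. }
    unfold term, thin_term. destruct (Req_dec_T (Cmod (node_of q)) 0) as [E0|_]; [lra|].
    rewrite Hcq in *. replace (1 - (1 - depth (fst q))) with (depth (fst q)) by ring.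
    set (t := depth (fst q)) in *.
    replace (4 / rw * (t * exp (theta1 t) * Cmod (f (node_of q))))
      with (4 / rw * t * exp (theta1 t) * Cmod (f (node_of q))) by ring.
    apply Rmult_le_compat_r; [apply Cmod_ge_0|].
    eapply Rle_trans; [exact Hco|].
    apply Rmult_le_compat; [|left; apply exp_pos| |exact Hexp].
    - apply Rmult_le_pos; [nra|]. left. apply Rinv_0_lt_compat. lra.
    - replace (4 / rw * t) with ((2 * t) * / (rw / 2)) by (field; lra).
      apply Rmult_le_compat; [nra|left; apply Rinv_0_lt_compat; lra|nra|].
      apply Rinv_le_contravar; lra. }
  assert (Pf := Cmod_ge_0 (f w)).
  assert (Hexp := exp_ineq1_le (rw / 8 * mu)).
  assert (Hm : INR m <= mu).
  { rewrite plus_INR in Hmass. assert (P := pos_INR N). lra. }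
  assert (Hge : rw / 8 * INR m * Cmod (f w) <= Cmod (lCprod (fun j => rblaschke j w) Z) * Cmod (f w)).
  { apply Rmult_le_compat_r; auto.
    assert (rw / 8 * INR m <= rw / 8 * mu) by (apply Rmult_le_compat_l; lra). lra. }
  fold rw in Hres. replace (4 * M / rw) with (4 / rw * M) in Hres by (field; lra). lra. }
assert (Hfw0 : 0 < Cmod (f w)) by now apply Cmod_gt_0.
set (c := rw / 8 * Cmod (f w)). assert (Hc : 0 < c) by (apply Rmult_lt_0_compat; lra).
destruct (INR_unbounded (4 / rw * (M + T) / c)) as [m Hm].
specialize (Hmain m).
apply (Rlt_div_l _ _ c Hc) in Hm. unfold c in Hm. lra.
Qed.

End Construction.

Lemma lsum_pos_witness (g : nat -> R) (l : list nat) : 0 < lsum g l -> exists x, In x l /\ 0 < g x.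
Proof.
induction l as [|x l IH]; simpl; intros H; [lra|].
destruct (Rlt_dec 0 (g x)) as [Hx|Hx]; [exists x; auto|].
destruct IH as [y [Hy Hgy]]; [lra|]. exists y; auto.
Qed.

Lemma Lambda_strict (theta1 theta2 : R -> R) :
  filterlim (fun t => theta1 t / theta2 t) (at_right 0) (Rbar_locally p_infty) ->
  positive_on_01 theta2 -> continuous_on_01 theta2 -> nonincreasing_on_01 theta2 ->
  int_diverges_at_0 (fun t => / (t * theta2 t)) ->
  exists z : nat -> C, Lambda theta2 z /\ ~ Lambda theta1 z.
Proof.
intros Hratio Hpos Hcont Hmono Hdiv.
destruct (level_selection (fun n => theta1 (depth n)) (fun n => theta2 (depth n)))
  as [K [active [active_dec [K0 [KS [Hact [Hblk [S HS]]]]]]]].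
- intros n Hn. apply Hpos, depth_in_01, Hn.
- intros n Hn. assert (D := depth_in_01 n Hn). assert (D' := depth_pos n).
  apply Hmono; [apply depth_pos|rewrite depth_S; lra|apply D].
- now apply dyadic_divergence.
- now apply dyadic_ratio.
- destruct (node_enumeration (fun q => active (fst q) /\ In (snd q) (tree K (fst q))))
    as [p [Hp1 [Hp2 [Hp3 Hp4]]]].
  + intros n i [_ Hi]. apply (tree_lt K K0 _ _ Hi).
  (* A block of positive mass contains an active level, and each level of the tree contains the
     index 0; hence infinitely many nodes are selected. *)
  + intros N. destruct (Hblk (Datatypes.S N)) as [s [len [H1 [H2 [H3 _]]]]].
    rewrite S_INR in H3. assert (P := pos_INR N).
    destruct (lsum_pos_witness _ _ (Rlt_le_trans 0 (INR N + 1) _ ltac:(lra) H3)) as [n [Hn Hg]].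
    apply in_seq in Hn. destruct (active_dec n) as [Ha|]; [|lra].
    exists n, 0%nat. split; [lia|]. split; [exact Ha|]. apply tree_0.
  + exists (fun k => node_of (p k)). split.
    * split; [|split].
      -- now apply z_disc_sequence.
      -- now apply (z_separated theta2 K active).
      -- now apply (z_thin theta2 K active active_dec) with S.
    * intros [_ [_ Hthin]]. revert Hthin.
      now apply (z_not_thin theta1 theta2 K active active_dec).
Qed.

(* Real functions on (0,1) are represented by total functions R -> R; only
   their values on (0,1) matter. *)
Theorem theorem1p4 (theta1 theta2 : R -> R) :
  (positive_on_01 theta1 ->
   positive_on_01 theta2 ->
   comparable_on_01 theta1 theta2 ->
   forall z : nat -> C, Lambda theta1 z <-> Lambda theta2 z)
  /\
  (filterlim (fun t => theta1 t / theta2 t) (at_right 0) (Rbar_locally p_infty) ->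
   positive_on_01 theta2 ->
   continuous_on_01 theta2 ->
   nonincreasing_on_01 theta2 ->
   int_diverges_at_0 (fun t => / (t * theta2 t)) ->
   exists z : nat -> C, Lambda theta2 z /\ ~ Lambda theta1 z).
Proof.
split; [|apply Lambda_strict].
intros H1 H2 [c [D [Hc [HcD Hcomp]]]] z. split.
- destruct (INR_unbounded (/ c)) as [p Hp]. apply (Lambda_of_le theta1 theta2 p).
  intros t Ht. destruct (Hcomp t Ht) as [Hl _]. specialize (H1 t Ht).
  apply Rle_trans with (/ c * theta1 t).
  + apply Rmult_le_reg_l with c; [exact Hc|]. rewrite <- Rmult_assoc, Rinv_r by lra. lra.
  + apply Rmult_le_compat_r; [lra|]. rewrite S_INR. lra.
- destruct (INR_unbounded D) as [p Hp]. apply (Lambda_of_le theta2 theta1 p).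
  intros t Ht. destruct (Hcomp t Ht) as [_ Hr]. specialize (H2 t Ht).
  eapply Rle_trans; [exact Hr|]. apply Rmult_le_compat_r; [lra|]. rewrite S_INR. lra.
Qed.
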